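(* Let $K$ be an algebraically closed field of characteristic $0$; characters are $K$-characters. Let $G=\mathrm{GL}_n(q)$, $n\ge2$, let $(\lambda_1,\dots,\lambda_r)$ be a composition of $n$ with $r\ge2$, and let $L_0\cong\mathrm{GL}_{\lambda_1}(q)\times\cdots\times\mathrm{GL}_{\lambda_r}(q)$ be the corresponding proper standard Levi subgroup of $G$ (block diagonal matrices). Let $\psi=\psi_1\otimes\cdots\otimes\psi_r$ be a cuspidal irreducible character of $L_0$, where $\psi_i$ is an irreducible cuspidal character of $\mathrm{GL}_{\lambda_i}(q)$. If $\lambda_1=\lambda_2=\cdots=\lambda_r$ and $\psi_1=\psi_2=\cdots=\psi_r$, then every irreducible constituent of $R_{L_0}^G(\psi)$ is Harish-Chandra primitive. Otherwise every such constituent is Harish-Chandra imprimitive.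
   Context: $R_{L}^G$ denotes Harish-Chandra induction (inflation to a parabolic subgroup with Levi complement $L$, followed by induction to $G$). An irreducible character of $G$ is Harish-Chandra imprimitive if it equals $R_L^G(\vartheta)$ for some character $\vartheta$ of a proper Levi subgroup $L$ of $G$; otherwise it is Harish-Chandra primitive. *)

(* Defs.v *)
From mathcomp Require Import all_boot all_order all_algebra all_fingroup.
From mathcomp Require Import all_solvable all_character.

Set Implicit Arguments.
Unset Strict Implicit.
Unset Printing Implicit Defensive.

Import GRing.Theory.
Local Open Scope ring_scope.

(* MathComp's class functions 'CF(G) are algC-valued.  The definitions below
   follow the same conventions over an arbitrary field K: a character of a
   subgroup G of gT is a function on gT that vanishes outside G, and the zero
   function (afforded by the representation of degree 0) is a character. *)
Section Characters.

Variables (K : fieldType) (gT : finGroupType).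
Implicit Types (G H P U L : {group gT}) (phi chi theta : {ffun gT -> K}).

Definition repr_char G d (rG : mx_representation K G d) : {ffun gT -> K} :=
  [ffun x => \tr (rG x) *+ (x \in G)].

Definition is_char G phi : Prop :=
  exists d (rG : mx_representation K G d), phi = repr_char rG.

Definition is_irr_char G chi : Prop :=
  exists d (rG : mx_representation K G d),
    mx_irreducible rG /\ chi = repr_char rG.

Definition irr_constituent G phi chi : Prop :=
  is_irr_char G chi /\ exists2 xi, is_char G xi & phi = chi + xi.

Definition char_ind G P phi : {ffun gT -> K} :=
  [ffun x => (#|P|%:R)^-1 * \sum_(y in G) phi (x ^ y)%g].

(* remgr U L x is the L-component of x in P = U ><| L. *)
Definition char_infl P U L theta : {ffun gT -> K} :=
  [ffun x => theta (remgr U L x) *+ (x \in P)].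

Definition HC_ind G P U L theta : {ffun gT -> K} :=
  char_ind G P (char_infl P U L theta).

End Characters.

Definition is_composition (mu : seq nat) (n : nat) : bool :=
  (0%N \notin mu) && (sumn mu == n).

(* MathComp's {'GL_n[F]} consists of matrices of size n.-1.+1, which is n as
   soon as 0 < n. *)
Section StandardParabolics.

Variables (F : finFieldType) (n : nat) (mu : seq nat).

(* Number of the block of mu that contains the row (or column) index a. *)
Definition block_of (a : 'I_n.-1.+1) : nat := reshape_index mu a.

Definition std_parabolic : {set {'GL_n[F]}} :=
  [set x : {'GL_n[F]} | [forall a, forall b,
     (GLval x a b != 0) ==> (block_of a <= block_of b)%N]].

Definition std_levi : {set {'GL_n[F]}} :=
  [set x : {'GL_n[F]} | [forall a, forall b,
     (GLval x a b != 0) ==> (block_of a == block_of b)]].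

Definition std_unipotent : {set {'GL_n[F]}} :=
  [set x in std_parabolic | [forall a, forall b,
     (block_of a == block_of b) ==> (GLval x a b == (a == b)%:R)]].

Lemma std_parabolicP x :
  reflect (forall a b, GLval x a b != 0 -> (block_of a <= block_of b)%N)
          (x \in std_parabolic).
Proof.
rewrite inE; apply: (iffP forallP) => [h a b | h a].
  by move/forallP/(_ b)/implyP: (h a).
by apply/forallP=> b; apply/implyP; apply: h.
Qed.

Lemma std_leviP x :
  reflect (forall a b, GLval x a b != 0 -> block_of a = block_of b)
          (x \in std_levi).
Proof.
rewrite inE; apply: (iffP forallP) => [h a b | h a].
  by move/forallP/(_ b)/implyP: (h a) => h' /h' /eqP.
by apply/forallP=> b; apply/implyP=> /h ->.
Qed.

Lemma std_unipotentP x :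
  reflect (x \in std_parabolic /\
           forall a b, block_of a = block_of b -> GLval x a b = (a == b)%:R)
          (x \in std_unipotent).
Proof.
apply: (iffP setIdP) => -[Px h]; split=> //.
  by move=> a b /eqP eab; move/forallP/(_ a)/forallP/(_ b)/implyP/(_ eab)/eqP: h.
by apply/forallP=> a; apply/forallP=> b; apply/implyP=> /eqP /h ->.
Qed.

Let mulGL_neq0 (x y : {'GL_n[F]}) a b : GLval (x * y)%g a b != 0 ->
  exists2 c, GLval x a c != 0 & GLval y c b != 0.
Proof.
rewrite GL_MxE mxE => nz.
have [/existsP[c /andP[? ?]]|/existsPn h] :=
  boolP [exists c, (GLval x a c != 0) && (GLval y c b != 0)]; first by exists c.
case/eqP: nz; rewrite big1 // => c _.
by move: (h c); rewrite negb_and !negbK => /orP[] /eqP ->; rewrite ?mul0r ?mulr0.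
Qed.

Let GL1_neq0 a b : GLval (1 : {'GL_n[F]})%g a b != 0 -> a = b.
Proof. by rewrite GL_1E mxE; case: (a =P b) => //; rewrite eqxx. Qed.

Fact std_parabolic_group_set : group_set std_parabolic.
Proof.
apply/group_setP; split=> [|x y /std_parabolicP Px /std_parabolicP Py].
  by apply/std_parabolicP=> a b /GL1_neq0 ->.
by apply/std_parabolicP=> a b /mulGL_neq0[c /Px le_ac /Py]; apply: leq_trans.
Qed.
Canonical std_parabolic_group := Group std_parabolic_group_set.

Fact std_levi_group_set : group_set std_levi.
Proof.
apply/group_setP; split=> [|x y /std_leviP Lx /std_leviP Ly].
  by apply/std_leviP=> a b /GL1_neq0 ->.
by apply/std_leviP=> a b /mulGL_neq0[c /Lx -> /Ly].
Qed.
Canonical std_levi_group := Group std_levi_group_set.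

Fact std_unipotent_group_set : group_set std_unipotent.
Proof.
apply/group_setP; split=> [|x y /std_unipotentP[Px Ux] /std_unipotentP[Py Uy]].
  apply/std_unipotentP; split=> [|a b _]; first exact: group1.
  by rewrite GL_1E mxE.
apply/std_unipotentP; split=> [|a b eab]; first exact: groupM.
rewrite GL_MxE mxE (bigD1 a) //= Ux // eqxx mul1r Uy // big1 ?addr0 // => c ca.
have [-> | nzx] := eqVneq (GLval x a c) 0; first by rewrite mul0r.
have [-> | nzy] := eqVneq (GLval y c b) 0; first by rewrite mulr0.
have eac : block_of a = block_of c.
  apply/eqP; rewrite eqn_leq (std_parabolicP _ Px) //= eab.
  exact: (std_parabolicP _ Py).
by rewrite Ux // eq_sym (negPf ca) mul0r.
Qed.
Canonical std_unipotent_group := Group std_unipotent_group_set.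

(* The i-th diagonal block.  It is invertible for x in std_levi; the default
   value 1 of insubd is used only for x outside the Levi subgroup. *)
Definition diag_block (i : nat) (x : {'GL_n[F]}) : {'GL_(nth 0%N mu i)[F]} :=
  insubd (1%g : {'GL_(nth 0%N mu i)[F]})
    (\matrix_(a, b) GLval x (inord (flatten_index mu i a))
                            (inord (flatten_index mu i b))).

End StandardParabolics.

Section HarishChandra.

Variables (K : fieldType) (F : finFieldType).

(* Type of the K-valued functions on GL_m(F), indexed by m. *)
Definition GLfun (m : nat) := {ffun {'GL_m[F]} -> K}.

Section FixedDegree.

Variable n : nat.
Implicit Types (P U L : {group {'GL_n[F]}}) (chi : GLfun n).

(* P is a parabolic subgroup of GL_n(F) with unipotent radical U and Levi
   complement L: up to conjugacy, these are the standard ones. *)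
Definition levi_decomposition P U L : Prop :=
  exists (mu : seq nat) (g : {'GL_n[F]}),
    [/\ is_composition mu n, P = (std_parabolic F n mu :^ g)%G,
        U = (std_unipotent F n mu :^ g)%G & L = (std_levi F n mu :^ g)%G].

Definition cuspidal chi : Prop :=
  forall P U L (theta : GLfun n),
    levi_decomposition P U L -> L \proper 'GL_n[F]%g -> is_char L theta ->
  ~ irr_constituent 'GL_n[F] (HC_ind 'GL_n[F] P U L theta) chi.

Definition HC_imprimitive chi : Prop :=
  exists P U L (theta : GLfun n),
    [/\ levi_decomposition P U L, L \proper 'GL_n[F]%g, is_char L theta
      & chi = HC_ind 'GL_n[F] P U L theta].

Definition HC_primitive chi : Prop := ~ HC_imprimitive chi.

(* The outer tensor product of the psi i, as a character of std_levi. *)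
Definition levi_tensor (lam : seq nat)
    (psi : forall i : 'I_(size lam), GLfun (nth 0%N lam i)) : GLfun n :=
  [ffun x => (\prod_i psi i (diag_block lam i x)) *+ (x \in std_levi F n lam)].

End FixedDegree.

(* Equality of dependent pairs: nth 0 lam i = nth 0 lam j and, along this equality,
   psi i = psi j. *)
Definition all_factors_equal (lam : seq nat)
    (psi : forall i : 'I_(size lam), GLfun (nth 0%N lam i)) : Prop :=
  forall i j, Tagged GLfun (psi i) = Tagged GLfun (psi j).

End HarishChandra.

(* Main.v *)
Require Import Defs.
From mathcomp Require Import all_boot all_order all_algebra all_fingroup.
From mathcomp Require Import all_solvable all_character.
From mathcomp Require Import ring zify.

Set Implicit Arguments.
Unset Strict Implicit.
Unset Printing Implicit Defensive.

Import GRing.Theory.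
Local Open Scope ring_scope.

(* The parabolic subgroups containing the diagonal torus are the subgroups P_c
   attached to colorings c of the indices.  Mackey's formula and the Bruhat
   decomposition reduce all inner products to permutation matrices; by cuspidality
   only those which stabilise L_0 and psi contribute, so that R_{L_0}^G(psi) does not
   depend on the parabolic subgroup used to define it.

   If the psi_i are not all equal, color a block by whether its factor is psi_1.  The
   stabiliser of psi preserves this coloring c, so psi induced to P_c has the same norm
   as R_{L_0}^G(psi), and induction from P_c to G maps its irreducible constituents to
   irreducible characters.

   If all psi_i are equal, suppose that a constituent of R_{L_0}^G(psi) is R_c(theta)
   with c not constant.  After conjugation c is a union of L_0-blocks.  Let t swap two
   blocks of different colors which are extremal in the order that compares c first
   and the blocks of L_0 next.  A constituent of the inflation of theta that lies above
   psi is invariant under t, hence t, which is not in P_c, contributes to the norm of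
   R_c(theta), and the latter is not irreducible. *)

(** * Characters over an algebraically closed field of characteristic 0 *)

(** K carries neither a complex conjugation nor an order. Inner products therefore pair f x with h
    x^-1, and positivity is recovered from dimensions: the inner product of two characters is the
    dimension of a space of intertwiners, hence a natural number, and so is every term of Mackey's
    sum. In characteristic 0 such a sum vanishes only termwise; all norm arguments rest on this.

    The parabolic subgroup defining R_{L_0}^G(psi) is only known to be a conjugate of a standard
    one. The conjugating element need not be a permutation matrix times an element of L_0, because
    over F_2 blocks of size 1 leave no trace in L_0. It acts on the Levi subgroup like such a
    product, however, and the induced character depends on nothing else.

    In the case of equal factors, P_c and its conjugate under t meet inside a smaller parabolic
    subgroup P_e whose Levi subgroup has the two swapped blocks as separate factors. The blocks are
    taken extremal so that P_e still contains a parabolic subgroup with Levi subgroup L_0; this is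
    what allows psi to be compared with a constituent of the restriction to P_e. *)

Section Matrices.

Variable K : fieldType.

(** With C = [col_base E] and B = [row_base E], idempotence reads C B C B = C B, and both outer
    factors can be cancelled. *)
Lemma idem_base n (E : 'M[K]_n) : E *m E = E -> row_base E *m col_base E = 1%:M.
Proof.
move=> EE; have CB := mulmx_base E.
apply: (row_full_inj (col_base_full E)); apply: (row_free_inj (row_base_free E)).
by rewrite mulmx1 mulmxA CB -mulmxA CB.
Qed.

Lemma mxtrace_idem n (E : 'M[K]_n) : E *m E = E -> \tr E = (\rank E)%:R.
Proof. by move/idem_base=> BC; rewrite -{1}(mulmx_base E) mxtrace_mulC BC mxtrace1. Qed.

(** The map M -> A M B is a tensor product. Its trace turns products of character values into traces
    on a space of matrices. *)
Lemma mxtrace_mulmx_mulmxr n1 n2 (A : 'M[K]_n1) (B : 'M[K]_n2) :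
  \tr (lin_mx (mulmxr B \o mulmx A)) = \tr A * \tr B.
Proof.
rewrite /mxtrace (reindex _ (curry_mxvec_bij _ _)) /=.
rewrite big_distrl /=.
rewrite (eq_bigr (fun p => lin_mx (mulmxr B \o mulmx A) (mxvec_index p.1 p.2)
  (mxvec_index p.1 p.2))) => [|[] //].
rewrite -(pair_bigA _ (fun i j => lin_mx (mulmxr B \o mulmx A)
  (mxvec_index i j) (mxvec_index i j))) /=.
apply: eq_bigr => i _; rewrite big_distrr /=; apply: eq_bigr => j _.
rewrite /lin_mx /lin1_mx mxE /= vec_mx_delta mxvecE.
rewrite mxE (bigD1 j) //= big1 => [|k kj]; last first.
  rewrite mxE big1 ?mul0r // => l _.
  by rewrite mxE (negPf kj) andbF mulr0.
rewrite addr0 mxE (bigD1 i) //= big1 => [|k ki]; last first.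
  by rewrite mxE (negPf ki) mulr0.
by rewrite mxE !eqxx mulr1 addr0.
Qed.

End Matrices.

Section Characters.

Variable K : closedFieldType.
Hypothesis charK0 : [pchar K] =i pred0.
Variable gT : finGroupType.
Implicit Types (G H N P Q S T : {group gT}) (f h phi chi psi omega tau : {ffun gT -> K}).

Lemma natK_eq0 n : (n%:R == 0 :> K) = (n == 0)%N.
Proof. by have/pcharf0P-> := charK0. Qed.

Lemma natK_inj m n : m%:R = n%:R :> K -> m = n.
Proof.
have wlog_inj m' n' : (m' <= n')%N -> m'%:R = n'%:R :> K -> m' = n'.
  move=> le_mn /eqP; rewrite -(subnKC le_mn) natrD -subr_eq0 opprD addrA subrr.
  by rewrite add0r oppr_eq0 natK_eq0 => /eqP ->; rewrite addn0.
move=> eq_mn; have [/wlog_inj-> // | /ltnW/wlog_inj-> //] := leqP m n.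
Qed.

Lemma card_neq0 G : #|G|%:R != 0 :> K.
Proof. by rewrite natK_eq0 -lt0n cardG_gt0. Qed.

(** Bilinear: the inverse replaces complex conjugation. The domain is a bare set, so that
    intersections of parabolic subgroups can be used as they are. *)
Definition cdot (G : {set gT}) (f h : gT -> K) : K :=
  #|G|%:R^-1 * \sum_(x in G) f x * h x^-1%g.

Lemma cdotC G (f h : gT -> K) : cdot G f h = cdot G h f.
Proof.
rewrite /cdot (reindex_inj invg_inj) /=; congr (_ * _).
by apply: eq_big => [x | x _]; rewrite ?groupV // invgK mulrC.
Qed.

Lemma cdotDl G f1 f2 (h : gT -> K) : cdot G (f1 + f2) h = cdot G f1 h + cdot G f2 h.
Proof.
rewrite /cdot -mulrDr -big_split; congr (_ * _); apply: eq_bigr => x _ /=.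
by rewrite ffunE mulrDl.
Qed.

Lemma cdotDr G (f : gT -> K) h1 h2 : cdot G f (h1 + h2) = cdot G f h1 + cdot G f h2.
Proof. by rewrite !(cdotC _ f) cdotDl. Qed.

Lemma cdot0l G (h : gT -> K) : cdot G (0 : {ffun gT -> K}) h = 0.
Proof. by rewrite /cdot big1 ?mulr0 // => x _; rewrite ffunE mul0r. Qed.

Lemma cdot_suml G (s : seq {ffun gT -> K}) (h : gT -> K) :
  cdot G (\sum_(f <- s) f : {ffun gT -> K}) h = \sum_(f <- s) cdot G f h.
Proof.
exact: (big_morph (fun f : {ffun gT -> K} => cdot G f h)
  (fun f1 f2 => cdotDl G f1 f2 h) (cdot0l G h)).
Qed.

Lemma eq_cdot (A : {set gT}) (f f' h h' : gT -> K) :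
  (forall x, x^-1%g \in A = (x \in A)) ->
  {in A, f =1 f'} -> {in A, h =1 h'} -> cdot A f h = cdot A f' h'.
Proof.
move=> AV ff hh; rewrite /cdot; congr (_ * _); apply: eq_bigr => x Ax.
by rewrite ff ?hh ?AV.
Qed.

Lemma eq_cdotG G (f f' h h' : gT -> K) :
  {in G, f =1 f'} -> {in G, h =1 h'} -> cdot G f h = cdot G f' h'.
Proof. by apply: eq_cdot => x; rewrite groupV. Qed.

Section ReprChar.

Variables (G : {group gT}) (n : nat) (rG : mx_representation K G n).

Lemma repr_charE x : x \in G -> repr_char rG x = \tr (rG x).
Proof. by rewrite ffunE => ->. Qed.

Lemma repr_char1 : repr_char rG 1%g = n%:R.
Proof. by rewrite repr_charE // repr_mx1 mxtrace1. Qed.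

End ReprChar.

Lemma char_out G phi x : is_char G phi -> x \notin G -> phi x = 0.
Proof. by move=> [d [rG ->]] /negPf G'x; rewrite ffunE G'x. Qed.

Lemma charJ G phi x y : is_char G phi -> y \in G -> phi (x ^ y)%g = phi x.
Proof.
move=> [d [rG ->]] Gy; rewrite !ffunE groupJr //; case: (boolP (x \in G)) => Gx //.
by rewrite !repr_mxM ?groupM ?groupV // mxtrace_mulC repr_mxK.
Qed.

Lemma irr_is_char G chi : is_irr_char G chi -> is_char G chi.
Proof. by move=> [d [rG [_ ->]]]; exists d, rG. Qed.

Lemma is_char0 G : is_char G (0 : {ffun gT -> K}).
Proof.
exists 0, (@grepr0 K gT G); apply/ffunP=> x.
by rewrite !ffunE mxtrace1 mul0rn.
Qed.

Lemma is_charD G phi psi : is_char G phi -> is_char G psi -> is_char G (phi + psi).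
Proof.
move=> [n1 [r1 ->]] [n2 [r2 ->]].
exists _, (dadd_grepr (Representation r1) (Representation r2)).
by apply/ffunP=> x; rewrite !ffunE mxtrace_block mulrnDl.
Qed.

Lemma is_char_sum G (s : seq {ffun gT -> K}) :
  (forall chi, chi \in s -> is_char G chi) -> is_char G (\sum_(chi <- s) chi).
Proof.
elim: s => [|chi s IHs] irr_s; first by rewrite big_nil; apply: is_char0.
rewrite big_cons; apply: is_charD; first by apply: irr_s; rewrite mem_head.
by apply: IHs => xi xi_s; apply: irr_s; rewrite inE xi_s orbT.
Qed.

(** E projects onto a submodule. In the factorisation E = C B, the matrices B rG(x) C represent G on
    it. *)
Lemma is_char_idem G n (rG : mx_representation K G n) (E : 'M_n) :
    E *m E = E -> {in G, forall x, E *m rG x = rG x *m E} ->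
  is_char G [ffun x => \tr (E *m rG x) *+ (x \in G)].
Proof.
move=> EE cE; have BC := idem_base EE; have CB := mulmx_base E.
move: (row_base E) (col_base E) BC CB => B C BC CB.
have EC : E *m C = C by rewrite -[X in X *m C = _]CB -mulmxA BC mulmx1.
have rP : mx_repr G (fun x => B *m rG x *m C).
  split=> [|x y Gx Gy]; first by rewrite repr_mx1 mulmx1.
  by rewrite repr_mxM // !mulmxA -(mulmxA (B *m rG x) C B) CB -(mulmxA (B *m rG x) E) cE // mulmxA -(mulmxA _ E) EC.
exists _, (MxRepresentation rP); apply/ffunP=> x; rewrite !ffunE /=.
by rewrite [in RHS]mxtrace_mulC mulmxA CB.
Qed.

Definition mx_hom G n1 n2 (r1 : gT -> 'M[K]_n1) (r2 : gT -> 'M[K]_n2)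
    (A : 'M_(n1, n2)) :=
  {in G, forall x, r1 x *m A = A *m r2 x}.

(** Averaging A -> r1(x) A r2(x)^-1 over Q gives a projection E onto the intertwiners. Its trace is
    the inner product on the one hand and its rank on the other. *)
Lemma cdot_mx_hom Q G1 G2 n1 n2 (r1 : mx_representation K G1 n1)
    (r2 : mx_representation K G2 n2) : Q \subset G1 -> Q \subset G2 ->
  exists2 E : 'M_(n1 * n2), cdot Q (repr_char r1) (repr_char r2) = (\rank E)%:R &
    forall A, (mxvec A <= E)%MS <-> mx_hom Q r1 r2 A.
Proof.
move=> /subsetP sQ1 /subsetP sQ2.
pose L x := lin_mx (mulmxr (r2 x^-1%g) \o mulmx (r1 x)).
pose E := #|Q|%:R^-1 *: \sum_(x in Q) L x.
have EE A : mxvec A *m E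
    = mxvec (#|Q|%:R^-1 *: \sum_(x in Q) r1 x *m A *m r2 x^-1%g).
  rewrite -scalemxAr mulmx_sumr linearZ_LR; congr (_ *: _); rewrite linear_sum.
  by apply: eq_bigr => x _; rewrite mul_vec_lin.
have homE A : mx_hom Q r1 r2 (vec_mx (mxvec A *m E)).
  move=> y Qy; rewrite EE mxvecK -scalemxAr -scalemxAl; congr (_ *: _).
  rewrite mulmx_sumr mulmx_suml [in RHS](reindex_inj (mulgI y)) /=.
  apply: eq_big => [x | x Qx]; first by rewrite groupMl.
  rewrite invMg !repr_mxM ?groupV ?sQ1 ?sQ2 //.
  by rewrite -!mulmxA -repr_mxM ?groupV ?sQ2 // mulVg repr_mx1 mulmx1.
have Ehom A : mx_hom Q r1 r2 A -> mxvec A *m E = mxvec A.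
  move=> homA; rewrite EE; congr mxvec.
  rewrite (eq_bigr (fun=> A)) => [|x Qx]; last first.
    by rewrite homA // -mulmxA -repr_mxM ?groupV ?sQ2 // mulgV repr_mx1 mulmx1.
  by rewrite sumr_const -scaler_nat scalerA mulVf ?card_neq0 // scale1r.
have EidE : E *m E = E.
  apply/row_matrixP=> i; rewrite row_mul -[row i E]vec_mxK; apply: Ehom.
  by rewrite rowE -[delta_mx _ _]vec_mxK; apply: homE.
exists E => [|A]; last first.
  split=> [/submxP[v] | /Ehom <-]; last exact: submxMl.
  by rewrite -[v]vec_mxK => /(canRL mxvecK)->; apply: homE.
rewrite -mxtrace_idem // /E linearZ linear_sum /cdot /=; congr (_ * _).
apply: eq_bigr => x Qx.
by rewrite /L mxtrace_mulmx_mulmxr !repr_charE ?groupV ?sQ1 ?sQ2.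
Qed.

Lemma cdot_neq0P Q G1 G2 n1 n2 (r1 : mx_representation K G1 n1)
    (r2 : mx_representation K G2 n2) : Q \subset G1 -> Q \subset G2 ->
  cdot Q (repr_char r1) (repr_char r2) != 0 <->
    exists2 A : 'M_(n1, n2), A != 0 & mx_hom Q r1 r2 A.
Proof.
move=> sQ1 sQ2; have [E -> homE] := cdot_mx_hom r1 r2 sQ1 sQ2.
rewrite natK_eq0 mxrank_eq0; split=> [nzE | [A nzA /homE sAE]]; last first.
  apply: contraNneq nzA => E0; move: sAE.
  by rewrite E0 submx0 mxvec_eq0.
exists (vec_mx (nz_row E)).
  by rewrite vec_mx_eq0 nz_row_eq0.
by apply/homE; rewrite vec_mxK nz_row_sub.
Qed.

Lemma cdot_nat Q G1 G2 phi psi : Q \subset G1 -> Q \subset G2 ->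
  is_char G1 phi -> is_char G2 psi -> exists m : nat, cdot Q phi psi = m%:R.
Proof.
move=> sQ1 sQ2 [n1 [r1 ->]] [n2 [r2 ->]].
by have [E -> _] := cdot_mx_hom r1 r2 sQ1 sQ2; exists (\rank E).
Qed.

(** An intertwiner over Q is also one over the subgroup S. *)
Lemma cdot_sub_neq0 S Q G1 G2 phi psi : S \subset Q ->
    Q \subset G1 -> Q \subset G2 -> is_char G1 phi -> is_char G2 psi ->
  cdot Q phi psi != 0 -> cdot S phi psi != 0.
Proof.
move=> sSQ sQ1 sQ2 [n1 [r1 ->]] [n2 [r2 ->]] /cdot_neq0P[] // A nzA homA.
apply/cdot_neq0P; rewrite ?(subset_trans sSQ) //; exists A => // x Sx.
by apply: homA; apply: (subsetP sSQ).
Qed.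

Lemma cdot_self_eq0 G phi : is_char G phi -> cdot G phi phi = 0 -> phi = 0.
Proof.
move=> [n [rG ->]] /eqP; apply: contraTeq => nz; apply/cdot_neq0P => //.
exists 1%:M => [|x _]; last by rewrite mulmx1 mul1mx.
apply: contraNneq nz => I0; apply/eqP/ffunP=> x; rewrite !ffunE.
by rewrite -[rG x]mulmx1 I0 mulmx0 linear0 mul0rn.
Qed.

Lemma mx_hom_irr_free G n1 n2 (r1 : mx_representation K G n1)
    (r2 : mx_representation K G n2) A :
  mx_irreducible r1 -> mx_hom G r1 r2 A -> A != 0 -> row_free A.
Proof.
move=> /mx_irrP[_ irr1] homA nzA; rewrite -kermx_eq0; apply/idPn=> nzK.
have modK : mxmodule r1 (kermx A).
  apply/mxmoduleP=> x Gx; apply/sub_kermxP.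
  by rewrite -mulmxA homA // mulmxA mulmx_ker mul0mx.
have := irr1 _ modK nzK; rewrite -sub1mx => /sub_kermxP.
by rewrite mul1mx => A0; rewrite A0 eqxx in nzA.
Qed.

Lemma mx_hom_irr_full G n1 n2 (r1 : mx_representation K G n1)
    (r2 : mx_representation K G n2) A :
  mx_irreducible r2 -> mx_hom G r1 r2 A -> A != 0 -> row_full A.
Proof.
move=> /mx_irrP[_ irr2] homA nzA.
have modA : mxmodule r2 <<A>>%MS.
  by apply/mxmoduleP=> x Gx; rewrite genmxE (eqmxMr _ (genmxE A)) -homA ?submxMl.
rewrite -sub1mx -(genmxE A) sub1mx; apply: irr2 => //.
by rewrite -mxrank_eq0 genmxE mxrank_eq0.
Qed.

Lemma irr_cdot_eq G chi1 chi2 : is_irr_char G chi1 -> is_irr_char G chi2 ->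
  cdot G chi1 chi2 != 0 -> chi1 = chi2.
Proof.
move=> [n1 [r1 [irr1 ->]]] [n2 [r2 [irr2 ->]]] /cdot_neq0P[] // A nzA homA.
have freeA := mx_hom_irr_free irr1 homA nzA.
have fullA := mx_hom_irr_full irr2 homA nzA.
have eqn : n1 = n2 by rewrite -(eqnP freeA) (eqnP fullA).
case: n2 / eqn r2 irr2 A nzA homA freeA {fullA} => r2 irr2 A nzA homA freeA.
apply/ffunP=> x; rewrite !ffunE; case: (boolP (x \in G)) => // Gx.
rewrite row_free_unit in freeA.
by rewrite -[r2 x](mulKmx freeA) -homA // mxtrace_mulC mulmxK.
Qed.

Lemma mx_irr_scalar G n (rG : mx_representation K G n) A :
  mx_irreducible rG -> {in G, forall x, A *m rG x = rG x *m A} -> is_scalar_mx A.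
Proof.
move=> irrG /centgmxP cA.
exact: mx_abs_irr_cent_scalar (group_closure_closed_field irrG) _ cA.
Qed.

(** By Schur's lemma the intertwiners form the line spanned by the identity. *)
Lemma irr_cdot1 G chi : is_irr_char G chi -> cdot G chi chi = 1.
Proof.
move=> [n [rG [irrG ->]]].
have [E -> homE] := cdot_mx_hom rG rG (subxx G) (subxx G).
suffices -> : \rank E = 1%N by [].
have [n_gt0 _] := proj1 (mx_irrP rG) irrG.
have nz1 : mxvec 1%:M != 0 :> 'rV[K]_(n * n).
  by rewrite mxvec_eq0 -mxrank_eq0 mxrank1 -lt0n.
have sE1 : (E <= mxvec (1%:M : 'M[K]_n))%MS.
  apply/row_subP=> i; have := row_sub i E; rewrite -[row i E]vec_mxK.
  move/homE => hA; have /is_scalar_mxP[a ->] : is_scalar_mx (vec_mx (row i E)).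
    by apply: mx_irr_scalar irrG _ => x Gx; rewrite hA.
  by rewrite -(scalemx1 n a) linearZ_LR scalemx_sub.
have s1E : (mxvec 1%:M <= E)%MS.
  by apply/homE => x _; rewrite mulmx1 mul1mx.
have r1 := rank_rV (mxvec (1%:M : 'M[K]_n)).
by rewrite nz1 in r1; apply/eqP; rewrite eqn_leq -[X in (_ <= X)%N && _]r1 -[X in _ && (X <= _)%N]r1 !mxrankS.
Qed.

(** Maschke's argument: a nonzero intertwiner A from [r] to [rG] is injective. Averaging a right
    inverse of A gives an intertwiner B with A B = 1, and 1 - B A cuts out the complement that
    affords the rest of phi. *)
Lemma cdot_constituent G phi chi : is_char G phi -> is_irr_char G chi ->
  cdot G phi chi != 0 -> irr_constituent G phi chi.
Proof.
move=> [n [rG ->]] irr_chi; rewrite cdotC; split=> //.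
case: irr_chi H => m [r [irr ->]] /cdot_neq0P[] // A nzA homA.
have freeA := mx_hom_irr_free irr homA nzA.
have [D AD] : {D | A *m D = 1%:M} by exists (pinvmx A); apply: mulmxVp.
pose B := #|G|%:R^-1 *: \sum_(x in G) rG x *m D *m r x^-1%g.
have AB : A *m B = 1%:M.
  rewrite -scalemxAr mulmx_sumr (eq_bigr (fun=> 1%:M)) => [|x Gx].
    by rewrite sumr_const -scaler_nat scalerA mulVf ?card_neq0 // scale1r.
  by rewrite !mulmxA -homA // -(mulmxA _ A) AD mulmx1 -repr_mxM ?groupV // mulgV repr_mx1.
have homB : mx_hom G rG r B.
  move=> y Gy; rewrite -scalemxAr -scalemxAl; congr (_ *: _).
  rewrite mulmx_sumr mulmx_suml [in RHS](reindex_inj (mulgI y)) /=.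
  apply: eq_big => [x | x Gx]; first by rewrite groupMl.
  rewrite invMg !repr_mxM ?groupV //.
  by rewrite -!mulmxA -repr_mxM ?groupV // mulVg repr_mx1 mulmx1.
pose E := B *m A.
have EE : E *m E = E by rewrite /E -mulmxA (mulmxA A) AB mul1mx.
have cE x : x \in G -> E *m rG x = rG x *m E.
  by move=> Gx; rewrite mulmxA homB // -!mulmxA homA.
exists [ffun x => \tr ((1%:M - E) *m rG x) *+ (x \in G)].
  apply: is_char_idem => [|x Gx]; last by rewrite mulmxBl mulmxBr mul1mx mulmx1 cE.
  by rewrite mulmxBl mul1mx mulmxBr mulmx1 EE subrr subr0.
apply/ffunP=> x; rewrite !ffunE -mulrnDl; case: (boolP (x \in G)) => // Gx.
rewrite mulmxBl mul1mx linearB /= addrC.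
by rewrite [\tr (E *m _)](_ : _ = \tr (r x)) ?subrK // /E -mulmxA -homA // mulmxA mxtrace_mulC mulmxA AB mul1mx.
Qed.

Lemma char_decomp G phi : is_char G phi ->
  exists2 s : seq {ffun gT -> K}, (forall chi, chi \in s -> is_irr_char G chi)
    & phi = \sum_(chi <- s) chi.
Proof.
move=> [n [rG ->]]; have [m] := ubnP n.
elim: m => // m IHm in n rG *; rewrite ltnS => le_nm.
have [n0 | n_gt0] := posnP n.
  exists [::] => //; rewrite big_nil; apply/ffunP=> x; rewrite !ffunE.
  by rewrite /mxtrace big1 ?mul0rn // => -[k lt_kn]; exfalso; rewrite n0 in lt_kn.
have nz1 : 1%:M != 0 :> 'M[K]_n by rewrite -mxrank_eq0 mxrank1 -lt0n.
have [U simU _] := dec_mxsimple_exists (mxmodule1 rG) nz1.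
have modU := mxsimple_module simU; pose rU := submod_repr modU.
have irrU : mx_irreducible rU by apply/submod_mx_irr.
have irr_chi : is_irr_char G (repr_char rU) by exists _, rU.
have [] := @cdot_constituent G (repr_char rG) _ _ irr_chi.
- by exists n, rG.
- rewrite cdotC; apply/cdot_neq0P => //; exists (val_submod 1%:M).
    by rewrite val_submod_eq0 -mxrank_eq0 mxrank1 mxrank_eq0; case: simU.
  by move=> x Gx; rewrite -val_submodJ // mul1mx -val_submodE.
move=> _ [xi [d [r ->]] Dphi].
have dlt : (d < n)%N.
  have /ffunP/(_ 1%g) := Dphi; rewrite [RHS]ffunE !repr_char1 -natrD => /natK_inj->.
  by rewrite -[X in (X < _)%N]add0n ltn_add2r lt0n mxrank_eq0; case: simU.
have [s irr_s Ds] := IHm d r (leq_trans dlt le_nm).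
exists (repr_char rU :: s) => [chi|]; last by rewrite big_cons -Ds.
by rewrite inE => /predU1P[-> | /irr_s].
Qed.

Lemma char_subconstituent G S phi (psi : gT -> K) : is_char G phi ->
    cdot S phi psi != 0 ->
  exists omega, irr_constituent G phi omega /\ cdot S omega psi != 0.
Proof.
move=> /char_decomp[s irr_s ->]; rewrite cdot_suml => nz.
have /hasP[chi s_chi nz_chi] : has (fun chi => cdot S (chi : {ffun _}) psi != 0) s.
  apply: contraNT nz => /hasPn z; rewrite big1_seq // => chi /andP[_ s_chi].
  by apply/eqP/negPn/z.
exists chi; split=> //; split; first exact: irr_s.
rewrite (big_rem _ s_chi) /=; exists (\sum_(xi <- rem chi s) xi) => //.
by apply: is_char_sum => xi /mem_rem/irr_s/irr_is_char.
Qed.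

(** If phi = chi + xi with chi irreducible, the norm is 1 + 2 m1 + m2 with natural m1 and m2, so xi
    has norm 0. *)
Lemma cdot1_irr G phi : is_char G phi -> cdot G phi phi = 1 -> is_irr_char G phi.
Proof.
move=> ch_phi n1.
have [] := @char_subconstituent G G phi phi ch_phi; first by rewrite n1 oner_eq0.
move=> chi [[irr_chi [xi ch_xi Dphi]] _].
suffices xi0 : xi = 0 by rewrite Dphi xi0 addr0.
apply: (cdot_self_eq0 ch_xi).
move: n1; rewrite {1 2}Dphi !(cdotDl, cdotDr) irr_cdot1 // (cdotC _ xi chi).
have ch_chi := irr_is_char irr_chi.
have [m1 ->] := cdot_nat (subxx G) (subxx G) ch_chi ch_xi.
have [m2 ->] := cdot_nat (subxx G) (subxx G) ch_xi ch_xi.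
rewrite -(natrD _ 1) -!natrD => /(@natK_inj _ 1) /eqP.
by rewrite -!addnA -[X in _ == X]addn0 eqn_add2l !addn_eq0 => /and3P[_ _ /eqP->].
Qed.

Lemma irr_constituent_cdot G phi chi : irr_constituent G phi chi ->
  cdot G phi chi != 0.
Proof.
move=> [irr_chi [xi ch_xi ->]]; rewrite cdotDl irr_cdot1 //.
have ch_chi := irr_is_char irr_chi.
have [m ->] := cdot_nat (subxx G) (subxx G) ch_xi ch_chi.
by rewrite -(natrD _ 1) natK_eq0.
Qed.

(** The hypothesis says that f - h has norm 0. As f - h need not be a character, definiteness does
    not apply to it; instead a common constituent is removed from both, by induction on the degree
    of f. *)
Lemma cdot_eq_char G f h : is_char G f -> is_char G h ->
  cdot G f f + cdot G h h = cdot G f h + cdot G f h -> f = h.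
Proof.
move=> chf; have [n [rG Df]] := chf; have fn : f 1%g = n%:R by rewrite Df repr_char1.
move: {rG Df} fn; have [m] := ubnP n; elim: m => // m IHm in n f h chf * => le_nm fn chh.
have [z | nz] := eqVneq (cdot G f h) 0.
  rewrite z addr0.
  have [m1 E1] := cdot_nat (subxx G) (subxx G) chf chf.
  have [m2 E2] := cdot_nat (subxx G) (subxx G) chh chh.
  rewrite E1 E2 -natrD => /eqP; rewrite natK_eq0 addn_eq0 => /andP[/eqP m1z /eqP m2z].
  by rewrite (cdot_self_eq0 chf) ?E1 ?m1z // (cdot_self_eq0 chh) // E2 m2z.
have [omega [[irr_om [f1 ch1 Df]] nz_om]] := char_subconstituent chf nz.
rewrite cdotC in nz_om; have [_ [h1 ch2 Dh]] := cdot_constituent chh irr_om nz_om.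
rewrite Df Dh !(cdotDl, cdotDr) irr_cdot1 // (cdotC _ f1 omega) (cdotC _ h1 omega).
move=> eq1; congr (_ + _).
case: (ch1) => d [r1 Dr1]; case: (irr_om) => d0 [r0 [irr0 Dr0]].
have f1d : f1 1%g = d%:R by rewrite Dr1 repr_char1.
apply: (IHm d) => //.
  move: fn; rewrite Df ffunE f1d Dr0 repr_char1 -natrD => /natK_inj Dn.
  have [d0_gt0 _] := proj1 (mx_irrP r0) irr0; rewrite ltnS in le_nm.
  by apply: leq_trans le_nm; rewrite -Dn -[X in (X < _)%N]add0n ltn_add2r.
apply: (addrI (1 + cdot G omega f1 + cdot G omega f1 + 1 + cdot G omega h1 + cdot G omega h1)).
transitivity (1 + cdot G omega f1 + (cdot G omega f1 + cdot G f1 f1) +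
  (1 + cdot G omega h1 + (cdot G omega h1 + cdot G h1 h1))); first by ring.
by rewrite eq1; ring.
Qed.

(** As psi is constant on S, the inner product is a multiple of the sum. A nonzero sum means that
    phi has vectors fixed by S. *)
Lemma sum_fixed_neq0 S phi psi :
    {in S, forall u, psi u = psi 1%g} -> cdot S phi psi != 0 ->
  \sum_(u in S) phi u != 0.
Proof.
move=> tr_psi; rewrite /cdot mulf_eq0 negb_or => /andP[_].
rewrite (eq_bigr (fun u => phi u * psi 1%g)) => [|u Su]; last by rewrite tr_psi ?groupV.
by rewrite -mulr_suml mulf_eq0 negb_or => /andP[].
Qed.

(** The sum of [rG] over N commutes with G, so it is a scalar, nonzero because its trace is.
    Multiplication by [rG u] does not change it, which forces [rG u] = 1. *)
Lemma irr_norm_trivial G N omega : is_irr_char G omega ->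
    N \subset G -> G \subset 'N(N)%g -> \sum_(u in N) omega u != 0 ->
  {in G & N, forall x u, omega (x * u)%g = omega x}.
Proof.
move=> [n [rG [irrG ->]]] /subsetP sNG /subsetP nNG nz.
pose E := \sum_(u in N) rG u.
have cE : {in G, forall x, E *m rG x = rG x *m E}.
  move=> x Gx; rewrite mulmx_suml mulmx_sumr [LHS](reindex_inj (conjg_inj x^-1%g)) /=.
  apply: eq_big => [u | u Nu]; first by rewrite memJ_norm // groupV nNG.
  have Nu' : u \in N by move: Nu; rewrite memJ_norm // groupV nNG.
  have Gu := sNG _ Nu'; have Gw := sNG _ Nu.
  by rewrite -!repr_mxM //; congr (rG _); rewrite conjgE invgK !mulgA mulgKV.
have [c Dc] : {c | E = c%:M} by apply/sig_eqW/is_scalar_mxP/(mx_irr_scalar irrG cE).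
have nzE : c != 0.
  apply: contraNneq nz => c0; rewrite (eq_bigr (fun u => \tr (rG u))).
    by rewrite -linear_sum -/E Dc c0 /= raddf0 linear0.
  by move=> u /sNG; apply: repr_charE.
move=> x u Gx Nu; have Gu := sNG u Nu; rewrite !repr_charE ?groupM // repr_mxM //.
suffices -> : rG u = 1%:M by rewrite mulmx1.
have : rG u *m E = E.
  rewrite mulmx_sumr [RHS](reindex_inj (mulgI u)) /=.
  apply: eq_big => [v | v Nv]; first by rewrite groupMl.
  by rewrite repr_mxM // sNG.
rewrite Dc mul_mx_scalar -(scalemx1 _ c) => /(congr1 (fun M => c^-1 *: M)).
by rewrite !scalerA mulVf // !scale1r.
Qed.

(** Over a central product of H and T, omega behaves like an outer product whose T-part is tau. The
    sum of the T-conjugates of s acts by a scalar on both modules; an intertwiner over T identifies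
    the two scalars, and traces give the formula. *)
Lemma irr_mul_central G (H T : {group gT}) omega tau :
    is_irr_char G omega -> is_irr_char T tau -> H \subset G -> T \subset G ->
    T \subset 'C(H)%g -> G \subset (H * T)%g -> cdot T omega tau != 0 ->
  {in H & T, forall x s, omega (x * s)%g * tau 1%g = omega x * tau s}.
Proof.
move=> [n [rG [irrG ->]]] [m [rT [irrT ->]]] /subsetP sHG /subsetP sTG cHT /subsetP defG.
rewrite cdotC => /cdot_neq0P[] //; first exact/subsetP.
move=> A nzA homA h s Hh Ts; have Gh := sHG h Hh; have Gs := sTG s Ts.
have JT (u v : gT) : u \in T -> v \in T -> (u ^ v)%g \in T by move=> Tu Tv; rewrite groupJ.
pose Z := \sum_(u in T) rG (s ^ u)%g; pose Y := \sum_(u in T) rT (s ^ u)%g.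
have cY : {in T, forall x, Y *m rT x = rT x *m Y}.
  move=> x Tx; rewrite mulmx_suml mulmx_sumr [LHS](reindex_inj (mulIg x^-1%g)) /=.
  apply: eq_big => [u | u]; first by rewrite groupMr ?groupV.
  rewrite groupMr ?groupV // => Tu; rewrite -!repr_mxM ?JT ?groupM ?groupV //.
  by rewrite conjgM [X in (X * x)%g]conjgE invgK !mulgA mulgKV.
have cZ : {in G, forall x, Z *m rG x = rG x *m Z}.
  move=> _ /defG/mulsgP[y x Hy Tx ->].
  have Gx := sTG x Tx; have Gy := sHG y Hy.
  have cyT u : u \in T -> commute u y by move/(subsetP cHT)/centP; apply.
  rewrite mulmx_suml mulmx_sumr [LHS](reindex_inj (mulIg x^-1%g)) /=.
  apply: eq_big => [u | u]; first by rewrite groupMr ?groupV.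
  rewrite groupMr ?groupV // => Tu.
  have Tw : (s ^ (u * x^-1))%g \in T by rewrite JT ?groupM ?groupV.
  have Tv : (s ^ u)%g \in T by rewrite JT.
  have Gyx : (y * x)%g \in G by rewrite groupM.
  have Gw := sTG _ Tw; have Gv := sTG _ Tv.
  rewrite -!repr_mxM //; congr (rG _).
  rewrite mulgA (cyT _ Tw) -!mulgA; congr (y * _)%g.
  by rewrite invMg invgK mulVg mulg1 conjgE !mulgA.
have [c Dc] : {c | Z = c%:M} by apply/sig_eqW/is_scalar_mxP/(mx_irr_scalar irrG cZ).
have [d Dd] : {d | Y = d%:M} by apply/sig_eqW/is_scalar_mxP/(mx_irr_scalar irrT cY).
have eq_cd : c = d.
  have : Y *m A = A *m Z.
    by rewrite mulmx_suml mulmx_sumr; apply: eq_bigr => u Tu; rewrite homA ?JT.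
  rewrite Dc Dd mul_scalar_mx mul_mx_scalar => /eqP; rewrite -subr_eq0 -scalerBl.
  by rewrite scaler_eq0 (negPf nzA) orbF subr_eq0 => /eqP.
have trY : #|T|%:R * repr_char rT s = d * repr_char rT 1%g.
  rewrite repr_char1 mulr_natr -[d *+ m]mxtrace_scalar -Dd linear_sum /=.
  rewrite (eq_bigr (fun=> repr_char rT s)) ?sumr_const ?mulr_natl // => u Tu.
  by rewrite -repr_charE ?JT // (@charJ T) //; exists m, rT.
have trZ : #|T|%:R * repr_char rG (h * s)%g = c * repr_char rG h.
  rewrite mulrC [in RHS]repr_charE // mulr_natr -linearZ /= -mul_mx_scalar -Dc.
  rewrite mulmx_sumr linear_sum /=.
  rewrite (eq_bigr (fun=> repr_char rG (h * s)%g)) ?sumr_const // => u Tu.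
  have Gsu := sTG _ (JT _ _ Ts Tu); have Ghs := groupM Gh Gsu.
  rewrite -repr_mxM // -repr_charE //.
  have ch_om : is_char G (repr_char rG) by exists n, rG.
  rewrite -(charJ (h * s)%g ch_om (sTG u Tu)) conjMg; congr (repr_char rG (_ * _)%g).
  by rewrite /conjg -(centP (subsetP cHT u Tu)) ?mulKg.
apply: (mulfI (card_neq0 T)); rewrite mulrA trZ mulrCA trY eq_cd; ring.
Qed.

Lemma is_char_conj P phi g : is_char P phi ->
  is_char (P :^ g^-1)%G [ffun u => phi (u ^ g)%g].
Proof.
move=> [n [r ->]].
have rP : mx_repr (P :^ g^-1)%g (fun u => r (u ^ g)%g).
  split=> [|u v]; first by rewrite conj1g repr_mx1.
  by rewrite !mem_conjgV conjMg => Pu Pv; rewrite repr_mxM.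
exists _, (MxRepresentation rP); apply/ffunP=> u.
by rewrite !ffunE mem_conjgV.
Qed.

(** * Induced characters and Mackey's formula *)

Lemma char_indE P G phi x : char_ind G P phi x = #|P|%:R^-1 * \sum_(y in G) phi (x ^ y)%g.
Proof. by rewrite ffunE. Qed.

(* Contribution of g to the inner product of two induced characters, see cdot_ind. *)
Definition mackey (P : {set gT}) (f h : gT -> K) g :=
  \sum_(u in P) f u * h (u^-1 ^ g)%g.

(** Mackey's formula without double coset representatives: conjugating x by y^-1 and substituting y
    g for z makes the terms of the threefold sum independent of y. *)
Lemma cdot_ind G P P' (f h : {ffun gT -> K}) : P \subset G ->
    (forall x, x \notin P -> f x = 0) ->
  cdot G (char_ind G P f) (char_ind G P' h)
    = (#|P| * #|P'|)%:R^-1 * \sum_(g in G) mackey P f h g.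
Proof.
move=> /subsetP sPG f_out; rewrite /cdot natrM invfM.
have defM g : mackey P f h g = \sum_(u in G) f u * h (u^-1 ^ g)%g.
  rewrite /mackey [RHS](bigID (mem P)) /= [X in _ + X]big1 ?addr0 => [|u /andP[_ P'u]].
    by apply: eq_bigl => u; case Pu: (u \in P); rewrite ?andbF ?andbT ?sPG.
  by rewrite f_out ?mul0r.
under eq_bigr => x _ do rewrite !char_indE mulrACA.
rewrite -mulr_sumr mulrCA -!mulrA; congr (_ * (_ * _)).
apply: (mulfI (card_neq0 G)); rewrite mulVKf ?card_neq0 //.
transitivity (\sum_(y in G) \sum_(x in G)
                (\sum_(z in G) f (x ^ y)%g * h (x^-1 ^ z)%g)).
  rewrite exchange_big; apply: eq_bigr => x _.
  by rewrite exchange_big mulr_suml exchange_big; apply: eq_bigr => z _; rewrite mulr_sumr.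
rewrite mulr_natl -sumr_const; apply: eq_bigr => y Gy.
rewrite (reindex_inj (conjg_inj y^-1%g)) /= exchange_big [LHS](reindex_inj (mulgI y)) /=.
apply: eq_big => [g | g]; rewrite groupMl // => Gg.
rewrite defM; apply: eq_big => [u | u _]; first by rewrite groupJr ?groupV.
by rewrite conjgKV -conjVg conjgM conjgKV.
Qed.

Lemma char_ind_id G f : is_char G f -> char_ind G G f = f.
Proof.
move=> chf; apply/ffunP=> x; rewrite ffunE (eq_bigr (fun=> f x)) => [|y Gy].
  by rewrite sumr_const -(mulr_natl (f x)) mulKf ?card_neq0.
exact: charJ chf Gy.
Qed.

Lemma char_ind_out G P (f : {ffun gT -> K}) x : P \subset G ->
  (forall x, x \notin P -> f x = 0) -> x \notin G -> char_ind G P f x = 0.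
Proof.
move=> /subsetP sPG f_out G'x; rewrite ffunE big1 ?mulr0 // => y Gy.
by rewrite f_out //; apply: contra G'x => /sPG; rewrite groupJr.
Qed.

(** Mackey's formula with [P' = G], since chi is induced from G itself. *)
Lemma Frobenius G P f chi : P \subset G -> is_char G chi ->
  (forall x, x \notin P -> f x = 0) -> cdot G (char_ind G P f) chi = cdot P f chi.
Proof.
move=> sPG ch_chi f_out; rewrite -{1}(char_ind_id ch_chi) cdot_ind //.
rewrite (eq_bigr (fun=> #|P|%:R * cdot P f chi)) => [|g Gg].
  rewrite sumr_const -(mulr_natl (_ * _)) natrM; field.
  by rewrite !card_neq0.
rewrite /cdot mulVKf ?card_neq0 //; apply: eq_bigr => u _.
by rewrite (charJ _ ch_chi Gg).
Qed.

Lemma char_ind_trans G H P f : P \subset H -> H \subset G ->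
  char_ind G H (char_ind H P f) = char_ind G P f.
Proof.
move=> sPH /subsetP sHG; apply/ffunP=> x; rewrite !ffunE.
under eq_bigr do rewrite ffunE; rewrite -mulr_sumr mulrCA; congr (_ * _).
apply: (mulfI (card_neq0 H)); rewrite mulVKf ?card_neq0 //.
rewrite exchange_big mulr_natl -sumr_const; apply: eq_bigr => z Hz.
rewrite [RHS](reindex_inj (mulIg z)) /=.
apply: eq_big => [y | y _]; last by rewrite conjgM.
by rewrite groupMr //; apply: sHG.
Qed.

Lemma mackeyE P P' f h g : is_char P f -> is_char P' h ->
  mackey P f h g = #|(P :&: P' :^ g^-1)%g|%:R
                   * cdot (P :&: P' :^ g^-1)%g f [ffun u => h (u ^ g)%g].
Proof.
move=> chf chh; rewrite /cdot mulVKf ?card_neq0 //= /mackey.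
rewrite (bigID (mem (P' :^ g^-1)%g)) /= [X in _ + X]big1 ?addr0 => [|u /andP[_]].
  by apply: eq_big => [u | u _]; rewrite ?inE // ffunE.
by rewrite mem_conjgV => P'u; rewrite (char_out chh) ?mulr0 // conjVg groupV.
Qed.

(** The terms of Mackey's sum cannot cancel; this does the work of positivity. *)
Lemma mackey_nat P P' f h g : is_char P f -> is_char P' h ->
  exists m : nat, mackey P f h g = m%:R.
Proof.
move=> chf chh; rewrite (mackeyE g chf chh).
have [m ->] := cdot_nat (subsetIl P (P' :^ g^-1)%g) (subsetIr P (P' :^ g^-1)%g)
  chf (is_char_conj g chh).
by exists (#|(P :&: P' :^ g^-1)%g| * m)%N; rewrite natrM.
Qed.

Lemma mackeyM P P' f h g x y : is_char P f -> is_char P' h ->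
  x \in P -> y \in P' -> mackey P f h (x * g * y)%g = mackey P f h g.
Proof.
move=> chf chh Px Py; rewrite /mackey (reindex_inj (conjg_inj x^-1%g)) /=.
apply: eq_big => [u | u _]; first by rewrite groupJr ?groupV.
rewrite (charJ _ chf) ?groupV // conjgM (charJ _ chh) //.
by rewrite conjgM -conjVg conjgKV.
Qed.

Lemma avg_repr_idem P n (r : mx_representation K P n)
    (E := #|P|%:R^-1 *: \sum_(p in P) r p) : E *m E = E.
Proof.
have rE p : p \in P -> r p *m E = E.
  move=> Pp; rewrite /E -scalemxAr mulmx_sumr [in RHS](reindex_inj (mulgI p)) /=.
  congr (_ *: _); apply: eq_big => [q | q Pq]; first by rewrite groupMl.
  by rewrite repr_mxM.
rewrite {1}/E -scalemxAl mulmx_suml (eq_bigr (fun=> E)) // sumr_const.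
by rewrite -scaler_nat scalerA mulVf ?card_neq0 // scale1r.
Qed.

(** The linear map on the space with basis G that sends x to [s x], acting on row vectors; hence the
    order of the factors in [fun_mx_comp]. *)
Definition fun_mx G (s : gT -> gT) : 'M[K]_#|G| :=
  \matrix_i delta_mx 0 (gring_index G (s (enum_val i))).

Lemma fun_mx_comp G (s t : gT -> gT) : {in G, forall x, s x \in G} ->
  fun_mx G s *m fun_mx G t = fun_mx G (t \o s).
Proof.
move=> Gs; apply/row_matrixP=> i; rewrite row_mul !rowK -rowE rowK.
by rewrite gring_indexK ?Gs ?enum_valP.
Qed.

Lemma fun_mx_id G : fun_mx G id = 1%:M.
Proof. by apply/row_matrixP=> i; rewrite rowK gring_valK row1. Qed.

Lemma eq_fun_mx G (s t : gT -> gT) : {in G, s =1 t} -> fun_mx G s = fun_mx G t.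
Proof.
by move=> st; apply/row_matrixP=> i; rewrite !rowK st ?enum_valP.
Qed.

Lemma tr_fun_mx G (s : gT -> gT) : {in G, forall x, s x \in G} ->
  \tr (fun_mx G s) = \sum_(x in G) (s x == x)%:R.
Proof.
move=> Gs; rewrite /mxtrace [RHS](reindex (@enum_val _ (mem G))) /=; last first.
  exists (gring_index G) => [i _ | x]; [exact: gring_valK | exact: gring_indexK].
apply: eq_big => [i | i _]; first by rewrite enum_valP.
rewrite !mxE eqxx /= -(inj_eq enum_val_inj) gring_indexK ?Gs ?enum_valP //.
by rewrite eq_sym.
Qed.

(* The induced module is the image of an idempotent E acting on the tensor product of
   the space of functions on G with the given module: E averages over P. *)
Lemma is_char_ind G P f : P \subset G -> is_char P f -> is_char G (char_ind G P f).
Proof.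
move=> /subsetP sPG [d [r Df]].
have rP : mx_repr P (fun p => tprod (fun_mx G (mulg p^-1%g)) (r p)).
  split=> [|p q Pp Pq].
    by rewrite repr_mx1 (@eq_fun_mx _ _ id) ?fun_mx_id ?tprod1 // => x _; rewrite invg1 mul1g.
  rewrite repr_mxM // -tprodE fun_mx_comp => [|x Gx]; last by rewrite groupM // groupV sPG.
  by rewrite [fun_mx G (_ \o _)](@eq_fun_mx _ _ (mulg (p * q)^-1%g)) // => x _; rewrite /= invMg mulgA.
have rG : mx_repr G (fun x => tprod (fun_mx G (mulg^~ x)) (1%:M : 'M_d)).
  split=> [|x y Gx Gy].
    by rewrite (@eq_fun_mx _ _ id) ?fun_mx_id ?tprod1 // => x _; rewrite mulg1.
  rewrite -tprodE fun_mx_comp => [|z Gz]; last by rewrite groupM.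
  by rewrite mulmx1 [fun_mx G (_ \o _)](@eq_fun_mx _ _ (mulg^~ (x * y)%g)) // => z _; rewrite /= mulgA.
pose E := #|P|%:R^-1 *: \sum_(p in P) MxRepresentation rP p.
have EE : E *m E = E by apply: avg_repr_idem.
suffices -> : char_ind G P f
    = [ffun x => \tr (E *m MxRepresentation rG x) *+ (x \in G)].
  apply: is_char_idem => // x Gx; rewrite -scalemxAl -scalemxAr; congr (_ *: _).
  rewrite mulmx_suml mulmx_sumr; apply: eq_bigr => p Pp /=.
  rewrite -!tprodE mulmx1 mul1mx !fun_mx_comp => [||y Gy].
  - by rewrite (@eq_fun_mx _ _ (mulg p^-1%g \o mulg^~ x)) // => y _; rewrite /= mulgA.
  - by move=> y Gy; rewrite groupM.
  by rewrite groupM // groupV sPG.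
have chf : is_char P f by exists d, r.
apply/ffunP=> x; rewrite [RHS]ffunE; case: (boolP (x \in G)) => [Gx | G'x]; last first.
  rewrite (@char_ind_out G P) //; first exact/subsetP.
  by move=> y; apply: char_out.
rewrite ffunE -scalemxAl linearZ /=; congr (_ * _).
rewrite mulmx_suml linear_sum /=.
transitivity (\sum_(p in P) \sum_(y in G) (p^-1 * (y * x) == y)%g%:R * f p); last first.
  apply: eq_bigr => p Pp; rewrite -tprodE mulmx1 mxtrace_prod -mulr_suml.
  rewrite fun_mx_comp => [|y Gy]; last by rewrite groupM // groupV sPG.
  rewrite tr_fun_mx => [|y Gy /=]; last by rewrite !groupM // groupV sPG.
  by rewrite Df repr_charE //; congr (_ * _); apply: eq_bigr => y _; rewrite /= mulgA.
rewrite exchange_big (reindex_inj invg_inj) /=.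
apply: eq_big => [y | y]; rewrite groupV // => Gy.
have eqp p : (p^-1 * (y * x) == y)%g = (p == x ^ y^-1)%g.
  rewrite -(inj_eq (mulgI p)) mulKVg conjgE invgK.
  by rewrite -(inj_eq (mulIg y^-1%g)) mulgK eq_sym mulgA.
case: (boolP (x ^ y^-1 \in P)%g) => [Py | P'y].
  rewrite (bigD1 (x ^ y^-1)%g) //= eqp eqxx mul1r big1 ?addr0 // => p /andP[_ np].
  by rewrite eqp (negPf np) mul0r.
rewrite (char_out chf) // big1 // => p Pp; rewrite eqp.
by case: eqP => [Dp | _]; rewrite ?mul0r // Dp (char_out chf) ?mulr0.
Qed.

Lemma is_charM G f h : is_char G f -> is_char G h -> is_char G [ffun x => f x * h x].
Proof.
move=> [n1 [r1 ->]] [n2 [r2 ->]]; exists _, (prod_repr r1 r2).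
apply/ffunP=> x; rewrite !ffunE mxtrace_prod.
by case: (x \in G); rewrite ?mulr1n // mulr0.
Qed.

Lemma is_char_one G : is_char G [ffun x => (x \in G)%:R : K].
Proof.
have r1 : mx_repr G (fun _ : gT => 1%:M : 'M[K]_1) by split=> [//|x y _ _]; rewrite mulmx1.
by exists 1, (MxRepresentation r1); apply/ffunP=> x; rewrite !ffunE mxtrace1.
Qed.

End Characters.

(** * Pullback of characters along maps that are multiplicative on a subgroup *)

Section Pullback.

Variables (K : closedFieldType) (aT rT : finGroupType).
Variables (Q : {group aT}) (H : {group rT}) (s : aT -> rT).
Hypotheses (sQH : {in Q, forall x, s x \in H})
  (sM : {in Q &, {morph s : x y / (x * y)%g}}).

Lemma is_char_pull (f : {ffun rT -> K}) : is_char H f ->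
  is_char Q [ffun x => f (s x) *+ (x \in Q)].
Proof.
have s1 : s 1%g = 1%g by apply: (mulgI (s 1%g)); rewrite -sM ?group1 // !mulg1.
move=> [n [r ->]]; have rP : mx_repr Q (fun x => r (s x)).
  by split=> [|x y Qx Qy]; rewrite ?s1 ?repr_mx1 // sM // repr_mxM ?sQH.
exists n, (MxRepresentation rP); apply/ffunP=> x; rewrite !ffunE.
by case: (boolP (x \in Q)) => // Qx; rewrite sQH.
Qed.

Lemma is_irr_char_pull (f : {ffun rT -> K}) : H \subset s @: Q -> is_irr_char H f ->
  is_irr_char Q [ffun x => f (s x) *+ (x \in Q)].
Proof.
have s1 : s 1%g = 1%g by apply: (mulgI (s 1%g)); rewrite -sM ?group1 // !mulg1.
move=> /subsetP onto [n [r [irr ->]]]; have rP : mx_repr Q (fun x => r (s x)).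
  by split=> [|x y Qx Qy]; rewrite ?s1 ?repr_mx1 // sM // repr_mxM ?sQH.
exists n, (MxRepresentation rP); split; last first.
  by apply/ffunP=> x; rewrite !ffunE; case: (boolP (x \in Q)) => // Qx; rewrite sQH.
have [n_gt0 irrU] := proj1 (mx_irrP r) irr.
apply/mx_irrP; split=> // U /mxmoduleP modU; apply: irrU.
apply/mxmoduleP=> _ /onto/imsetP[x Qx ->]; exact: modU x Qx.
Qed.

End Pullback.

(** * Parabolic subgroups defined by colorings of the indices *)

(* A group identified with GL_N(F).  Working with an abstract carrier instead of
   {'GL_n[F]} keeps unification from unfolding the construction of the latter. *)
Record gl_model (F : fieldType) (N : nat) (gT : finGroupType) := GLModel {
  gl_mx :> gT -> 'M[F]_N;
  gl_of : 'M[F]_N -> gT;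
  gl_mx1 : gl_mx 1%g = 1%:M;
  gl_mxM : forall x y, gl_mx (x * y)%g = gl_mx x *m gl_mx y;
  gl_mx_inj : injective gl_mx;
  gl_ofK : forall M, M \in unitmx -> gl_mx (gl_of M) = M
}.

Section Colorings.

Variables (F : fieldType) (N : nat) (gT : finGroupType) (X : gl_model F N gT).
Implicit Types (x y u g : gT) (c d : 'I_N -> nat) (a b k : 'I_N) (s t : 'S_N).

Lemma gl_unit x : X x \in unitmx.
Proof. by case: (@mulmx1_unit _ _ (X x) (X x^-1%g)); rewrite // -gl_mxM mulgV gl_mx1. Qed.

Lemma gl_eqP x y : (forall a b, X x a b = X y a b) -> x = y.
Proof. by move=> eqxy; apply: (@gl_mx_inj _ _ _ X); apply/matrixP. Qed.

Lemma gl1E a b : X 1%g a b = (a == b)%:R.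
Proof. by rewrite gl_mx1 mxE. Qed.

Lemma glME x y a b : X (x * y)%g a b = \sum_k X x a k * X y k b.
Proof. by rewrite gl_mxM mxE. Qed.

Lemma glM_neq0 x y a b : X (x * y)%g a b != 0 ->
  exists2 k, X x a k != 0 & X y k b != 0.
Proof.
rewrite glME => nz; have [k nzk] : exists k, X x a k * X y k b != 0.
  apply/existsP; apply: contraNT nz => /existsPn z.
  by rewrite big1 // => k _; apply/eqP/negPn/z.
by move: nzk; rewrite mulf_eq0 negb_or => /andP[]; exists k.
Qed.

Lemma gl1_neq0 a b : X 1%g a b != 0 -> a = b.
Proof. by rewrite gl1E; case: (a =P b) => //; rewrite eqxx. Qed.

(* Colors need not increase along the indices, so these are all the parabolic subgroups
   containing the diagonal torus; the coloring block_of mu gives the standard ones. *)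
Definition cP c : {set gT} :=
  [set x | [forall a, forall b, (X x a b != 0) ==> (c a <= c b)%N]].

Definition cL c : {set gT} :=
  [set x | [forall a, forall b, (X x a b != 0) ==> (c a == c b)]].

Definition cU c : {set gT} :=
  [set x in cP c | [forall a, forall b, (c a == c b) ==> (X x a b == (a == b)%:R)]].

Lemma cPP c x :
  reflect (forall a b, X x a b != 0 -> (c a <= c b)%N) (x \in cP c).
Proof.
rewrite inE; apply: (iffP forallP) => [h a b | h a].
  by move/forallP/(_ b)/implyP: (h a).
by apply/forallP=> b; apply/implyP; apply: h.
Qed.

Lemma cLP c x :
  reflect (forall a b, X x a b != 0 -> c a = c b) (x \in cL c).
Proof.
rewrite inE; apply: (iffP forallP) => [h a b | h a].
  by move/forallP/(_ b)/implyP: (h a) => h' /h' /eqP.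
by apply/forallP=> b; apply/implyP=> /h ->.
Qed.

Fact cP_group_set c : group_set (cP c).
Proof.
apply/group_setP; split=> [|x y /cPP Px /cPP Py]; first by apply/cPP=> a b /gl1_neq0->.
by apply/cPP=> a b /glM_neq0[k /Px le_ak /Py]; apply: leq_trans.
Qed.
Canonical cP_group c := Group (cP_group_set c).

Fact cL_group_set c : group_set (cL c).
Proof.
apply/group_setP; split=> [|x y /cLP Lx /cLP Ly]; first by apply/cLP=> a b /gl1_neq0->.
by apply/cLP=> a b /glM_neq0[k /Lx-> /Ly].
Qed.
Canonical cL_group c := Group (cL_group_set c).

Lemma cL_sub_cP c : cL c \subset cP c.
Proof. by apply/subsetP=> x /cLP Lx; apply/cPP=> a b /Lx ->. Qed.

Definition lmx c (M : 'M[F]_N) : 'M[F]_N := \matrix_(a, b) (M a b *+ (c a == c b)).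

Lemma lmx1 c : lmx c 1%:M = 1%:M.
Proof.
apply/matrixP=> a b; rewrite !mxE; case: (a =P b) => [-> | _]; first by rewrite eqxx.
by rewrite mul0rn.
Qed.

(** An index k contributing to an entry within one color satisfies c a <= c k <= c b = c a, so it
    has this color too. *)
Lemma lmxM c x y : x \in cP c -> y \in cP c ->
  lmx c (X (x * y)%g) = lmx c (X x) *m lmx c (X y).
Proof.
move=> /cPP Px /cPP Py; apply/matrixP=> a b; rewrite gl_mxM !mxE.
have [eq_ab | ne_ab] := eqVneq (c a) (c b); last first.
  rewrite mulr0n big1 // => k _; rewrite !mxE.
  case: (c a =P c k) => [eq_ak | _]; last by rewrite mul0r.
  by case: (c k =P c b) => [eq_kb | _]; [rewrite eq_ak eq_kb eqxx in ne_ab | rewrite mulr0].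
rewrite mulr1n; apply: eq_bigr => k _; rewrite !mxE.
have [-> | nzx] := eqVneq (X x a k) 0; first by rewrite mul0rn !mul0r.
have [-> | nzy] := eqVneq (X y k b) 0; first by rewrite mul0rn !mulr0.
have eq_ak : c a = c k by apply/eqP; rewrite eqn_leq Px // eq_ab Py.
by rewrite eq_ak eqxx -eq_ak eq_ab eqxx.
Qed.

(** The Levi component of x in P_c = U_c L_c, meaningful only on [cP c]. *)
Definition lpart c x : gT := gl_of X (lmx c (X x)).

Lemma lpart_mx c x : x \in cP c -> X (lpart c x) = lmx c (X x).
Proof.
move=> Px; rewrite /lpart; apply: gl_ofK.
have : lmx c (X x) *m lmx c (X x^-1%g) = 1%:M.
  by rewrite -lmxM ?groupV // mulgV gl_mx1 lmx1.
by case/mulmx1_unit.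
Qed.

Lemma lpartE c x a b : x \in cP c -> X (lpart c x) a b = X x a b *+ (c a == c b).
Proof. by move/lpart_mx->; rewrite mxE. Qed.

Lemma lpartM c : {in cP c &, {morph lpart c : x y / (x * y)%g}}.
Proof.
move=> x y Px Py; apply: (@gl_mx_inj _ _ _ X).
by rewrite gl_mxM !lpart_mx ?groupM // lmxM.
Qed.

Lemma lpart_L c x : x \in cP c -> lpart c x \in cL c.
Proof.
move=> Px; apply/cLP=> a b; rewrite lpartE //.
by case: (c a =P c b) => // _; rewrite mulr0n eqxx.
Qed.

Lemma lpart_id c x : x \in cL c -> lpart c x = x.
Proof.
move=> Lx; apply: gl_eqP => a b; rewrite lpartE ?(subsetP (cL_sub_cP c)) //.
case: eqP => // ne_ab; rewrite mulr0n; apply/esym/eqP/negPn/negP=> nz.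
exact/ne_ab/(cLP _ _ Lx).
Qed.

Lemma cUP c x : reflect (x \in cP c /\ lpart c x = 1%g) (x \in cU c).
Proof.
rewrite [_ \in cU c]inE; case: (boolP (x \in cP c)) => /= Px; last by right=> -[].
apply: (iffP forallP) => [h | [_ h] a].
  split=> //; apply: gl_eqP => a b; rewrite lpartE // gl1E.
  have /forallP/(_ b)/implyP := h a; case: (c a =P c b) => [_ /(_ isT)/eqP-> // | ne _].
  by case: (a =P b) => // ab; rewrite ab in ne.
by apply/forallP=> b; apply/implyP=> eq_ab; rewrite -gl1E -h lpartE // eq_ab.
Qed.

Lemma cU_sub_cP c : cU c \subset cP c.
Proof. by apply/subsetP=> x /cUP[]. Qed.

Lemma lpart1 c : lpart c 1%g = 1%g.
Proof. by rewrite lpart_id ?group1. Qed.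

Lemma lpartV c x : x \in cP c -> lpart c x^-1%g = (lpart c x)^-1%g.
Proof.
move=> Px; apply: (mulgI (lpart c x)).
by rewrite -lpartM ?groupV // !mulgV lpart1.
Qed.

Fact cU_group_set c : group_set (cU c).
Proof.
apply/group_setP; split=> [|x y /cUP[Px lx] /cUP[Py ly]].
  by apply/cUP; rewrite lpart1 group1.
by apply/cUP; rewrite groupM // lpartM // lx ly mulg1.
Qed.
Canonical cU_group c := Group (cU_group_set c).

Lemma cU_norm c : cP c \subset 'N(cU c)%g.
Proof.
apply/subsetP=> x Px; rewrite inE; apply/subsetP=> _ /imsetP[u /cUP[Pu lu] ->].
apply/cUP; rewrite groupJ // conjgE !lpartM ?groupM ?groupV //.
by rewrite lu mul1g lpartV // mulVg.
Qed.

Lemma lpart_cP c x : x \in cP c -> lpart c x \in cP c.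
Proof. by move=> Px; rewrite (subsetP (cL_sub_cP c)) // lpart_L. Qed.

Lemma cU_div c x : x \in cP c -> (x * (lpart c x)^-1)%g \in cU c.
Proof.
move=> Px; have Plx := lpart_cP Px.
by apply/cUP; rewrite groupM ?groupV // lpartM ?groupV // lpartV // (lpart_id (lpart_L Px)) mulgV.
Qed.

Section Inflation.

Variable K : closedFieldType.
Implicit Type (theta : {ffun gT -> K}).

Definition infl c theta : {ffun gT -> K} :=
  [ffun x => theta (lpart c x) *+ (x \in cP c)].

Lemma infl_char c theta : is_char (cL_group c) theta -> is_char (cP_group c) (infl c theta).
Proof.
apply: is_char_pull => [x Px | x y Px Py]; first exact: lpart_L.
exact: lpartM.
Qed.

Lemma inflE c theta x : x \in cP c -> infl c theta x = theta (lpart c x).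
Proof. by move=> Px; rewrite ffunE Px. Qed.

Lemma infl_out c theta x : x \notin cP c -> infl c theta x = 0.
Proof. by move=> /negPf P'x; rewrite ffunE P'x. Qed.

Lemma infl_L c theta x : x \in cL c -> infl c theta x = theta x.
Proof. by move=> Lx; rewrite inflE ?lpart_id // (subsetP (cL_sub_cP c)). Qed.

Lemma infl_U c theta x : x \in cU c -> infl c theta x = theta 1%g.
Proof. by move=> /cUP[Px lx]; rewrite inflE // lx. Qed.

End Inflation.

(** The 1 of row a stands in column [s a], so this is a morphism for the left-to-right product of
    permutations, and conjugation by it composes colorings with s or its inverse. *)
Definition gl_perm s : gT := gl_of X (perm_mx s).

Lemma gl_permE s a b : X (gl_perm s) a b = (s a == b)%:R.
Proof. by rewrite gl_ofK ?unitmx_perm // !mxE. Qed.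

Lemma gl_permM s t : gl_perm (s * t)%g = (gl_perm s * gl_perm t)%g.
Proof.
apply: (@gl_mx_inj _ _ _ X).
by rewrite gl_mxM !gl_ofK ?unitmx_perm // perm_mxM.
Qed.

Lemma gl_perm1 : gl_perm 1%g = 1%g.
Proof. by apply: gl_eqP => a b; rewrite gl_permE gl1E perm1. Qed.

Lemma gl_permV s : gl_perm s^-1%g = (gl_perm s)^-1%g.
Proof. by apply: (mulgI (gl_perm s)); rewrite -gl_permM !mulgV gl_perm1. Qed.

Lemma gl_perm_mul s x a b : X (gl_perm s * x)%g a b = X x (s a) b.
Proof.
rewrite glME (bigD1 (s a)) //= gl_permE eqxx mul1r big1 ?addr0 // => k nk.
by rewrite gl_permE eq_sym (negPf nk) mul0r.
Qed.

Lemma gl_mul_perm s x a b : X (x * gl_perm s)%g a (s b) = X x a b.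
Proof.
rewrite glME (bigD1 b) //= gl_permE eqxx mulr1 big1 ?addr0 // => k nk.
by rewrite gl_permE (inj_eq perm_inj) (negPf nk) mulr0.
Qed.

Lemma gl_conj_perm s x a b : X (x ^ gl_perm s)%g (s a) (s b) = X x a b.
Proof. by rewrite conjgE mulgA gl_mul_perm -gl_permV gl_perm_mul permK. Qed.

Lemma mem_cP_perm c s x : (x ^ gl_perm s \in cP c)%g = (x \in cP (c \o s)).
Proof.
apply/cPP/cPP=> [h a b | h a b]; first by rewrite -(gl_conj_perm s) => /h.
by rewrite -[a](permKV s) -[b](permKV s) gl_conj_perm => /h.
Qed.

Lemma mem_cL_perm c s x : (x ^ gl_perm s \in cL c)%g = (x \in cL (c \o s)).
Proof.
apply/cLP/cLP=> [h a b | h a b]; first by rewrite -(gl_conj_perm s) => /h.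
by rewrite -[a](permKV s) -[b](permKV s) gl_conj_perm => /h.
Qed.

Lemma lpart_perm c s x : x \in cP (c \o s) ->
  lpart c (x ^ gl_perm s)%g = (lpart (c \o s) x ^ gl_perm s)%g.
Proof.
move=> Px; apply: gl_eqP => a b; rewrite -[a](permKV s) -[b](permKV s).
by rewrite gl_conj_perm !lpartE ?mem_cP_perm // gl_conj_perm.
Qed.

Lemma mem_cU_perm c s x : (x ^ gl_perm s \in cU c)%g = (x \in cU (c \o s)).
Proof.
apply/cUP/cUP; rewrite mem_cP_perm => -[Px]; rewrite lpart_perm //.
  by move/(canRL (conjgK _)); rewrite conj1g.
by move->; rewrite conj1g.
Qed.

Lemma cPJ c s : (cP c :^ gl_perm s)%g = cP (c \o s^-1%g).
Proof. by apply/setP=> x; rewrite mem_conjg -gl_permV mem_cP_perm. Qed.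

Lemma cLJ c s : (cL c :^ gl_perm s)%g = cL (c \o s^-1%g).
Proof. by apply/setP=> x; rewrite mem_conjg -gl_permV mem_cL_perm. Qed.

Lemma cUJ c s : (cU c :^ gl_perm s)%g = cU (c \o s^-1%g).
Proof. by apply/setP=> x; rewrite mem_conjg -gl_permV mem_cU_perm. Qed.

Lemma eq_cP c d : (forall a b, (c a <= c b)%N = (d a <= d b)%N) -> cP c = cP d.
Proof. by move=> cd; apply/setP=> x; apply/cPP/cPP=> h a b /h; rewrite cd. Qed.

Lemma eq_cL c d : (forall a b, (c a == c b) = (d a == d b)) -> cL c = cL d.
Proof.
by move=> cd; apply/setP=> x; apply/cLP/cLP=> h a b /h/eqP ab; apply/eqP; rewrite ?cd // -cd.
Qed.

End Colorings.

(** * Bruhat decomposition for colored parabolic subgroups *)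

Section Bruhat.

Variables (F : fieldType) (N : nat) (gT : finGroupType) (X : gl_model F N gT).
Implicit Types (x y u g : gT) (c d : 'I_N -> nat) (a b k : 'I_N) (s t : 'S_N).

Lemma unitmx_rank1 (u : 'cV[F]_N) (w : 'rV[F]_N) : w *m u = 0 -> 1%:M + u *m w \in unitmx.
Proof.
move=> wu0; have : (1%:M + u *m w) *m (1%:M - u *m w) = 1%:M.
  rewrite mulmxDl mul1mx mulmxBr mulmx1 mulmxA -(mulmxA u w u) wu0 mulmx0 mul0mx.
  by rewrite subr0 subrK.
by case/mulmx1_unit.
Qed.

Lemma gl_row_neq0 x a : exists b, X x a b != 0.
Proof.
apply/existsP; apply: contraT => /existsPn z.
have := gl1E X a a; rewrite -(mulgV x) glME eqxx big1 => [/esym/eqP|k _].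
  by rewrite oner_eq0.
by move/negPn/eqP: (z k) => ->; rewrite mul0r.
Qed.

Lemma gl_col_neq0 x b : exists a, X x a b != 0.
Proof.
apply/existsP; apply: contraT => /existsPn z.
have := gl1E X b b; rewrite -(mulVg x) glME eqxx big1 => [/esym/eqP|k _].
  by rewrite oner_eq0.
by move/negPn/eqP: (z k) => ->; rewrite mulr0.
Qed.

Definition pivot (M : 'M[F]_N) a b :=
  [&& M a b != 0, [forall b', (M a b' != 0) ==> (b' == b)]
    & [forall a', (M a' b != 0) ==> (a' == a)]].

Lemma pivotP (M : 'M[F]_N) a b : reflect
  [/\ M a b != 0, forall b', b' != b -> M a b' = 0 & forall a', a' != a -> M a' b = 0]
  (pivot M a b).
Proof.
apply: (iffP and3P) => -[nz h1 h2]; split=> //.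
- move=> b' nb; apply/eqP; apply: contraNT nb => nz'.
  by have /forallP/(_ b')/implyP/(_ nz') := h1.
- move=> a' na; apply/eqP; apply: contraNT na => nz'.
  by have /forallP/(_ a')/implyP/(_ nz') := h2.
- by apply/forallP=> b'; apply/implyP; apply: contraNT => /h1->.
by apply/forallP=> a'; apply/implyP; apply: contraNT => /h2->.
Qed.

Definition unpivoted (M : 'M[F]_N) := [set a | ~~ [exists b, pivot M a b]].

(* A nonzero entry whose column has minimal color d among those meeting unpivoted rows,
   and whose row has maximal color c in this column, can be turned into a pivot by
   elements of cP c on the left and cP d on the right. *)
Lemma pivot_step c d y : unpivoted (X y) != set0 ->
  exists p q, [/\ p \in cP X c, q \in cP X d &
    unpivoted (X (p * y * q)%g) \proper unpivoted (X y)].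
Proof.
case/set0Pn=> a0 Ua0; have [b0 nz0] := gl_row_neq0 y a0.
pose candb b := [exists a, (a \in unpivoted (X y)) && (X y a b != 0)].
have cb0 : candb b0 by apply/existsP; exists a0; rewrite Ua0.
have [b /existsP[a1 /andP[Ua1 nz1]] bmin] := arg_minnP d cb0.
have [a nzab amax] := arg_maxnP c (P := fun a => X y a b != 0) nz1.
have Ua a' : X y a' b != 0 -> a' \in unpivoted (X y).
  rewrite inE => nz'; apply/negP => /existsP[b' /pivotP[_ row col]].
  have bb' : b = b' by apply/eqP; apply: contraNT nz' => /row->.
  rewrite inE in Ua1; case/negP: Ua1; apply/existsP; exists b'; rewrite -bb'.
  have -> : a1 = a' by apply/eqP; apply: contraNT nz1 => /col; rewrite -bb' => ->.
  by apply/pivotP; rewrite bb'; split=> //; rewrite -bb'.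
pose v := (X y a b)^-1.
pose u : 'cV[F]_N := \col_i (- (X y i b * v) *+ (i != a)).
pose w : 'rV[F]_N := \row_j (- (v * X y a j) *+ (j != b)).
have unitp : 1%:M + u *m delta_mx 0 a \in unitmx.
  by apply: unitmx_rank1; rewrite -rowE; apply/matrixP=> i j; rewrite !mxE eqxx.
have unitq : 1%:M + delta_mx b 0 *m w \in unitmx.
  by apply: unitmx_rank1; rewrite -colE; apply/matrixP=> i j; rewrite !mxE eqxx.
pose p := gl_of X (1%:M + u *m delta_mx 0 a).
pose q := gl_of X (1%:M + delta_mx b 0 *m w).
have pE x i j : X (p * x)%g i j = X x i j - X y i b * v * X x a j *+ (i != a).
  rewrite gl_mxM gl_ofK // mulmxDl mul1mx -mulmxA -rowE mxE; congr (_ + _).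
  by rewrite mxE big_ord1 !mxE; case: (i != a); rewrite ?mulNr // mul0r oppr0.
have qE x i j : X (x * q)%g i j = X x i j - X x i b * v * X y a j *+ (j != b).
  rewrite gl_mxM gl_ofK // mulmxDr mulmx1 mulmxA -colE mxE; congr (_ + _).
  by rewrite mxE big_ord1 !mxE; case: (j != b); rewrite ?mulrN ?mulrA // mulr0 oppr0.
exists p, q.
have Pp : p \in cP X c.
  apply/cPP=> i j; rewrite -[p]mulg1 pE !gl1E.
  case: (i =P j) => [-> // | _]; rewrite sub0r oppr_eq0.
  case: (a =P j) => [<- | _]; last by rewrite mulr0 mul0rn eqxx.
  case: (i =P a) => [-> // | _]; rewrite mulr1 mulr1n mulf_eq0 negb_or => /andP[nz _].
  exact: amax.
have Pq : q \in cP X d.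
  apply/cPP=> i j; rewrite -[q]mul1g qE !gl1E.
  case: (i =P j) => [-> // | _]; rewrite sub0r oppr_eq0.
  case: (i =P b) => [-> | _]; last by rewrite !mul0r mul0rn eqxx.
  case: (j =P b) => [-> // | _]; rewrite mul1r mulr1n mulf_eq0 negb_or => /andP[_ nz].
  by apply: bmin; apply/existsP; exists a; rewrite nz Ua.
have pcol i : i != a -> X (p * y)%g i b = 0.
  by move=> ia; rewrite pE ia -mulrA mulVf // mulr1 subrr.
have prow j : X (p * y)%g a j = X y a j by rewrite pE eqxx subr0.
have wa j : j != b -> X (p * y * q)%g a j = 0.
  by move=> jb; rewrite qE jb !prow mulfV // mul1r subrr.
have wab : X (p * y * q)%g a b = X y a b by rewrite qE eqxx prow subr0.
have wb i : i != a -> X (p * y * q)%g i b = 0.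
  by move=> ia; rewrite qE eqxx subr0 pcol.
have wij i j : i != a -> X (p * y * q)%g i j = X (p * y)%g i j.
  by move=> ia; rewrite qE pcol // !mul0r mul0rn subr0.
have pivab : pivot (X (p * y * q)%g) a b.
  by apply/pivotP; rewrite wab; split.
split=> //; apply/properP; split; last first.
  exists a; first exact: Ua.
  by rewrite inE negbK; apply/existsP; exists b.
apply/subsetP=> i; rewrite !inE; apply: contra => /existsP[j /pivotP[nz row col]].
have ia : i != a.
  apply: contraTneq (Ua a nzab) => <-; rewrite inE negbK.
  by apply/existsP; exists j; apply/pivotP.
have jb : j != b.
  by apply: contraNneq nzab => jb; rewrite -jb col // eq_sym.
have yaj : X y a j = 0 by rewrite col // eq_sym.
have yib : X y i b = 0 by rewrite row // eq_sym.
apply/existsP; exists j; apply/pivotP; split=> [|j' nj | i' ni].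
- by rewrite wij // pE yib !mul0r mul0rn subr0.
- by rewrite wij // pE yib !mul0r mul0rn subr0 row.
have [-> | ia'] := eqVneq i' a; first by rewrite wa.
by rewrite wij // pE yaj mulr0 mul0rn subr0 col.
Qed.

(** Induction on the number of rows without pivot. Only existence is claimed, as a double coset may
    contain several permutation matrices; those from [stab_psi] are compared in
    [double_coset_stab]. *)
Lemma bruhat c d x : exists p s q,
  [/\ p \in cP X c, q \in cP X d & x = (p * gl_perm X s * q)%g].
Proof.
have [m] := ubnP #|unpivoted (X x)|; elim: m x => // m IHm x; rewrite ltnS => le_m.
have [U0 | nU] := eqVneq (unpivoted (X x)) set0; last first.
  have [p [q [Pp Pq ltU]]] := pivot_step c d nU.
  have [p1 [s [q1 [Pp1 Pq1 Dx]]]] := IHm _ (leq_trans (proper_card ltU) le_m).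
  exists (p^-1 * p1)%g, s, (q1 * q^-1)%g; rewrite !groupM ?groupV //; split=> //.
  by rewrite !mulgA -(mulgA p^-1%g) -(mulgA p^-1%g) -Dx -!mulgA mulgV mulg1 mulKg.
have /fin_all_exists[f pivf] a : exists b, pivot (X x) a b.
  by apply/existsP; have := in_set0 a; rewrite -U0 inE => /negbFE.
have inj_f : injective f.
  move=> a a' faa; have /pivotP[_ _ col] := pivf a'; have /pivotP[nz _ _] := pivf a.
  by apply/eqP; apply: contraNT nz => /col; rewrite faa => ->.
(* All rows have pivots, so x is monomial; removing its permutation leaves a diagonal matrix, which
   lies in every [cP c]. *)
exists (x * (gl_perm X (perm inj_f))^-1)%g, (perm inj_f), 1%g; rewrite group1 mulg1 mulgKV.
split=> //; apply/cPP=> a b.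
rewrite -(gl_mul_perm X (perm inj_f)) mulgKV permE => nz.
have /pivotP[_ row _] := pivf a.
suffices /inj_f-> : f b = f a by [].
by apply/eqP; apply: contraNT nz => /row->.
Qed.

(** Some term of the Leibniz expansion of the determinant is nonzero. *)
Lemma gl_diag_perm x : exists s, forall a, X x a (s a) != 0.
Proof.
suffices [s /forallP nz] : exists s : 'S_N, [forall a, X x a (s a) != 0] by exists s.
apply/existsP; apply: contraT => /existsPn no.
have := gl_unit X x; rewrite unitmxE /determinant big1 ?unitr0 // => s _.
have [a z] : exists a, X x a (s a) == 0.
  by have := no s; rewrite negb_forall => /existsP[a]; rewrite negbK; exists a.
by rewrite (bigD1 a) //= (eqP z) mul0r mulr0.
Qed.

End Bruhat.

(** * Conjugation between Levi subgroups *)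

Section LeviConjugation.

Variables (F : finFieldType) (N : nat) (gT : finGroupType) (X : gl_model F N gT).
Implicit Types (x y g : gT) (m b : 'I_N -> nat) (i j : 'I_N) (s : 'S_N).

(* Over F_2 a block of size 1 contributes only the identity to the Levi subgroup,
   so it cannot be recovered from it; the other blocks are called big. *)
Definition big_block m i :=
  [exists j, (j != i) && (m j == m i)] || [exists t : F, (t != 0) && (t != 1)].

Lemma eq_big_block m i j : m i = m j -> big_block m i -> big_block m j.
Proof.
move=> mij /orP[/existsP[k /andP[ki /eqP mk]] | ht]; last by rewrite /big_block ht orbT.
apply/orP; left; apply/existsP; have [eq_ij | ne_ij] := eqVneq i j.
  by exists k; rewrite -eq_ij ki mk eqxx.
by exists i; rewrite ne_ij mij eqxx.
Qed.

(** The product is the entry (i, j) of g^-1 M g for M = [delta_mx c d]. It vanishes because M is, up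
    to a nonzero scalar, a difference of two elements of the Levi subgroup. *)
Lemma levi_conj_entries m b g : {in cL X m, forall x, (x ^ g)%g \in cL X b} ->
  forall c d, m c = m d -> big_block m c ->
  forall i j, b i <> b j -> X g^-1%g i c * X g d j = 0.
Proof.
move=> gmb c d mcd big_c i j ne_ij.
pose ok (M : 'M[F]_N) := (X g^-1%g *m M *m X g) i j = 0.
suffices okE : ok (delta_mx c d).
  have := okE; rewrite /ok -(mul_delta_mx (0 : 'I_1)) mulmxA -colE -mulmxA -rowE.
  by rewrite mxE big_ord1 !mxE.
have okL x : x \in cL X m -> ok (X x).
  move=> /gmb/cLP Lx; apply/eqP; apply: contra_notT ne_ij => nz; apply: Lx.
  by rewrite conjgE !gl_mxM mulmxA.
have okB M1 M2 : ok M1 -> ok M2 -> ok (M1 - M2).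
  rewrite /ok mulmxBr mulmxBl => ok1 ok2.
  by rewrite mxE ok1 mxE ok2 subr0.
have okT p q : p != q -> m p = m q -> ok (delta_mx p q).
  move=> npq mpq; have u : 1%:M + delta_mx p q \in @unitmx F N.
    rewrite -(mul_delta_mx (0 : 'I_1)); apply: unitmx_rank1.
    by rewrite mul_delta_mx_cond eq_sym (negPf npq) mulr0n.
  have -> : delta_mx p q = X (gl_of X (1%:M + delta_mx p q)) - X 1%g.
    by rewrite gl_ofK // gl_mx1 addrC addKr.
  apply: okB; apply: okL; last exact: group1.
  apply/cLP=> a b'; rewrite gl_ofK // !mxE.
  have [-> // | _] := eqVneq a b'; rewrite add0r.
  by case: (a =P p) => [->|]; case: (b' =P q) => [->|] //=; rewrite eqxx.
have [<- | ncd] := eqVneq c d; last exact: okT.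
case/orP: big_c => [/existsP[k /andP[kc /eqP mkc]] | /existsP[t /andP[t0 t1]]].
  (* If x swaps c and k, then E_cc = (1 + E_ck) x - x. *)
  pose x := gl_perm X (tperm c k).
  have Lx : x \in cL X m.
    apply/cLP=> a b'; rewrite gl_permE; case: (tperm c k a =P b') => [<- _ | _]; last by rewrite eqxx.
    by case: tpermP => [->|->|].
  have u : 1%:M + delta_mx c k \in @unitmx F N.
    rewrite -(mul_delta_mx (0 : 'I_1)); apply: unitmx_rank1.
    by rewrite mul_delta_mx_cond (negPf kc) mulr0n.
  pose y := gl_of X (1%:M + delta_mx c k).
  have Ly : y \in cL X m.
    apply/cLP=> a b'; rewrite gl_ofK // !mxE.
    have [-> // | _] := eqVneq a b'; rewrite add0r.
    by case: (a =P c) => [->|]; case: (b' =P k) => [->|] //=; rewrite eqxx.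
  have -> : delta_mx c c = X (y * x)%g - X x.
    rewrite gl_mxM [X y]gl_ofK // mulmxDl mul1mx addrC addKr gl_ofK ?unitmx_perm //.
    apply/matrixP=> a b'; rewrite -[tperm c k]tpermV -col_permE !mxE.
    have -> // : (tperm c k b' == k) = (b' == c).
    by rewrite -(inj_eq (@perm_inj _ (tperm c k)) b' c) tpermL.
  by apply: okB; apply: okL; rewrite ?groupM.
(* Scaling the index c by t differs from the identity by (t - 1) E_cc. *)
have u : 1%:M + (t - 1) *: delta_mx c c \in @unitmx F N.
  pose e : 'rV_N := \row_k (if k == c then t else 1).
  have -> : 1%:M + (t - 1) *: delta_mx c c = diag_mx e :> 'M[F]_N.
    apply/matrixP=> a b'; rewrite !mxE; have [<- | nab] := eqVneq a b'.
      by case: (a == c); rewrite /= !mulr1n ?mulr1 ?mulr0 ?addr0 // addrC subrK.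
    rewrite mulr0n add0r; case: (a =P c) => [ac|]; case: (b' =P c) => [bc|] /=; rewrite ?mulr0 //.
    by rewrite ac bc eqxx in nab.
  rewrite unitmxE det_diag unitfE prodf_seq_neq0; apply/allP=> k _ /=.
  by rewrite mxE; case: ifP; rewrite ?oner_eq0.
have okS : ok (X (gl_of X (1%:M + (t - 1) *: delta_mx c c)) - X 1%g).
  apply: okB; apply: okL; last exact: group1.
  apply/cLP=> a b'; rewrite gl_ofK // !mxE.
  have [-> // | _] := eqVneq a b'; rewrite add0r.
  by case: (a =P c) => [->|]; case: (b' =P c) => [->|] //=; rewrite mulr0 eqxx.
move: okS; rewrite gl_ofK // gl_mx1 addrC addKr /ok -scalemxAr -scalemxAl mxE => /eqP.
by rewrite mulf_eq0 subr_eq0 (negPf t1) => /eqP.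
Qed.

(** Let s be a transversal of nonzero entries of g. If all blocks of m are big, the entries of g
    match the two colorings along s, and (gl_perm s)^-1 g lies in L_b. In general g is first
    multiplied by an element z which centralises L_m. *)
Lemma levi_conj m b g : (cL X m :^ g)%g = cL X b -> exists s l,
  [/\ forall i j, (m i == m j) = (b (s i) == b (s j)), l \in cL X b
    & {in cL X m, forall x, x ^ g = x ^ (gl_perm X s * l)}%g].
Proof.
move=> Lg; have Lmb : {in cL X m, forall x, (x ^ g)%g \in cL X b}.
  by move=> x Lx; rewrite -Lg memJ_conjg.
have Lbm : {in cL X b, forall x, (x ^ g^-1)%g \in cL X m}.
  by move=> x; rewrite -Lg mem_conjg.
have K1 := levi_conj_entries Lmb; have K2 := levi_conj_entries Lbm.
rewrite invgK in K2; have [s gs] := gl_diag_perm X g.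
have c1 i a : big_block m i -> X g^-1%g a i != 0 -> b a = b (s i).
  move=> bi nz; apply/eqP; apply: contraNT nz => /eqP ne.
  have /eqP := K1 i i erefl bi _ _ ne; by rewrite mulf_eq0 (negPf (gs i)) orbF.
have c2 i d j : big_block m i -> m d = m i -> X g d j != 0 -> b j = b (s i).
  move=> bi mdi nz; have [a nza] := gl_col_neq0 X g^-1%g i.
  rewrite -(c1 i a bi nza); apply/esym/eqP; apply: contraNT nz => /eqP ne.
  have /eqP := K1 i d (esym mdi) bi _ _ ne; by rewrite mulf_eq0 (negPf nza).
have eq_ms i j : (m i == m j) = (b (s i) == b (s j)).
  have [<- | nij] := eqVneq i j; first by rewrite !eqxx.
  apply/eqP/eqP=> [mij | bij].
    apply/esym; apply: (c2 i j) => //; apply/orP; left; apply/existsP; exists j.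
    by rewrite eq_sym nij mij eqxx.
  have [a nza] := gl_row_neq0 X g^-1%g (s i).
  suffices h k : b (s k) = b (s i) -> big_block b (s k) -> m k = m a.
    rewrite (h i) ?(h j) //.
      apply/orP; left; apply/existsP; exists (s i).
      by rewrite (inj_eq perm_inj) nij bij eqxx.
    apply/orP; left; apply/existsP; exists (s j).
    by rewrite (inj_eq perm_inj) eq_sym nij bij eqxx.
  move=> bki big_k; apply/eqP; apply: contraNT (gs k) => /eqP ne.
  have /eqP := K2 _ _ bki big_k _ _ ne; by rewrite mulf_eq0 (negPf nza) orbF.
have hz i c : ~~ big_block m i -> big_block m c -> X g^-1%g (s i) c = 0.
  move=> nbi bc; apply/eqP; apply: contraNT nbi => /(c1 _ _ bc)/eqP.
  by rewrite -eq_ms => /eqP mic; apply: eq_big_block bc.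
(* Outside big blocks, row i of k is row s i of g^-1, so that row i of k g is the basis vector of
   index s i; the other rows are those of the identity. Elements of L_m are trivial on rows outside
   big blocks, so k commutes with them. *)
pose k := \matrix_(i, j) if big_block m i then (i == j)%:R else X g^-1%g (s i) j.
pose k' := \matrix_(i, j) if big_block m i then (i == j)%:R else X g i (s j).
have kE (M : 'M[F]_N) i j : (k *m M) i j =
    if big_block m i then M i j else \sum_c X g^-1%g (s i) c * M c j.
  rewrite mxE; case: ifP => bi; last by apply: eq_bigr => c _; rewrite mxE bi.
  rewrite (bigD1 i) //= !mxE bi eqxx mul1r big1 ?addr0 // => c nc.
  by rewrite mxE bi eq_sym (negPf nc) mul0r.
have kk' : k *m k' = 1%:M.
  apply/matrixP=> i j; rewrite kE mxE; case: ifP => [bi | /negbT nbi].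
    by rewrite mxE bi.
  transitivity (X (g^-1 * g)%g (s i) (s j)); last first.
    by rewrite mulVg gl1E (inj_eq perm_inj) mxE.
  rewrite glME; apply: eq_bigr => c _; rewrite mxE.
  by case: (boolP (big_block m c)) => // bc; rewrite hz // !mul0r.
have [uk _] := mulmx1_unit kk'; pose z := gl_of X k.
exists s, ((gl_perm X s)^-1 * z * g)%g; split=> //.
  apply/cLP=> a j; rewrite -[a](permKV s); move: (s^-1%g a) => i {a}.
  rewrite -gl_permV -mulgA gl_perm_mul permK gl_mxM gl_ofK // kE.
  case: ifP => [bi nz | /negbT nbi]; first by rewrite (c2 i i).
  by rewrite -glME mulVg gl1E; case: (s i =P j) => [-> | _]; rewrite ?eqxx.
move=> x Lx; rewrite !mulgA mulgV mul1g conjgM; congr (_ ^ g)%g.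
suffices cz : (z * x = x * z)%g by rewrite conjgE -cz mulKg.
apply: (gl_eqP (X := X)) => i j; rewrite gl_mxM gl_ofK // kE glME; move/cLP: Lx => Lx.
have xnb c j' : ~~ big_block m c -> X x c j' = (c == j')%:R.
  rewrite negb_or => /andP[/existsPn h1 /existsPn h2].
  have d0 l : l != c -> X x c l = 0.
    move=> lc; apply/eqP; have := h1 l; rewrite lc /=.
    by apply: contraNT => /Lx ->.
  have [<- | nc] := eqVneq c j'; last by rewrite d0 // eq_sym.
  have [l nz] := gl_row_neq0 X x c.
  have lc : l = c by apply/eqP; apply: contraNT nz => /d0->.
  by rewrite lc in nz; have := h2 (X x c c); rewrite nz negbK => /eqP.
case: ifP => [bi | /negbT nbi].
  rewrite [RHS](bigD1 j) //= [X in _ + X]big1 ?addr0 => [|c nc].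
    have [xz | nz] := eqVneq (X x i j) 0; first by rewrite xz mul0r.
    by rewrite gl_ofK // mxE (eq_big_block (Lx _ _ nz) bi) eqxx mulr1.
  have [xz | nz] := eqVneq (X x i c) 0; first by rewrite xz mul0r.
  by rewrite gl_ofK // mxE (eq_big_block (Lx _ _ nz) bi) (negPf nc) mulr0.
rewrite [RHS](bigD1 i) //= [X in _ + X]big1 ?addr0 => [|c nc]; last first.
  by rewrite xnb // eq_sym (negPf nc) mul0r.
rewrite xnb // eqxx mul1r gl_ofK // mxE (negPf nbi).
rewrite (bigD1 j) //= big1 ?addr0 => [|c nc].
  case: (boolP (big_block m j)) => bj; first by rewrite hz // mul0r.
  by rewrite xnb // eqxx mulr1.
case: (boolP (big_block m c)) => bc; first by rewrite hz // mul0r.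
by rewrite xnb // (negPf nc) mulr0.
Qed.

End LeviConjugation.

(** * From colorings to compositions *)

Section SortingColorings.

Variable N : nat.
Implicit Type c : 'I_N.+1 -> nat.

(** The permutation lists the indices color by color, in increasing order of color, and mu records
    the multiplicity of each color that occurs, so no part is 0. *)
Lemma coloring_composition c : exists (mu : seq nat) (s : 'S_N.+1),
  is_composition mu N.+1 /\
  forall a b, (c (s a) <= c (s b))%N = (reshape_index mu a <= reshape_index mu b)%N.
Proof.
pose vals := sort leq (undup [seq c a | a <- enum 'I_N.+1]).
pose block v := [seq a <- enum 'I_N.+1 | c a == v].
pose ss := map block vals; pose mu := shape ss.
have vals_mem v : (v \in vals) = (v \in [seq c a | a <- enum 'I_N.+1]).
  by rewrite mem_sort mem_undup.
have vals_sorted : sorted ltn vals.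
  by rewrite ltn_sorted_uniq_leq sort_uniq undup_uniq sort_sorted //; apply: leq_total.
have flat_perm : perm_eq (flatten ss) (enum 'I_N.+1).
  apply: uniq_perm; [|exact: enum_uniq|].
    have : uniq vals by rewrite sort_uniq undup_uniq.
    rewrite /ss; elim: (vals) => //= v vs IH /andP[v_vs uvs]; rewrite cat_uniq IH // andbT.
    rewrite filter_uniq ?enum_uniq //=; apply/hasPn=> a /flattenP[_ /mapP[w w_vs ->]].
    rewrite !mem_filter => /andP[/eqP-> _]; rewrite negb_and; apply/orP; left.
    by apply: contraNneq v_vs => <-.
  move=> a; rewrite mem_enum; apply/flattenP; exists (block (c a)).
    by apply: map_f; rewrite vals_mem map_f ?mem_enum.
  by rewrite mem_filter eqxx mem_enum.
have size_flat : size (flatten ss) = N.+1 by rewrite (perm_size flat_perm) size_enum_ord.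
have uniq_flat : uniq (flatten ss) by rewrite (perm_uniq flat_perm) enum_uniq.
pose f (a : 'I_N.+1) := nth ord0 (flatten ss) a.
have inj_f : injective f.
  by move=> a b /eqP; rewrite nth_uniq ?size_flat // => /eqP/val_inj.
have sum_mu : sumn mu = N.+1 by rewrite -size_flat size_flatten.
have idx_lt (a : 'I_N.+1) : (reshape_index mu a < size vals)%N.
  by have := @reshape_indexP mu a; rewrite sum_mu ltn_ord size_map size_map => ->.
have cf a : c (f a) = nth 0%N vals (reshape_index mu a).
  rewrite /f nth_flatten -/mu; have lt_a := idx_lt a.
  have : nth ord0 (nth [::] ss (reshape_index mu a)) (reshape_offset mu a)
           \in nth [::] ss (reshape_index mu a).
    apply: mem_nth; have := @reshape_offsetP mu a; rewrite sum_mu ltn_ord => /(_ isT).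
    by rewrite /mu (nth_map [::]) // size_map.
  by rewrite {2}/ss (nth_map 0%N) // mem_filter => /andP[/eqP].
exists mu, (perm inj_f); split.
  rewrite /is_composition sum_mu eqxx andbT; apply/mapP=> -[l /mapP[v v_vals ->]].
  move=> /esym/size0nil l0; move: v_vals; rewrite vals_mem => /mapP[a _ Dv].
  by have : a \in block v by [rewrite mem_filter mem_enum Dv eqxx]; rewrite l0.
move=> a b; rewrite !permE !cf.
have mono i j : (i < j)%N -> (j < size vals)%N -> (nth 0%N vals i < nth 0%N vals j)%N.
  by move=> lt_ij lt_j; apply: (sorted_ltn_nth ltn_trans) => //; rewrite inE ?lt_j ?(ltn_trans lt_ij).
case: (ltngtP (reshape_index mu a) (reshape_index mu b)) => [lt | lt | ->].
- by rewrite ltnW // mono.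
- by rewrite leqNgt mono.
by rewrite leqnn.
Qed.

End SortingColorings.

Lemma leq_sum_eq (I : finType) (f h : I -> nat) :
  (forall i, f i <= h i)%N -> (\sum_i f i = \sum_i h i)%N -> f =1 h.
Proof.
move=> le_fh eq_fh i; apply/eqP.
have /leqif_sum : forall i, true -> (f i <= h i ?= iff (f i == h i))%N.
  by move=> j _; split.
case=> _; rewrite eq_fh eqxx => /esym/forallP/(_ i).
by [].
Qed.

(** * Harish-Chandra series of cuspidal pairs *)

Section HCInduction.

Variables (K : closedFieldType) (charK0 : [pchar K] =i pred0).
Variables (F : fieldType) (N : nat) (gT : finGroupType) (X : gl_model F N gT).
Local Notation G := [set: gT]%G.
Implicit Types (x y u g : gT) (b c d : 'I_N -> nat) (i j k : 'I_N) (s t : 'S_N).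
Implicit Types (psi theta chi : {ffun gT -> K}).

Definition HCind c theta := char_ind G (cP_group X c) (infl X c theta).

Definition conjfun g (f : {ffun gT -> K}) : {ffun gT -> K} := [ffun x => f (x ^ g)%g].

Lemma cP_group_perm c s : (cP_group X c :^ (gl_perm X s)^-1)%G = cP_group X (c \o s).
Proof.
apply: val_inj => /=; rewrite -gl_permV cPJ invgK; apply: eq_cP => i j.
by rewrite /=.
Qed.

Lemma cL_group_perm c s : (cL_group X c :^ (gl_perm X s)^-1)%G = cL_group X (c \o s).
Proof. by apply: val_inj => /=; rewrite -gl_permV cLJ invgK. Qed.

Lemma is_char_perm c s theta : is_char (cL_group X c) theta ->
  is_char (cL_group X (c \o s)) (conjfun (gl_perm X s) theta).
Proof. by rewrite -cL_group_perm; apply: is_char_conj. Qed.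

Lemma is_irr_char_perm c s theta : is_irr_char (cL_group X c) theta ->
  is_irr_char (cL_group X (c \o s)) (conjfun (gl_perm X s) theta).
Proof.
move=> irr_th; have ch_th := irr_is_char irr_th.
apply: (cdot1_irr charK0); first exact: is_char_perm.
rewrite -(irr_cdot1 charK0 irr_th) -cL_group_perm /cdot /= cardJg; congr (_ * _).
rewrite [RHS](reindex_inj (conjg_inj (gl_perm X s))) /=.
by apply: eq_big => [x | x _]; rewrite ?mem_conjgV // !ffunE conjVg.
Qed.

Lemma infl_perm c s theta :
  conjfun (gl_perm X s) (infl X c theta) = infl X (c \o s) (conjfun (gl_perm X s) theta).
Proof.
apply/ffunP=> x; rewrite !ffunE mem_cP_perm; case: (boolP (x \in _)) => // Px.
by rewrite lpart_perm.
Qed.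

Lemma HCind_perm c s theta : HCind (c \o s) (conjfun (gl_perm X s) theta) = HCind c theta.
Proof.
apply/ffunP=> x; rewrite !ffunE -infl_perm -cP_group_perm /= cardJg; congr (_ * _).
rewrite [RHS](reindex_inj (mulIg (gl_perm X s))) /=.
by apply: eq_big => [y | y _]; rewrite ?inE // ffunE conjgM.
Qed.

Lemma HCind_char c theta : is_char (cL_group X c) theta -> is_char G (HCind c theta).
Proof. by move/infl_char; apply: is_char_ind => //; apply: subsetT. Qed.

(** The groups [cU c :&: cL b] are the unipotent radicals of the parabolic subgroups of L_b
    containing the torus, proper ones if c separates two indices of a block. The vanishing sum says
    that psi has no vectors fixed by such a group. *)
Definition cuspidal_on b psi := forall c,
  (exists i j, b i = b j /\ c i <> c j) -> \sum_(u in cU X c :&: cL X b) psi u = 0.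

Lemma eq1_cU c d : c =1 d -> cU X c = cU X d.
Proof.
move=> cd; apply/setP=> x; rewrite !inE; congr (_ && _); apply: eq_forallb => i;
by apply: eq_forallb => j; rewrite !cd.
Qed.

Lemma cuspidal_on_perm b s psi : cuspidal_on b psi ->
  cuspidal_on (b \o s) (conjfun (gl_perm X s) psi).
Proof.
move=> cusp c [i [j [bij cij]]]; rewrite -[RHS](cusp (c \o s^-1%g)); last first.
  by exists (s i), (s j); rewrite /= !permK.
rewrite [RHS](reindex_inj (conjg_inj (gl_perm X s))) /=.
apply: eq_big => [u | u _]; last by rewrite ffunE.
rewrite !in_setI mem_cU_perm mem_cL_perm; congr (_ && _).
by rewrite [cU X ((c \o _) \o s)](@eq1_cU _ c) // => k; rewrite /= permK.
Qed.

(** The order of the colors is ignored: the Levi subgroups agree, while the parabolic subgroups may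
    differ. *)
Definition same_blocks b c := forall i j, (b i == b j) = (c i == c j).

Lemma same_cL b c : same_blocks b c -> cL_group X b = cL_group X c.
Proof. by move=> bc; apply: val_inj; apply: eq_cL. Qed.

Lemma same_lpart b c x : same_blocks b c -> lpart X b x = lpart X c x.
Proof.
move=> bc; rewrite /lpart; congr (gl_of X _).
by apply/matrixP=> i j; rewrite !mxE bc.
Qed.

Lemma same_cuspidal b c psi : same_blocks b c -> cuspidal_on b psi -> cuspidal_on c psi.
Proof.
move=> bc cusp d [i [j [/eqP cij dij]]]; have /(congr1 val) /= <- := same_cL bc.
by apply: cusp; exists i, j; split=> //; apply/eqP; rewrite bc.
Qed.

Lemma cdot_infl_L b c psi theta (Q : {set gT}) :
  {in Q, forall x, x^-1%g \in Q} -> Q \subset cL X b -> Q \subset cL X c ->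
  cdot Q (infl X b psi) (infl X c theta) = cdot Q psi theta.
Proof.
move=> QV /subsetP sQb /subsetP sQc; rewrite /cdot; congr (_ * _).
by apply: eq_bigr => x Qx; rewrite !infl_L ?sQb ?sQc ?QV.
Qed.

(** If c separated two indices of a block of b, the group [cU c :&: cL b] would act trivially on the
    inflation of theta, so psi would have vectors fixed by it, against cuspidality. *)
Lemma cuspidal_constant b c psi theta :
    is_char (cL_group X b) psi -> is_char (cL_group X c) theta -> cuspidal_on b psi ->
    cdot (cP X b :&: cP X c) (infl X b psi) (infl X c theta) != 0 ->
  forall i j, b i = b j -> c i = c j.
Proof.
move=> ch_psi ch_th cusp nz i j bij; apply/eqP; apply: contraT => /eqP cij.
have z : \sum_(u in cU X c :&: cL X b) psi u = 0 by apply: cusp; exists i, j.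
have chb := infl_char ch_psi; have chc := infl_char ch_th.
pose S := (cU_group X c :&: cL_group X b)%G.
have sSQ : S \subset (cP_group X b :&: cP_group X c)%G.
  by rewrite /= setIC; apply: setISS; rewrite ?cL_sub_cP ?cU_sub_cP.
have nzS := cdot_sub_neq0 charK0 sSQ (subsetIl _ _) (subsetIr _ _) chb chc nz.
have := sum_fixed_neq0 _ nzS.
rewrite (eq_bigr psi) => [|u /setIP[_ Lu]]; last by rewrite infl_L.
by rewrite [X in X != 0]z eqxx; apply=> u /setIP[Uu _]; rewrite !infl_U ?group1.
Qed.

Lemma mackey_perm b c s psi theta :
    is_char (cL_group X b) psi -> is_char (cL_group X c) theta ->
  mackey (cP_group X b) (infl X b psi) (infl X c theta) (gl_perm X s)
    = #|cP X b :&: cP X (c \o s)|%:R * cdot (cP X b :&: cP X (c \o s))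
        (infl X b psi) (infl X (c \o s) (conjfun (gl_perm X s) theta)).
Proof.
move=> ch_psi ch_th; rewrite (mackeyE charK0 _ (infl_char ch_psi) (infl_char ch_th)).
by rewrite -infl_perm -[cP X (c \o s)]/(gval (cP_group X (c \o s))) -cP_group_perm.
Qed.

Lemma mackey_neq0 b c g psi theta :
    is_char (cL_group X b) psi -> is_char (cL_group X c) theta ->
    mackey (cP_group X b) (infl X b psi) (infl X c theta) g != 0 ->
  exists p s q, [/\ p \in cP X b, q \in cP X c, g = (p * gl_perm X s * q)%g &
    cdot (cP X b :&: cP X (c \o s)) (infl X b psi)
      (infl X (c \o s) (conjfun (gl_perm X s) theta)) != 0].
Proof.
move=> ch_psi ch_th; have [p [s [q [Pp Pq ->]]]] := bruhat X b c g.
rewrite (mackeyM _ (infl_char ch_psi) (infl_char ch_th)) // mackey_perm // => nz.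
by exists p, s, q; split=> //; apply: contraNneq nz => ->; rewrite mulr0.
Qed.

Section CuspidalPair.

Variables (b0 : 'I_N -> nat) (psi : {ffun gT -> K}).
Hypotheses (psi_irr : is_irr_char (cL_group X b0) psi) (psi_cusp : cuspidal_on b0 psi).

(** Modulo [levi_perms], this is the stabiliser of psi in the relative Weyl group of L_0. *)
Definition stab_psi := [set s : 'S_N |
  [forall i, forall j, (b0 i == b0 j) == (b0 (s i) == b0 (s j))]
  && (conjfun (gl_perm X s) psi == psi)].

Lemma stab_psiP s : reflect (same_blocks b0 (b0 \o s) /\ conjfun (gl_perm X s) psi = psi)
  (s \in stab_psi).
Proof.
rewrite inE; apply: (iffP andP) => [[/forallP h /eqP ->] | [h ->]]; split=> //.
  by move=> i j; have /forallP/(_ j)/eqP := h i.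
by apply/forallP=> i; apply/forallP=> j; rewrite h.
Qed.

(** Cuspidality on both sides gives b and c composed with s the same blocks. Restricted to L_0, the
    nonzero inner product then joins psi and its conjugate, which are both irreducible. *)
Lemma mackey_cuspidal b c g : same_blocks b0 b -> same_blocks b0 c ->
    mackey (cP_group X b) (infl X b psi) (infl X c psi) g != 0 ->
  exists p s q, [/\ p \in cP X b, q \in cP X c, g = (p * gl_perm X s * q)%g
    & s \in stab_psi].
Proof.
move=> bb bc nz; have ch_psi := irr_is_char psi_irr.
have ch_b : is_char (cL_group X b) psi by rewrite -(same_cL bb).
have ch_c : is_char (cL_group X c) psi by rewrite -(same_cL bc).
have [p [s [q [Pp Pq Dg nzs]]]] := mackey_neq0 ch_b ch_c nz.
exists p, s, q; split=> //.
have ch_cs := is_char_perm s ch_c.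
have bcs := cuspidal_constant ch_b ch_cs (same_cuspidal bb psi_cusp) nzs.
have csb : forall i j, (c \o s) i = (c \o s) j -> b i = b j.
  rewrite setIC cdotC in nzs.
  exact: cuspidal_constant ch_cs ch_b (cuspidal_on_perm (same_cuspidal bc psi_cusp)) nzs.
have eqb : same_blocks b (c \o s) by move=> i j; apply/eqP/eqP => [/bcs | /csb].
have eq0 : same_blocks b0 (b0 \o s).
  by move=> i j; rewrite bb eqb /= bc.
apply/stab_psiP; split=> //; apply/esym/(irr_cdot_eq charK0 psi_irr).
  by rewrite (same_cL eq0); apply: is_irr_char_perm.
have defL : cL_group X b0 = cL_group X b := same_cL bb.
have sLb : cL_group X b0 \subset cP_group X b by rewrite defL; apply: cL_sub_cP.
have defLc : cL_group X b0 = cL_group X (c \o s) by rewrite defL; apply: same_cL.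
have sLc : cL_group X b0 \subset cP_group X (c \o s).
  by rewrite defLc; apply: cL_sub_cP.
rewrite -(@cdot_infl_L b (c \o s)).
- apply: (cdot_sub_neq0 charK0 _ _ _ (infl_char ch_b) (infl_char ch_cs) nzs).
  + by rewrite subsetI sLb.
  + exact: (@subsetIl _ (cP X b)).
  exact: (@subsetIr _ (cP X b)).
- by move=> x; rewrite groupV.
- by rewrite defL.
by rewrite defLc.
Qed.

(** The two inflations coincide on the intersection and are irreducible there, because the
    intersection maps onto L_0. *)
Lemma mackey_stab b c s : same_blocks b0 b -> same_blocks b0 c -> s \in stab_psi ->
  mackey (cP_group X b) (infl X b psi) (infl X c psi) (gl_perm X s)
    = #|cP X b :&: cP X (c \o s)|%:R.
Proof.
move=> bb bc /stab_psiP[eq0 Js]; have ch_psi := irr_is_char psi_irr.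
rewrite mackey_perm -?(same_cL bb) -?(same_cL bc) // Js.
pose Q := (cP_group X b :&: cP_group X (c \o s))%G.
have eqbc : same_blocks b (c \o s).
  by move=> i j; rewrite -bb eq0 /= bc.
have irrQ : is_irr_char Q [ffun x => psi (lpart X b x) *+ (x \in Q)].
  apply: (@is_irr_char_pull K gT gT Q (cL_group X b)).
  - by move=> x /setIP[Px _]; apply: lpart_L.
  - by move=> x y /setIP[Px _] /setIP[Py _]; apply: lpartM.
  - apply/subsetP=> x Lx; apply/imsetP; exists x; last by rewrite lpart_id.
    rewrite inE [x \in _](subsetP (cL_sub_cP X b)) //.
    by rewrite [x \in _](subsetP (cL_sub_cP X (c \o s))) // -[cL _ _]/(gval (cL_group X _)) -(same_cL eqbc).
  by rewrite -(same_cL bb).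
rewrite -[RHS]mulr1; congr (_ * _); rewrite -(irr_cdot1 charK0 irrQ).
apply: (@eq_cdotG K gT Q) => x Qx; case/setIP: (Qx) => Px Pcx; rewrite inflE // ffunE Qx //.
by rewrite (same_lpart _ eqbc).
Qed.

(** The Weyl group of L_0. *)
Definition levi_perms := [set s : 'S_N | [forall i, b0 (s i) == b0 i]].

Lemma levi_permsP s : reflect (forall i, b0 (s i) = b0 i) (s \in levi_perms).
Proof.
rewrite inE; apply: (iffP forallP) => h i; first exact/eqP.
by apply/eqP.
Qed.

Lemma levi_perm_L s : s \in levi_perms -> gl_perm X s \in cL X b0.
Proof.
move/levi_permsP=> h; apply/cLP=> i j; rewrite gl_permE.
by case: (s i =P j) => [<- | _]; rewrite ?h ?eqxx.
Qed.

Lemma stab_psiM s t : s \in stab_psi -> t \in levi_perms -> (s * t)%g \in stab_psi.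
Proof.
move=> /stab_psiP[eqs Js] Wt; apply/stab_psiP; split.
  by move=> i j; rewrite eqs /= !permM !(levi_permsP _ Wt).
apply/ffunP=> x; rewrite ffunE gl_permM conjgM.
rewrite (charJ _ (irr_is_char psi_irr)) ?levi_perm_L //.
by move/ffunP/(_ x): Js; rewrite ffunE.
Qed.

(** Colors do not decrease along nonzero entries of a parabolic subgroup, and a permutation that
    never decreases colors preserves them, by comparison of sums. Applied to a transversal of p^-1
    and then to q, this gives s i and t i the same color. *)
Lemma double_coset_stab b c s t p q : same_blocks b0 b -> same_blocks b0 c ->
    s \in stab_psi -> t \in stab_psi -> p \in cP X b -> q \in cP X c ->
  gl_perm X t = (p * gl_perm X s * q)%g -> (s^-1 * t)%g \in levi_perms.
Proof.
move=> bb bc /stab_psiP[eqs _] /stab_psiP[eqt _] Pp Pq Dt.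
have Dq : (gl_perm X s * q = p^-1 * gl_perm X t)%g by rewrite Dt -mulgA mulKg.
have Pp' : p^-1%g \in cP X b by rewrite groupV.
have [r nzr] := gl_diag_perm X p^-1%g.
have eq_br : (fun i => b i) =1 (fun i => b (r i)).
  apply: leq_sum_eq => [i|]; first exact: (cPP _ _ _ Pp').
  by rewrite [LHS](reindex_inj (@perm_inj _ r)).
have le_c i : (c (s i) <= c (t i))%N.
  have -> : c (t i) = c (t (r i)).
    by apply/eqP; rewrite -bc; have := eqt i (r i); rewrite /= => <-; rewrite bb -eq_br.
  apply: (cPP _ _ _ Pq); rewrite -(gl_perm_mul X s) Dq gl_mul_perm.
  exact: nzr.
have eq_c : (fun i => c (s i)) =1 (fun i => c (t i)).
  apply: leq_sum_eq => //; transitivity (\sum_i c i)%N.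
    by rewrite [RHS](reindex_inj (@perm_inj _ s)).
  by rewrite [LHS](reindex_inj (@perm_inj _ t)).
apply/levi_permsP=> i; rewrite permM; apply/eqP; rewrite bc -eq_c permKV.
by rewrite -bc.
Qed.

(** All s in [stab_psi] contribute equally, since the size of the double coset compensates the order
    of the intersection. The order of the blocks in b and c thus has no influence. *)
Lemma cdot_cuspidal b c : same_blocks b0 b -> same_blocks b0 c ->
  cdot G (HCind b psi) (HCind c psi) = #|stab_psi|%:R / #|levi_perms|%:R.
Proof.
move=> bb bc; have ch_psi := irr_is_char psi_irr.
have ch_b : is_char (cL_group X b) psi by rewrite -(same_cL bb).
have ch_c : is_char (cL_group X c) psi by rewrite -(same_cL bc).
rewrite /HCind (cdot_ind charK0) ?subsetT => [|//|x]; last exact: infl_out.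
set P := cP_group X b; set P' := cP_group X c.
pose T g := mackey P (infl X b psi) (infl X c psi) g; rewrite -/P -/P'.
have W_neq0 : #|levi_perms|%:R != 0 :> K.
  rewrite (natK_eq0 charK0) -lt0n; apply/card_gt0P; exists 1%g.
  by apply/levi_permsP=> i; rewrite perm1.
have TM p g q : p \in P -> q \in P' -> T (p * g * q)%g = T g.
  exact: (mackeyM _ (infl_char ch_b) (infl_char ch_c)).
(* The elements of [stab_psi] in a contributing double coset form a single coset of [levi_perms].
   Counting all of them instead of choosing representatives costs this factor. *)
have count g : #|levi_perms|%:R * T g =
    \sum_(s in stab_psi | gl_perm X s \in (P :* g * P')%g) T (gl_perm X s).
  have [z | nz] := eqVneq (T g) 0.
    rewrite z mulr0 big1 // => s /andP[_ /mulsgP[_ q /rcosetP[p Pp ->] Pq ->]].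
    by rewrite TM.
  have [p [s [q [Pp Pq Dg Ws]]]] := mackey_cuspidal bb bc nz.
  have Ts : T g = T (gl_perm X s) by rewrite Dg TM.
  transitivity (\sum_(t in levi_perms) T g).
    by rewrite sumr_const mulr_natl.
  have Pt t : t \in levi_perms -> gl_perm X t \in P'.
    by move/levi_perm_L; rewrite [cL X b0](congr1 val (same_cL bc)); apply/subsetP/cL_sub_cP.
  rewrite [RHS](reindex_inj (mulgI s)) /=; apply: eq_big => [t | t Wt]; last first.
    by rewrite gl_permM -[X in T (X * _)%g]mul1g TM ?group1 ?Pt.
  apply/idP/andP=> [Wt | [Wst /mulsgP[_ q' /rcosetP[p' Pp' ->] Pq' Dst]]].
    split; first exact: stab_psiM.
    apply/mulsgP; exists (p^-1 * g)%g (q^-1 * gl_perm X t)%g.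
    - by rewrite mem_rcoset mulgK groupV.
    - by rewrite groupM ?groupV ?Pt.
    by rewrite Dg gl_permM !mulgA mulVg mul1g mulgK.
  rewrite -[t](mulKg s); apply: (double_coset_stab bb bc Ws Wst (groupM Pp' Pp) (groupM Pq Pq')).
  by rewrite Dst Dg !mulgA.
apply: (mulfI W_neq0); rewrite [RHS]mulrCA mulfV // mulr1 mulrCA mulr_sumr.
rewrite (eq_bigr _ (fun g _ => count g)).
rewrite (exchange_big_dep (mem stab_psi)) /=; last by move=> g s _ /andP[].
rewrite (eq_bigr (fun=> (#|P| * #|P'|)%:R)) => [|s Ws].
  rewrite sumr_const -(mulr_natl (_ * _)%:R) mulrCA mulVf ?mulr1 //.
  by rewrite natrM mulf_neq0 ?(card_neq0 charK0 (cP_group X b)) ?(card_neq0 charK0 (cP_group X c)).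
(* By the product formula, the order of the intersection times the size of the double coset of s is
   |P| |P'|. *)
rewrite (eq_bigl (mem (P :* gl_perm X s * P')%g)) => [|g].
  rewrite sumr_const /T mackey_stab // -(mulr_natl (_%:R)) -natrM; congr (_%:R).
  have cJ : (cP X c :^ (gl_perm X s)^-1)%g = cP X (c \o s).
    exact: (congr1 val (cP_group_perm c s)).
  rewrite -(cardJg P' (gl_perm X s)^-1%g) [(P' :^ _)%g]cJ.
  rewrite (mul_cardG P (cP_group X (c \o s))) /=; congr (_ * _)%N.
  rewrite -cJ -(card_rcoset (cP X b * cP X c :^ (gl_perm X s)^-1)%g (gl_perm X s)); congr #|pred_of_set _|.
  by rewrite conjsgE invgK -!mulgA mulg_set1 mulVg -set1gE mulg1.
rewrite inE Ws /=; apply/mulsgP/mulsgP => -[_ q /rcosetP[p Pp ->] Pq ->].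
  exists (p^-1 * (p * g * q))%g q^-1%g; rewrite ?groupV //.
    by rewrite mem_rcoset mulgK groupV.
  by rewrite !mulgA mulVg mul1g mulgK.
exists (p^-1 * (p * gl_perm X s * q))%g q^-1%g; rewrite ?groupV //.
  by rewrite mem_rcoset mulgK groupV.
by rewrite !mulgA mulVg mul1g mulgK.
Qed.

(* The inner products of both characters with themselves and each other coincide. *)
Lemma HCind_same_blocks b c : same_blocks b0 b -> same_blocks b0 c ->
  HCind b psi = HCind c psi.
Proof.
move=> bb bc; have ch_psi := irr_is_char psi_irr.
apply: (@cdot_eq_char _ charK0 _ G); last by rewrite !cdot_cuspidal.
  by apply: HCind_char; rewrite -(same_cL bb).
by apply: HCind_char; rewrite -(same_cL bc).
Qed.

End CuspidalPair.

End HCInduction.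

(** * Norms and irreducibility of induced characters *)

Section MoreCharacters.

Variables (K : closedFieldType) (charK0 : [pchar K] =i pred0) (gT : finGroupType).
Implicit Types (G P Q S : {group gT}) (f h : {ffun gT -> K}).

Definition char_res (Q : {set gT}) f : {ffun gT -> K} := [ffun x => f x *+ (x \in Q)].

Lemma char_resE Q f x : x \in Q -> char_res Q f x = f x.
Proof. by move=> Qx; rewrite ffunE Qx. Qed.

Lemma is_char_res Q P f : Q \subset P -> is_char P f -> is_char Q (char_res Q f).
Proof. by move=> /subsetP sQP; apply: (@is_char_pull K gT gT Q P id). Qed.

Lemma irr_char1_neq0 G f : is_irr_char G f -> f 1%g != 0.
Proof.
move=> [n [rG [irrG ->]]]; rewrite repr_char1 (natK_eq0 charK0) -lt0n.
by have [] := proj1 (mx_irrP rG) irrG.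
Qed.

Lemma mackeyDl P f1 f2 (h : gT -> K) g :
  mackey P (f1 + f2 : {ffun gT -> K}) h g = mackey P f1 h g + mackey P f2 h g.
Proof.
rewrite /mackey -big_split; apply: eq_bigr => x _; by rewrite ffunE mulrDl.
Qed.

Lemma mackeyDr P (f : gT -> K) h1 h2 g :
  mackey P f (h1 + h2 : {ffun gT -> K}) g = mackey P f h1 g + mackey P f h2 g.
Proof.
rewrite /mackey -big_split; apply: eq_bigr => x _; by rewrite ffunE mulrDr.
Qed.

Lemma sum_mackey P f h : is_char P f -> is_char P h ->
  \sum_(g in P) mackey P f h g = (#|P| * #|P|)%:R * cdot P f h.
Proof.
move=> chf chh; rewrite (eq_bigr (fun=> #|P|%:R * cdot P f h)) => [|g Pg].
  by rewrite sumr_const -(mulr_natl (_ * _)) mulrA natrM.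
rewrite -[g]mul1g -[X in (X * _)%g](mulg1 1%g) (mackeyM _ chf chh) ?group1 //.
rewrite /cdot mulVKf ?card_neq0 //; apply: eq_bigr => u _; by rewrite conjg1.
Qed.

Lemma sum_nat (I : finType) (A : pred I) (f : I -> K) :
  (forall i, exists m : nat, f i = m%:R) -> exists m : nat, \sum_(i | A i) f i = m%:R.
Proof.
move=> /fin_all_exists[m fm]; exists (\sum_(i | A i) m i)%N.
by rewrite natr_sum; apply: eq_bigr => i _; rewrite fm.
Qed.

(** Equality of norms kills the part of Mackey's sum outside P for f + h. Its terms are natural
    numbers, so the part for f vanishes as well, and inducing f keeps its norm 1. *)
Lemma char_ind_irr G P f h : P \subset G -> is_char P f -> is_char P h ->
    cdot P (f + h) (f + h) = cdot G (char_ind G P (f + h)) (char_ind G P (f + h)) ->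
  is_irr_char P f -> is_irr_char G (char_ind G P f).
Proof.
move=> sPG chf chh eq_norm irrf.
pose S (f1 f2 : {ffun gT -> K}) := \sum_(g in G | g \notin P) mackey P f1 f2 g.
have natS f1 f2 : is_char P f1 -> is_char P f2 -> exists m : nat, S f1 f2 = m%:R.
  by move=> ch1 ch2; apply: sum_nat => g; apply: (mackey_nat charK0 _ ch1 ch2).
have normE f1 : is_char P f1 -> cdot G (char_ind G P f1) (char_ind G P f1)
    = cdot P f1 f1 + (#|P| * #|P|)%:R^-1 * S f1 f1.
  move=> ch1; rewrite (cdot_ind charK0) // => [|x]; last exact: char_out.
  rewrite (bigID (mem P)) mulrDr; congr (_ + _) => /=.
  rewrite (eq_bigl (mem P)) => [|g].
    by rewrite sum_mackey // mulKf // natrM mulf_neq0 ?card_neq0.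
  by case Pg: (g \in P); rewrite ?andbF // (subsetP sPG).
have Sff : S f f = 0.
  have : S (f + h) (f + h) = 0.
    move/eqP: eq_norm; rewrite normE; last exact: is_charD.
    rewrite -subr_eq0 opprD addrA subrr sub0r oppr_eq0 mulf_eq0 invr_eq0 natrM.
    by rewrite mulf_eq0 !(negPf (card_neq0 charK0 _)) => /eqP.
  have -> : S (f + h) (f + h) = S f f + (S f h + (S h f + S h h)).
    rewrite /S -!big_split /=; apply: eq_bigr => g _.
    by rewrite !(mackeyDl, mackeyDr) -!addrA.
  have [[m1 ->] [m2 ->]] := (natS f f chf chf, natS f h chf chh).
  have [[m3 ->] [m4 ->]] := (natS h f chh chf, natS h h chh chh).
  rewrite -!natrD => /eqP; rewrite (natK_eq0 charK0) addn_eq0 => /andP[/eqP->].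
  by [].
apply: (cdot1_irr charK0); first exact: (is_char_ind charK0).
by rewrite normE // Sff mulr0 addr0 (irr_cdot1 charK0).
Qed.

(** The terms inside P already account for a norm of at least 1, and the term at g adds to it. *)
Lemma char_ind_reducible G P f g : P \subset G -> is_char P f -> g \in G -> g \notin P ->
  mackey P f f g != 0 -> ~ is_irr_char G (char_ind G P f).
Proof.
move=> sPG chf Gg nPg nz irr_ind.
have f_out x : x \notin P -> f x = 0 by apply: char_out.
have := irr_cdot1 charK0 irr_ind; rewrite (cdot_ind charK0) //.
move/(canRL (mulVKf _)); rewrite natrM mulf_neq0 ?card_neq0 // => /(_ isT).
rewrite (bigID (mem P)) /= (eq_bigl (mem P)) => [|x]; last first.
  by case Px: (x \in P); rewrite ?andbF // (subsetP sPG).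
rewrite sum_mackey // (bigD1 g) /=; last by rewrite Gg.
have [m1 E1] := cdot_nat charK0 (subxx P) (subxx P) chf chf.
have [m2 E2] := mackey_nat charK0 g chf chf.
have [m3 ->] : exists m : nat, \sum_(i | (i \in G) && (i \notin P) && (i != g)) mackey P f f i = m%:R.
  by apply: sum_nat => x; apply: (mackey_nat charK0 _ chf chf).
have m1_gt0 : (0 < m1)%N.
  rewrite lt0n -(natK_eq0 charK0) -E1; apply: contraNneq nz => z.
  by rewrite (cdot_self_eq0 charK0 chf z) /mackey big1 // => u _; rewrite ffunE mul0r.
rewrite E1 E2 -!natrM mulr1 -!natrD => /(natK_inj charK0).
move: nz; rewrite E2 (natK_eq0 charK0) => m2_neq0.
have := leq_pmulr (#|P| * #|P|) m1_gt0; move: (#|P| * #|P|)%N => M; lia.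
Qed.

End MoreCharacters.

(** * Refinement of colorings *)

Section Refinements.

Variables (F : fieldType) (N : nat) (gT : finGroupType) (X : gl_model F N gT).
Implicit Types (x y u g : gT) (b c d e : 'I_N -> nat) (i j k l : 'I_N) (s t : 'S_N).

(** Refinement as preorders: P_d is contained in P_c, while U_c is contained in U_d. *)
Definition refines d c := forall i j, (d i <= d j -> c i <= c j)%N.

Lemma refines_eq d c i j : refines d c -> d i = d j -> c i = c j.
Proof. by move=> dc dij; apply/eqP; rewrite eqn_leq !dc ?dij. Qed.

Lemma cP_refines d c : refines d c -> cP X d \subset cP X c.
Proof. by move=> dc; apply/subsetP=> x /cPP Px; apply/cPP=> i j /Px/dc. Qed.

Lemma cU_entry c x i j : x \in cU X c -> c i = c j -> X x i j = (i == j)%:R.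
Proof.
by move=> /cUP[Px lx] cij; rewrite -(gl1E X) -lx lpartE // cij eqxx.
Qed.

Lemma cU_refines d c : refines d c -> cU X c \subset cU X d.
Proof.
move=> dc; apply/subsetP=> x Ux; have Px := subsetP (cU_sub_cP X c) x Ux.
have Pdx : x \in cP X d.
  apply/cPP=> i j nz; have [-> // | nij] := eqVneq i j.
  have : c i != c j.
    by apply: contraNneq nz => /(cU_entry Ux)->; rewrite (negPf nij).
  have le_c := cPP _ _ _ Px _ _ nz; rewrite leqNgt; apply: contra => lt_d.
  by rewrite eqn_leq le_c dc // ltnW.
apply/cUP; split=> //; apply: (gl_eqP (X := X)) => i j; rewrite lpartE // gl1E.
case: (d i =P d j) => [dij | nij]; first by rewrite (cU_entry Ux (refines_eq dc dij)).
by case: (i =P j) => [ij | _]; rewrite ?mulr0n //; case: nij; rewrite ij.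
Qed.

Lemma lpart_refines d c x : refines d c -> x \in cP X d ->
  lpart X d (lpart X c x) = lpart X d x.
Proof.
move=> dc Pdx; have Pcx := subsetP (cP_refines dc) x Pdx.
rewrite /lpart; congr (gl_of X _); apply/matrixP=> i j; rewrite !mxE.
rewrite -/(lpart X c x) lpartE //; case: (d i =P d j) => [dij | _]; rewrite ?mulr0n //.
by rewrite (refines_eq dc dij) eqxx.
Qed.

(** The factor exceeds all values of b, so c is compared first. *)
Definition lex c b i := (c i * (\max_j b j).+1 + b i)%N.

Lemma lex_leq c b i j :
  (lex c b i <= lex c b j)%N = (c i < c j)%N || (c i == c j) && (b i <= b j)%N.
Proof.
rewrite /lex; have bi : (b i <= \max_j b j)%N by apply: leq_bigmax.
have bj : (b j <= \max_j b j)%N by apply: leq_bigmax.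
move: (\max_j b j) bi bj => M bi bj; case: ltngtP => [lt | lt | ->].
- by have := leq_mul lt (leqnn M.+1); lia.
- by have := leq_mul lt (leqnn M.+1); lia.
by rewrite leq_add2l.
Qed.

Lemma lex_refines c b : refines (lex c b) c.
Proof. by move=> i j; rewrite lex_leq => /orP[/ltnW | /andP[/eqP->]]. Qed.

Lemma lex_same_blocks c b : (forall i j, b i = b j -> c i = c j) ->
  same_blocks b (lex c b).
Proof.
move=> bc i j; rewrite [RHS]eqn_leq !lex_leq; apply/eqP/idP => [bij | ].
  by rewrite (bc i j bij) bij !eqxx !leqnn !orbT.
case/andP; case: ltngtP => //= _ le1 le2.
by apply/eqP; rewrite eqn_leq le1.
Qed.

Lemma lpart_mem_cP c d x : x \in cP X c -> x \in cP X d -> lpart X c x \in cP X d.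
Proof.
move=> Pcx /cPP Pdx; apply/cPP=> i j; rewrite lpartE //.
by case: (c i == c j); rewrite ?eqxx // mulr1n => /Pdx.
Qed.

Lemma lpart_trivial (R : Type) (f : gT -> R) c x :
    {in cP X c & cU X c, forall y u, f (y * u)%g = f y} -> x \in cP X c ->
  f (lpart X c x) = f x.
Proof.
move=> f_triv Px; have Pl := lpart_cP Px.
rewrite -[in RHS](mulKVg (lpart X c x) x) f_triv //.
apply/cUP; rewrite groupM ?groupV //; split=> //.
by rewrite lpartM ?groupV // lpartV // (lpart_id (lpart_L Px)) mulVg.
Qed.

Variables (K : closedFieldType) (charK0 : [pchar K] =i pred0).

(** The fibres of [lpart X c] on Q are cosets of U_c on which the summand is constant; the factor
    |U_c| cancels against the order of Q. *)
Lemma cdot_lpart c (Q : {group gT}) (f h : gT -> K) :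
    cU X c \subset Q -> Q \subset cP X c ->
    {in Q, forall x, f (lpart X c x) = f x} -> {in Q, forall x, h (lpart X c x) = h x} ->
  cdot Q f h = cdot (Q :&: cL X c)%G f h.
Proof.
move=> /subsetP sUQ /subsetP sQP fl hl; pose H := (Q :&: cL_group X c)%G.
have lQ x : x \in Q -> lpart X c x \in H.
  move=> Qx; rewrite inE [_ \in cL_group X c]lpart_L ?sQP // andbT.
  have : ((x * (lpart X c x)^-1)^-1 * x)%g \in Q by rewrite groupM // groupV sUQ // cU_div ?sQP.
  by rewrite invMg invgK mulgKV.
pose Z x := f x * h x^-1%g.
have Zl x : x \in Q -> Z (lpart X c x) = Z x.
  by move=> Qx; rewrite /Z fl // -lpartV ?sQP // hl ?groupV.
have sumE : \sum_(x in Q) Z x = #|cU X c|%:R * \sum_(y in H) Z y.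
  rewrite (partition_big (lpart X c) (mem H)) //= mulr_sumr; apply: eq_bigr => y.
  case/setIP=> Qy Ly; rewrite (eq_bigr (fun=> Z y)) => [|x /andP[Qx /eqP <-]]; last by rewrite Zl.
  rewrite mulr_natl -(card_rcoset _ y) -sumr_const; apply: eq_bigl => x.
  apply/andP/rcosetP=> [[Qx /eqP ly] | [u Uu ->]].
    by exists (x * y^-1)%g; rewrite ?mulgKV // -ly cU_div ?sQP.
  rewrite groupM ?(sUQ u) //; have [Pu lu] := cUP _ _ _ Uu.
  by split=> //; rewrite lpartM // ?lu ?mul1g ?lpart_id // sQP.
rewrite /cdot sumE mulrA; congr (_ * _).
have cardQ : #|Q|%:R = #|cU X c|%:R * #|H|%:R :> K.
  rewrite -natrM; congr _%:R; rewrite -!sum1_card.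
  rewrite (partition_big (lpart X c) (mem H)) //= mulnC sum1_card -sum_nat_const.
  apply: eq_bigr => y /setIP[Qy Ly]; rewrite sum1dep_card [RHS]sum1_card.
  rewrite -(card_rcoset (cU X c) y).
  apply: eq_card => x; rewrite !inE; apply/andP/rcosetP=> [[Qx /eqP ly] | [u Uu ->]].
    by exists (x * y^-1)%g; rewrite ?mulgKV // -ly cU_div ?sQP.
  rewrite groupM ?(sUQ u) //; have [Pu lu] := cUP _ _ _ Uu.
  by split=> //; rewrite lpartM // ?lu ?mul1g ?lpart_id // sQP.
by rewrite cardQ invfM mulrAC mulVf ?mul1r // (card_neq0 charK0 (cU_group X c)).
Qed.

End Refinements.

(** * Factors of a Levi subgroup supported on unions of blocks *)

Section BlockSupport.

Variables (F : fieldType) (N : nat) (gT : finGroupType) (X : gl_model F N gT).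
Implicit Types (x y u g : gT) (b c d e : 'I_N -> nat) (i j k l : 'I_N) (s t : 'S_N).
Implicit Type D : pred 'I_N.

Definition saturated e D := forall k l, e k = e l -> D k = D l.

(** The factor of L_e that acts on the indices in D only. If D is a union of e-blocks, L_e is the
    direct product of this factor and the one for the complement. *)
Definition cS e D : {set gT} :=
  [set x in cL X e | [forall k, forall l, ~~ D k ==> (X x k l == (k == l)%:R)]].

Lemma cSP e D x :
  reflect (x \in cL X e /\ forall k l, ~~ D k -> X x k l = (k == l)%:R) (x \in cS e D).
Proof.
rewrite [x \in cS e D]inE; apply: (iffP andP) => -[Lx h]; split=> //.
  by move=> k l nDk; have /forallP/(_ l)/implyP/(_ nDk)/eqP := forallP h k.
by apply/forallP=> k; apply/forallP=> l; apply/implyP=> /h->.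
Qed.

Fact cS_group_set e D : group_set (cS e D).
Proof.
apply/group_setP; split=> [|x y /cSP[Lx hx] /cSP[Ly hy]].
  by apply/cSP; rewrite group1; split=> // k l _; rewrite gl1E.
apply/cSP; rewrite groupM //; split=> // k l nDk.
rewrite glME (bigD1 k) //= hx // eqxx mul1r hy // big1 ?addr0 // => m nmk.
by rewrite hx // eq_sym (negPf nmk) mul0r.
Qed.
Canonical cS_group e D := Group (cS_group_set e D).

Lemma cS_commute e e' D x y : x \in cS e D -> y \in cS e' (predC D) ->
  saturated e D -> saturated e' D -> commute x y.
Proof.
move=> /cSP[/cLP Lx hx] /cSP[/cLP Ly hy] satD satD'; apply: (gl_eqP (X := X)) => k l.
rewrite !glME; case Dk: (D k).
  rewrite (bigD1 l) //= big1 ?addr0 => [|m nml]; last first.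
    have [-> | nz] := eqVneq (X x k m) 0; first by rewrite mul0r.
    by rewrite hy /= ?negbK -?(satD _ _ (Lx _ _ nz)) ?Dk // (negPf nml) mulr0.
  rewrite (bigD1 k) //= big1 ?addr0 => [|m nmk]; last first.
    by rewrite hy /= ?negbK ?Dk // eq_sym (negPf nmk) mul0r.
  rewrite (hy k) /= ?negbK ?Dk // eqxx mul1r.
  have [-> | nz] := eqVneq (X x k l) 0; first by rewrite mul0r.
  by rewrite hy /= ?negbK -?(satD _ _ (Lx _ _ nz)) ?Dk // eqxx mulr1.
rewrite (bigD1 k) //= big1 ?addr0 => [|m nmk]; last first.
  by rewrite hx ?Dk // eq_sym (negPf nmk) mul0r.
rewrite hx ?Dk // eqxx mul1r (bigD1 l) //= big1 ?addr0 => [|m nml]; last first.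
  have [-> | nz] := eqVneq (X y k m) 0; first by rewrite mul0r.
  by rewrite hx -?(satD' _ _ (Ly _ _ nz)) ?Dk // (negPf nml) mulr0.
have [-> | nz] := eqVneq (X y k l) 0; first by rewrite mul0r.
by rewrite hx -?(satD' _ _ (Ly _ _ nz)) ?Dk // eqxx mulr1.
Qed.

Definition restr D x : gT := gl_of X (\matrix_(k, l) if D k then X x k l else (k == l)%:R).

Lemma restrE e D x k l : saturated e D -> x \in cL X e ->
  X (restr D x) k l = if D k then X x k l else (k == l)%:R.
Proof.
move=> satD Lx; rewrite gl_ofK ?mxE //.
pose M y : 'M[F]_N := \matrix_(k, l) if D k then X y k l else (k == l)%:R.
suffices : M x *m M x^-1%g = 1%:M by case/mulmx1_unit.
apply/matrixP=> i j; rewrite !mxE; case Di: (D i); last first.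
  rewrite (bigD1 i) //= !mxE Di eqxx mul1r big1 ?addr0 // => m nmi.
  by rewrite mxE Di eq_sym (negPf nmi) mul0r.
rewrite -(gl1E X) -(mulgV x) glME; apply: eq_bigr => m _; rewrite !mxE Di.
have [-> | nz] := eqVneq (X x i m) 0; first by rewrite !mul0r.
by rewrite -(satD _ _ (cLP _ _ _ Lx _ _ nz)) Di.
Qed.

(** The coloring may change from e to b as long as e is at least as fine as b on D; off D the
    restriction is trivial. *)
Lemma restr_cS e b D x : saturated e D -> x \in cL X e ->
  (forall k l, D k -> e k = e l -> b k = b l) -> restr D x \in cS b D.
Proof.
move=> satD Lx eb; apply/cSP; split=> [|k l nDk].
  apply/cLP=> k l; rewrite (restrE _ _ satD Lx); case Dk: (D k).
    by move/(cLP _ _ _ Lx); apply: eb.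
  by case: (k =P l) => [-> | _]; rewrite ?eqxx.
by rewrite (restrE _ _ satD Lx) (negPf nDk).
Qed.

Lemma restr_mul e D x : saturated e D -> x \in cL X e ->
  x = (restr (predC D) x * restr D x)%g.
Proof.
move=> satD Lx; have satC : saturated e (predC D) by move=> k l /satD /= ->.
apply: (gl_eqP (X := X)) => k l; rewrite glME.
have Er m : X (restr (predC D) x) k m = if D k then (k == m)%:R else X x k m.
  by rewrite (restrE _ _ satC Lx) /=; case: (D k).
case Dk: (D k) Er => Er.
  rewrite (bigD1 k) //= Er eqxx mul1r (restrE _ _ satD Lx) Dk big1 ?addr0 // => m nmk.
  by rewrite Er eq_sym (negPf nmk) mul0r.
rewrite (bigD1 l) //= [X in _ + X]big1 ?addr0 => [|m nml].
  rewrite Er (restrE _ _ satD Lx); have [-> | nz] := eqVneq (X x k l) 0; first by rewrite mul0r.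
  by rewrite -(satD _ _ (cLP _ _ _ Lx _ _ nz)) Dk eqxx mulr1.
rewrite Er (restrE _ _ satD Lx); have [-> | nz] := eqVneq (X x k m) 0; first by rewrite mul0r.
by rewrite -(satD _ _ (cLP _ _ _ Lx _ _ nz)) Dk (negPf nml) mulr0.
Qed.

Lemma cS_fixed e D t x : saturated e D -> x \in cS e (predC D) ->
  (forall k, D (t k) = D k) -> (forall k, ~~ D k -> t k = k) ->
  (x ^ gl_perm X t = x)%g.
Proof.
move=> satD /cSP[/cLP Lx hx] Dt tfix; apply: (gl_eqP (X := X)) => k' l'.
rewrite -[k'](permKV t) -[l'](permKV t) gl_conj_perm.
move: (t^-1%g k') (t^-1%g l') => k l {k' l'}.
case Dk: (D k).
  by rewrite !hx /= ?negbK ?Dt ?Dk // (inj_eq perm_inj).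
rewrite (tfix k) ?Dk //; case Dl: (D l); last by rewrite tfix ?Dl.
have zero m : D m -> X x k m = 0.
  by move=> Dm; apply/eqP; apply: contraTT Dm => /Lx/satD <-; rewrite Dk.
by rewrite !zero ?Dt.
Qed.

End BlockSupport.

(** * Primitivity of the constituents of a series *)

Section Series.

Variables (K : closedFieldType) (charK0 : [pchar K] =i pred0).
Variables (F : fieldType) (N : nat) (gT : finGroupType) (X : gl_model F N gT).
Local Notation G := [set: gT]%G.
Implicit Types (x y u g : gT) (b c d e : 'I_N -> nat) (i j k l : 'I_N) (s t : 'S_N).

Variables (b0 : 'I_N -> nat) (psi : {ffun gT -> K}).
Hypotheses (psi_irr : is_irr_char (cL_group X b0) psi) (psi_cusp : cuspidal_on X b0 psi).

Lemma HC_series_induced c chi :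
    (forall i j, b0 i = b0 j -> c i = c j) ->
    (forall s, s \in stab_psi X b0 psi -> forall i, c (s i) = c i) ->
    irr_constituent G (HCind X b0 psi) chi ->
  exists2 theta, is_char (cL_group X c) theta & chi = HCind X c theta.
Proof.
move=> bc Wc const; have irr_chi := const.1; have ch_chi := irr_is_char irr_chi.
have nz := irr_constituent_cdot charK0 const.
(* d has the blocks of b0, and P_d is contained in P_c; by independence of the parabolic subgroup,
   R_{L_0}^G(psi) may be induced through P_c. *)
pose d := lex c b0; have dc : refines d c := @lex_refines _ c b0.
have bd : same_blocks b0 d := lex_same_blocks bc.
have ch_psi : is_char (cL_group X d) psi by rewrite -(same_cL X bd); apply: irr_is_char.
set P := cP_group X c; pose B := cP_group X d.
have sBP : B \subset P := cP_refines X dc.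
pose Y := char_ind P B (infl X d psi).
have ch_inf := infl_char ch_psi.
have chY : is_char P Y by apply: (is_char_ind charK0).
have inf_out x : x \notin B -> infl X d psi x = 0 by apply: infl_out.
have defR : HCind X b0 psi = char_ind G P Y.
  rewrite (HCind_same_blocks charK0 psi_irr psi_cusp (fun _ _ => erefl) bd).
  by rewrite (char_ind_trans charK0) ?subsetT.
(* Nonzero terms of Mackey's sum come from the double cosets of elements of the stabiliser. These
   preserve c, so the double cosets lie in P_c. *)
have normY : cdot P Y Y = cdot G (char_ind G P Y) (char_ind G P Y).
  rewrite (char_ind_trans charK0) ?subsetT // !(cdot_ind charK0) ?subsetT //; congr (_ * _).
  rewrite [RHS](bigID (mem P)) /= [X in _ + X]big1 ?addr0 => [|g /andP[_ nPg]].
    by apply: eq_bigl => g; rewrite in_setT.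
  apply/eqP; apply: contraNT nPg => /(mackey_cuspidal charK0 psi_irr psi_cusp bd bd).
  move=> [p [s [q [/(subsetP sBP) Pp /(subsetP sBP) Pq -> Ws]]]].
  rewrite !groupM //; apply/cPP=> i j; rewrite gl_permE.
  by case: (s i =P j) => [<- | _]; rewrite ?Wc ?eqxx.
have nzY : cdot P Y chi != 0.
  by rewrite -(Frobenius charK0 (subsetT P) ch_chi) -?defR // => x; apply: char_out.
have [y [[irr_y [Y' chY' DY]] nzy]] := char_subconstituent charK0 chY nzY.
have ch_y := irr_is_char irr_y.
have irr_Iy : is_irr_char G (char_ind G P y).
  by apply: (char_ind_irr charK0 (subsetT P) ch_y chY'); rewrite -?DY.
have Dchi : char_ind G P y = chi.
  apply: (irr_cdot_eq charK0 irr_Iy irr_chi).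
  by rewrite (Frobenius charK0 (subsetT P) ch_chi) // => x; apply: char_out.
(* U_c lies in U_d and acts trivially on the inflation of psi, hence fixes vectors of y; being
   normal in P_c, it lies in the kernel of the irreducible y. *)
have y_triv : {in P & cU X c, forall x u, y (x * u)%g = y x}.
  apply: (irr_norm_trivial (N := cU_group X c) irr_y (cU_sub_cP X c) (cU_norm X c)).
  apply: (@sum_fixed_neq0 K gT (cU_group X c) y (infl X d psi)) => [u Uu|].
    have Udu := subsetP (cU_refines X dc) u Uu; by rewrite !infl_U ?group1.
  have sUB : cU_group X c \subset B.
    exact: subset_trans (cU_refines X dc) (cU_sub_cP X d).
  rewrite cdotC; apply: (cdot_sub_neq0 charK0 sUB (subxx B) sBP ch_inf ch_y).
  rewrite -(Frobenius charK0 sBP ch_y) // -/Y DY.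
  by apply: (irr_constituent_cdot charK0); split=> //; exists Y'.
exists (char_res (cL X c) y).
  by apply: (@is_char_res K gT (cL_group X c) P); rewrite ?cL_sub_cP.
rewrite -Dchi /HCind; congr (char_ind _ _ _); apply/ffunP=> x.
have [Px | nPx] := boolP (x \in P); last by rewrite (char_out ch_y) // infl_out.
rewrite inflE // char_resE ?lpart_L //.
by rewrite lpart_trivial.
Qed.

Definition block_swap i j t := [/\ t \in stab_psi X b0 psi,
  forall k, b0 k = b0 i -> b0 (t k) = b0 j, forall k, b0 k = b0 j -> b0 (t k) = b0 i,
  forall k, b0 k <> b0 i -> b0 k <> b0 j -> t k = k & involutive t].

(* The coloring e refines c by splitting off a block i with maximal b0 in its color and a
   block j with minimal b0 in its color.  A constituent omega of the restriction of theta
   to cP e which lies above psi is trivial on cU e and, the blocks i and j being separated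
   in e, is determined on them by psi; hence it is fixed by the swap t. *)
Lemma HC_series_swap c theta :
    (forall i j, b0 i <> b0 j -> exists t, block_swap i j t) ->
    (exists i j, c i <> c j) -> is_char (cL_group X c) theta ->
    cdot (cP X b0 :&: cP X c) (infl X b0 psi) (infl X c theta) != 0 ->
  exists t, gl_perm X t \notin cP X c /\
    mackey (cP_group X c) (infl X c theta) (infl X c theta) (gl_perm X t) != 0.
Proof.
move=> swaps [i1 [j1 cij1]] ch_th nz.
have ch_psi := irr_is_char psi_irr.
have bc := cuspidal_constant charK0 ch_psi ch_th psi_cusp nz.
have [i0 [j0 lt0]] : exists i0 j0, (c i0 < c j0)%N.
  by case: (ltngtP (c i1) (c j1)) => // lt; [exists i1, j1 | exists j1, i1].
have [i /eqP ci imax] := arg_maxnP (P := fun k => c k == c i0) b0 (eqxx _).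
have [j /eqP cj jmin] := arg_minnP (P := fun k => c k == c j0) b0 (eqxx _).
rewrite -ci -cj in lt0 imax jmin.
have {}imax k : c k = c i -> (b0 k <= b0 i)%N by move/eqP/imax.
have {}jmin k : c k = c j -> (b0 j <= b0 k)%N by move/eqP/jmin.
have bij : b0 i <> b0 j by move/bc=> eq_c; rewrite eq_c ltnn in lt0.
have [t [Wt ti tj tfix tK]] := swaps i j bij; exists t.
have [eqt Jt] := stab_psiP _ _ _ _ Wt.
have tb k l : b0 k = b0 l -> b0 (t k) = b0 (t l).
  by move=> /eqP; rewrite eqt => /eqP.
split.
  (* The nonzero entry (j, t j) leads from the color c j to the smaller color c i. *)
  apply/negP=> /cPP/(_ j (t j)); rewrite gl_permE eqxx oner_eq0 => /(_ isT).
  by rewrite (bc (t j) i (tj j erefl)) leqNgt lt0.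
pose D k := (b0 k == b0 i) || (b0 k == b0 j).
(* Doubling makes room between colors: block i is raised above the rest of its color, and in the
   color of j everything but block j is raised. *)
pose e k := ((c k).*2 + ((b0 k == b0 i) || ((c k == c j) && (b0 k != b0 j))))%N.
have cbi k : b0 k = b0 i -> c k = c i by apply: bc.
have cbj k : b0 k = b0 j -> c k = c j by apply: bc.
have ec : refines e c.
  by move=> k l; rewrite /e; case: (_ || _); case: (_ || _); lia.
have e_lt k l : (c k < c l)%N -> (e k <= e l)%N.
  by rewrite /e; case: (_ || _); case: (_ || _); lia.
have dc : refines (lex c b0) c := @lex_refines _ c b0; set d := lex c b0 in dc.
(* The extremality of i and j is used here: block i must come last and block j first in its
   color. *)
have de : refines d e.
  move=> k l; rewrite lex_leq => /orP[/e_lt // | /andP[/eqP ckl bkl]].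
  rewrite /e ckl leq_add2l; case: eqP => [bki | _] /=.
    have cl : c l = c i by rewrite -ckl cbi.
    have bl : b0 l = b0 i by apply/eqP; rewrite eqn_leq imax // -bki.
    by rewrite bl eqxx.
  case: (c l =P c j) => //= cl; case: eqP => //= nbkj; case: eqP => //= _.
  case: eqP => // blj; case: nbkj; apply/eqP.
  by rewrite eqn_leq jmin ?ckl // -blj bkl.
have eb k l : b0 k = b0 l -> e k = e l by move=> bkl; rewrite /e bkl (bc k l bkl).
have eD k l : D k -> e k = e l -> b0 k = b0 l.
  move=> Dk ekl; have ckl := refines_eq ec ekl; move: ekl; rewrite /e ckl.
  move/addnI; case/orP: Dk => /eqP Dk.
    rewrite Dk eqxx /=; case: (b0 l =P b0 i) => [-> // | _].
    by move: lt0; rewrite -(cbi k Dk) ckl; case: eqP => // ->; rewrite ltnn.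
  rewrite Dk eqxx andbF orbF -ckl (cbj k Dk) eqxx /=.
  case: eqP => [/esym // | _]; case: (b0 l =P b0 i) => //= _.
  by case: (b0 l =P b0 j).
have satb : saturated b0 D by move=> k l bkl; rewrite /D bkl.
have sate : saturated e D.
  move=> k l ekl; apply/idP/idP => [Dk | Dl].
    by rewrite -(satb k l) // (eD k l).
  by rewrite (satb k l) // (eD l k).
have Dt k : D (t k) = D k.
  case Dk: (D k).
    by case/orP: Dk => /eqP Dk; rewrite /D ?(ti _ Dk) ?(tj _ Dk) eqxx ?orbT.
  move/negbT: (Dk); rewrite negb_or => /andP[/eqP n1 /eqP n2].
  by rewrite tfix ?Dk.
have tD k : ~~ D k -> t k = k.
  by rewrite negb_or => /andP[/eqP n1 /eqP n2]; apply: tfix.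
(* Within the color of i, an entry leading out of block i is moved by t to a row of the larger color
   c j, which P_c forbids. Entries leading into block j within its color are excluded likewise. *)
have Pce x : x \in cP X c -> x \in cP X (c \o t) -> x \in cP X e.
  move=> /cPP Px /cPP Pxt; apply/cPP=> k l nz_kl.
  have := Px k l nz_kl; rewrite leq_eqVlt => /orP[/eqP ckl | /e_lt //].
  have := Pxt k l nz_kl; rewrite /e ckl leq_add2l /=.
  case: (b0 k =P b0 i) => [bki | nbki] /=.
    rewrite (cbj _ (ti k bki)); have cl : c l = c i by rewrite -ckl cbi.
    case: (b0 l =P b0 i) => // nbli; case: (b0 l =P b0 j) => [blj | nblj].
      by move: lt0; rewrite -cl (cbj l blj) ltnn.
    by rewrite tfix // cl leqNgt lt0.
  case: (c l =P c j) => //= cl; case: (b0 k =P b0 j) => //= nbkj.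
  rewrite tfix // ckl cl; case: (b0 l =P b0 j) => [blj | _]; last by rewrite orbT.
  by rewrite (cbi _ (tj l blj)) leqNgt lt0.
have eqet : same_blocks e (e \o t).
  have impl k l : e k = e l -> e (t k) = e (t l).
    move=> ekl; case Dk: (D k); first by apply/eb/tb/eD.
    by rewrite !tD // -?(sate _ _ ekl) Dk.
  by move=> k l; apply/eqP/eqP => [/impl // | /= /impl]; rewrite !tK.
clear cbi cbj e_lt lt0 imax jmin swaps.
have bd : same_blocks b0 d := lex_same_blocks bc.
have ch_d : is_char (cL_group X d) psi by rewrite -(same_cL X bd).
set f := infl X c theta in nz *; have chf : is_char (cP_group X c) f := infl_char ch_th.
(* P_d and P_{b0} have the same intersection with L_c, and both functions are invariant under U_c,
   so the inner product over P_d can be computed on that intersection. *)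
have nzd : cdot (cP X d) (infl X d psi) f != 0.
  rewrite (@cdot_lpart F N gT X K charK0 c (cP_group X d)).
  - rewrite (@eq_cdotG _ _ _ _ (infl X b0 psi) _ f) // => [|x].
      apply: (cdot_sub_neq0 charK0 _ _ _ (infl_char ch_psi) chf nz).
      + rewrite subsetI; apply/andP; split; last first.
          exact: subset_trans (subsetIr _ _) (cL_sub_cP X c).
        apply/subsetP=> x /setIP[/cPP Px /cLP Lx]; apply/cPP=> k l nz_kl.
        have := Px k l nz_kl; rewrite lex_leq (Lx k l nz_kl) ltnn /=.
        by case/andP.
      + exact: (@subsetIl _ (cP X b0)).
      exact: (@subsetIr _ (cP X b0)).
    move=> /setIP[/= Pdx Lx]; rewrite inflE // ffunE.
    suffices -> : x \in cP X b0 by rewrite (same_lpart X _ bd).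
    apply/cPP=> k l nz_kl; have := cPP _ _ _ Pdx k l nz_kl.
    by rewrite lex_leq (cLP _ _ _ Lx k l nz_kl) ltnn => /andP[].
  - exact: subset_trans (cU_refines X dc) (cU_sub_cP X d).
  - exact: cP_refines dc.
  - move=> x Pdx; have Pcx := subsetP (cP_refines X dc) x Pdx.
    by rewrite !inflE ?lpart_mem_cP // lpart_refines.
  move=> x /(subsetP (cP_refines X dc)) Pcx.
  by rewrite /f !inflE ?lpart_mem_cP // (lpart_id (lpart_L Pcx)).
pose fe := char_res (cP X e) f; have sPe := cP_refines X ec.
have ch_fe : is_char (cP_group X e) fe := is_char_res sPe chf.
have sPde := cP_refines X de.
have nze : cdot (cP X d) fe (infl X d psi) != 0.
  rewrite (@cdotC _ _ (cP_group X d)) (@eq_cdotG _ _ _ _ (infl X d psi) _ f) // => x Pdx.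
  by rewrite char_resE // (subsetP sPde).
have [omega [[irr_om [xi ch_xi Dfe]] nz_om]] := char_subconstituent charK0 ch_fe nze.
have ch_om := irr_is_char irr_om.
have om_triv : {in cP X e & cU X e, forall x u, omega (x * u)%g = omega x}.
  apply: (irr_norm_trivial (N := cU_group X e) irr_om (cU_sub_cP X e) (cU_norm X e)).
  apply: (@sum_fixed_neq0 K gT (cU_group X e) omega (infl X d psi)) => [u Uu|].
    have Udu := subsetP (cU_refines X de) u Uu; by rewrite !infl_U ?group1.
  have sUd : cU_group X e \subset cP_group X d.
    exact: subset_trans (cU_refines X de) (cU_sub_cP X d).
  exact: (cdot_sub_neq0 charK0 sUd sPde (subxx _) ch_om (infl_char ch_d)).
have om_l x : x \in cP X e -> omega (lpart X e x) = omega x.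
  exact: lpart_trivial.
pose omL := char_res (cL X e) omega.
have irr_omL : is_irr_char (cL_group X e) omL.
  apply: (cdot1_irr charK0); first exact: is_char_res (cL_sub_cP X e) ch_om.
  rewrite -(irr_cdot1 charK0 irr_om) /=.
  rewrite (@cdot_lpart F N gT X K charK0 e (cP_group X e)) ?cU_sub_cP //.
  rewrite [X in cdot X omega omega](_ : _ = cL X e); last exact/setIidPr/cL_sub_cP.
  by apply: (@eq_cdotG _ _ (cL_group X e)) => x Lx; rewrite char_resE.
(* T is the common factor of L_0 and L_e on the blocks i and j; [Hb] and [He] are its complements in
   the two groups. *)
pose T := cS_group X b0 D; pose He := cS_group X e (predC D).
pose Hb := cS_group X b0 (predC D).
have sTb : T \subset cL_group X b0 by apply/subsetP=> x /cSP[].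
have eqLd : cL X b0 = cL X d := congr1 val (same_cL X bd).
have sTd : T \subset cL X d by rewrite -eqLd.
have sTPd : T \subset cP_group X d := subset_trans sTd (cL_sub_cP X d).
have sTe : T \subset cL_group X e.
  by apply/subsetP=> x /cSP[/cLP Lx _]; apply/cLP=> k l /Lx/eb.
have nzT : cdot T (char_res T psi) omega != 0.
  have := cdot_sub_neq0 charK0 sTPd sPde (subxx _) ch_om (infl_char ch_d) nz_om.
  rewrite cdotC (@eq_cdotG _ _ _ _ (char_res T psi) _ omega) // => x Tx.
  by rewrite infl_L ?char_resE // (subsetP sTd).
have ch_T := is_char_res sTb ch_psi.
(* tau links psi and omega: on T both are proportional to it. Since t fixes psi, it fixes tau on T,
   and therefore omega on L_e. *)
have [tau [const_tau nz_tau]] := char_subconstituent charK0 ch_T nzT.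
have irr_tau := const_tau.1.
have nz_psi : cdot T psi tau != 0.
  have := irr_constituent_cdot charK0 const_tau.
  by rewrite (@eq_cdotG _ _ _ _ psi _ tau) // => x Tx; rewrite char_resE.
have cHT (H : {group gT}) a : H = cS_group X a (predC D) -> saturated a D -> T \subset 'C(H)%g.
  move=> -> sata; apply/centsP=> x Tx y Hy; exact: cS_commute Tx Hy satb sata.
have psiT (s : gT) : s \in T -> psi s * tau 1%g = psi 1%g * tau s.
  move=> Ts; rewrite -[in LHS](mul1g s); apply: (irr_mul_central charK0 psi_irr irr_tau
     (H := Hb)) => //; rewrite ?group1 //.
  - by apply/subsetP=> x /cSP[].
  - exact: cHT.
  apply/subsetP=> x Lx; have satC : saturated b0 (predC D) by move=> k l /satb /= ->.
  by rewrite [x](restr_mul satb Lx) mem_mulg // (restr_cS (e := b0)).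
have omT (h s : gT) : h \in He -> s \in T -> omega (h * s)%g * tau 1%g = omega h * tau s.
  move=> Hh Ts; have sHe : He \subset cL_group X e by apply/subsetP=> x /cSP[].
  have Lh := subsetP sHe h Hh; have Ls := subsetP sTe s Ts.
  have genL : cL_group X e \subset (He * T)%g.
    apply/subsetP=> x Lx; have satC : saturated e (predC D) by move=> k l /sate /= ->.
    by rewrite [x](restr_mul sate Lx) mem_mulg // (restr_cS sate Lx, restr_cS satC Lx).
  have nz_omL : cdot T omL tau != 0.
    rewrite cdotC (@eq_cdotG _ _ _ _ tau _ omega) // => x Tx.
    by rewrite char_resE // (subsetP sTe).
  have := irr_mul_central charK0 irr_omL irr_tau sHe sTe (cHT _ _ erefl sate) genL nz_omL Hh Ts.
  by rewrite /omL !char_resE ?groupM.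
have tau1 := irr_char1_neq0 charK0 irr_tau.
have psi1 := irr_char1_neq0 charK0 psi_irr.
have om_t x : x \in cL X e -> omega (x ^ gl_perm X t)%g = omega x.
  move=> Lx; have satC : saturated e (predC D) by move=> k l /sate /= ->.
  rewrite [x](restr_mul sate Lx) conjMg.
  have Hh : restr X (predC D) x \in He by apply: (restr_cS satC Lx).
  have Ts : restr X D x \in T by apply: (restr_cS sate Lx).
  move: (restr X (predC D) x) (restr X D x) Hh Ts => h s Hh Ts.
  rewrite (cS_fixed sate Hh Dt tD).
  have Tst : (s ^ gl_perm X t)%g \in T.
    case/cSP: Ts => Ls hs; apply/cSP; split=> [|k l nDk].
      by rewrite mem_cL_perm -(eq_cL X eqt).
    rewrite -[k]tK -[l]tK gl_conj_perm hs ?Dt //.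
    by rewrite !tK (inj_eq perm_inj).
  apply: (mulIf tau1); rewrite !omT //; congr (_ * _).
  apply: (mulfI psi1); rewrite -!psiT //; congr (_ * _).
  by move/ffunP/(_ s): Jt; rewrite ffunE.
rewrite mackey_perm // -infl_perm -/f mulf_neq0 //.
  exact: (card_neq0 charK0 (cP_group X c :&: cP_group X (c \o t))%G).
pose Q := (cP_group X c :&: cP_group X (c \o t))%G.
have sQe : Q \subset cP_group X e by apply/subsetP=> x /setIP[Px Pxt]; apply: Pce.
have Qt x : x \in Q -> (x ^ gl_perm X t)%g \in Q.
  case/setIP=> Px Pxt; apply/setIP; split; rewrite [_ \in _]mem_cP_perm //.
  by rewrite (@eq_cP _ _ _ _ _ c) // => k l; rewrite /= !tK.
pose xit := conjfun (gl_perm X t) xi.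
have ch_xit : is_char (cP_group X e :^ (gl_perm X t)^-1)%G xit := is_char_conj _ ch_xi.
have sQet : Q \subset (cP_group X e :^ (gl_perm X t)^-1)%G.
  by apply/subsetP=> x /Qt/(subsetP sQe); rewrite mem_conjgV.
have feE x : x \in cP X e -> f x = omega x + xi x.
  by move=> Px; move/ffunP/(_ x): Dfe; rewrite char_resE // [RHS]ffunE.
(* On Q the inflation is omega + xi and its conjugate omega + xi^t. Of the four inner products, all
   natural numbers, that of omega with itself is nonzero. *)
rewrite (@eq_cdotG _ _ Q _ (omega + xi) _ (omega + xit)) => [||x Qx].
- rewrite !(cdotDl, cdotDr).
  have nzQ : cdot Q omega omega != 0.
    apply: (cdot_sub_neq0 charK0 sQe (subxx _) (subxx _) ch_om ch_om).
    by rewrite (irr_cdot1 charK0 irr_om) oner_eq0.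
  have [m1 E1] := cdot_nat charK0 sQe sQe ch_om ch_om.
  have [m2 ->] := cdot_nat charK0 sQe sQe ch_xi ch_om.
  have [m3 ->] := cdot_nat charK0 sQe sQet ch_om ch_xit.
  have [m4 ->] := cdot_nat charK0 sQe sQet ch_xi ch_xit.
  move: nzQ; rewrite E1 -!natrD !(natK_eq0 charK0) !addn_eq0 !negb_and.
  by move=> ->.
- by move=> x Qx; rewrite feE ?ffunE // (subsetP sQe).
rewrite [LHS]ffunE [RHS]ffunE [xit x]ffunE feE ?(subsetP sQe) ?Qt //; congr (_ + _).
have Pex := subsetP sQe x Qx; rewrite -om_l ?(subsetP sQe) ?Qt //.
rewrite lpart_perm; last first.
  have := subsetP sQe _ (Qt _ Qx); by rewrite mem_cP_perm.
by rewrite -(same_lpart X x eqet) om_t ?lpart_L // om_l.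
Qed.

(** A common constituent makes a term of Mackey's sum nonzero at some permutation s. Conjugating c
    and theta by s does not change the induced character and reduces to the situation of
    [HC_series_swap]. *)
Lemma HC_series_primitive c theta chi :
    (forall i j, b0 i <> b0 j -> exists t, block_swap i j t) ->
    (exists i j, c i <> c j) -> is_char (cL_group X c) theta ->
    irr_constituent G (HCind X b0 psi) chi -> chi <> HCind X c theta.
Proof.
move=> swaps [i [j cij]] ch_th const Dchi; have ch_psi := irr_is_char psi_irr.
have := irr_constituent_cdot charK0 const; rewrite {1}Dchi.
rewrite (cdot_ind charK0) => [|| x]; [|exact: subsetT|exact: infl_out].
rewrite mulf_eq0 negb_or => /andP[_ nzs].
have [g nzg] : exists g, mackey (cP X b0) (infl X b0 psi) (infl X c theta) g != 0.
  by apply/existsP; apply: contraNT nzs => /existsPn z; rewrite big1 // => g _; apply/eqP/negPn/z.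
have [p [s [q [_ _ _ nz]]]] := mackey_neq0 charK0 ch_psi ch_th nzg.
have ch_ths := is_char_perm s ch_th.
have cs_nc : exists i j, (c \o s) i <> (c \o s) j.
  by exists (s^-1%g i), (s^-1%g j); rewrite /= !permKV.
have [t [nPt nzt]] := HC_series_swap swaps cs_nc ch_ths nz.
apply: (char_ind_reducible charK0 (subsetT _) (infl_char ch_ths) (in_setT _) nPt nzt).
by rewrite -/(HCind X _ _) HCind_perm -Dchi; case: const.
Qed.

End Series.

(** * Tensor products of cuspidal characters of the diagonal blocks *)

Section TensorLevi.

Variables (K : closedFieldType) (charK0 : [pchar K] =i pred0).
Variables (F : fieldType) (N r : nat) (gT : finGroupType) (X : gl_model F N gT).
(* emb i enumerates the indices of color i and off i is its inverse. *)
Variables (m : 'I_r -> nat) (hT : 'I_r -> finGroupType).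
Variable Y : forall i, gl_model F (m i) (hT i).
Variables (blk : 'I_N -> 'I_r) (emb : forall i, 'I_(m i) -> 'I_N).
Variable off : forall i, 'I_N -> 'I_(m i).
Hypothesis blk_emb : forall i a, blk (@emb i a) = i.
Hypothesis emb_off : forall i k, blk k = i -> emb (off i k) = k.
Hypothesis off_emb : forall i a, off i (emb a) = a.
Variable psi : forall i, {ffun hT i -> K}.
Hypothesis psi_irr : forall i, is_irr_char [set: hT i]%G (psi i).

Definition bcol k : nat := blk k.
Local Notation L := (cL_group X bcol).

Definition dmx i x : 'M[F]_(m i) := \matrix_(a, b) X x (emb a) (emb b).
Definition dblock i x : hT i := gl_of (Y i) (dmx i x).

Lemma sum_block (V : nmodType) i (f : 'I_N -> V) :
  \sum_(k | blk k == i) f k = \sum_a f (@emb i a).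
Proof.
rewrite (reindex (@emb i)) /=; first by apply: eq_bigl => a; rewrite blk_emb eqxx.
exists (off i) => [a _ | k /eqP bk]; [exact: off_emb | exact: emb_off].
Qed.

Lemma L_blk x k l : x \in L -> X x k l != 0 -> blk k = blk l.
Proof. by move=> /cLP Lx /Lx /val_inj. Qed.

Lemma dmx_mul x y i : x \in L ->
  dmx i (x * y)%g = dmx i x *m dmx i y.
Proof.
move=> Lx; apply/matrixP=> a b; rewrite !mxE glME.
rewrite (bigID (fun k => blk k == i)) /= [X in _ + X]big1 ?addr0 => [|k nk].
  by rewrite sum_block; apply: eq_bigr => c _; rewrite !mxE.
have [-> | nz] := eqVneq (X x (@emb i a) k) 0; first by rewrite mul0r.
by rewrite -(L_blk Lx nz) blk_emb eqxx in nk.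
Qed.

Lemma dblockE x i a b : x \in L -> Y i (dblock i x) a b = X x (@emb i a) (@emb i b).
Proof.
move=> Lx; rewrite gl_ofK ?mxE //.
have : dmx i x *m dmx i x^-1%g = 1%:M.
  rewrite -dmx_mul // mulgV; apply/matrixP=> a' b'.
  by rewrite !mxE gl1E (can_eq (@off_emb i)).
by case/mulmx1_unit.
Qed.

Lemma dblockM i : {in L &, {morph dblock i : x y / (x * y)%g}}.
Proof.
move=> x y Lx Ly; apply: (gl_eqP (X := Y i)) => a b; rewrite dblockE ?groupM //.
have /matrixP/(_ a b) := dmx_mul y i Lx; rewrite !mxE => ->.
by rewrite glME; apply: eq_bigr => c _; rewrite !mxE !dblockE.
Qed.

Lemma dblock1 i : dblock i 1%g = 1%g.
Proof. by apply: (mulgI (dblock i 1%g)); rewrite -dblockM ?group1 // !mulg1. Qed.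

Definition Dblk i : pred 'I_N := fun k => blk k == i.
Local Notation T i := (cS_group X bcol (Dblk i)).

Lemma satD i : saturated bcol (Dblk i).
Proof. by move=> k l /val_inj; rewrite /Dblk => ->. Qed.

(** The embedding of the i-th factor, inverse to [dblock i] on [T i]. *)
Definition eblock i (y : hT i) : gT := gl_of X
  (\matrix_(k, l) if (blk k == i) && (blk l == i) then Y i y (off i k) (off i l)
                  else (k == l)%:R).

Lemma eblockE i y k l : X (@eblock i y) k l =
  if (blk k == i) && (blk l == i) then Y i y (off i k) (off i l) else (k == l)%:R.
Proof.
rewrite gl_ofK ?mxE //.
pose M y : 'M[F]_N := \matrix_(k, l) if (blk k == i) && (blk l == i)
  then Y i y (off i k) (off i l) else (k == l)%:R.
suffices : M y *m M y^-1%g = 1%:M by case/mulmx1_unit.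
apply/matrixP=> k' l'; rewrite !mxE; case: (blk k' =P i) => [bk | nbk]; last first.
  rewrite (bigD1 k') //= !mxE (introF eqP nbk) /= eqxx mul1r big1 ?addr0 // => p npk.
  by rewrite mxE (introF eqP nbk) /= eq_sym (negPf npk) mul0r.
rewrite (bigID (fun k => blk k == i)) /= [X in _ + X]big1 ?addr0 => [|p nbp]; last first.
  rewrite mxE bk eqxx (negPf nbp) /=; case: (k' =P p) => [kp | _]; last by rewrite mul0r.
  by rewrite -kp bk eqxx in nbp.
rewrite sum_block; case: (blk l' =P i) => [bl | nbl].
  transitivity (Y i (y * y^-1)%g (off i k') (off i l')).
    by rewrite glME; apply: eq_bigr => a _; rewrite !mxE bk bl !blk_emb eqxx /= off_emb.
  rewrite mulgV gl1E; congr (_ %:R).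
  by rewrite -(inj_eq (can_inj (@off_emb i))) !emb_off.
rewrite big1 => [|a _].
  by case: (k' =P l') => // kl; case: nbl; rewrite -kl.
rewrite !mxE (introF eqP nbl) andbF.
case: (@emb i a =P l') => [al | _]; last by rewrite mulr0.
by case: nbl; rewrite -al blk_emb.
Qed.

Lemma eblock_T i y : @eblock i y \in T i.
Proof.
apply/cSP; split=> [|k l nk].
  apply/cLP=> k l; rewrite eblockE /bcol; case: ifP => [/andP[/eqP-> /eqP->] // | _].
  by case: (k =P l) => [-> | _]; rewrite ?eqxx.
by rewrite eblockE -[blk k == i]/(Dblk i k) (negPf nk).
Qed.

Lemma T_sub_L i : T i \subset L.
Proof. by apply/subsetP=> x /cSP[]. Qed.

Lemma eblock_L i y : @eblock i y \in L.
Proof. exact: subsetP (T_sub_L i) _ (eblock_T y). Qed.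

Lemma dblock_eblock i y : dblock i (@eblock i y) = y.
Proof.
apply: (gl_eqP (X := Y i)) => a b.
by rewrite dblockE ?eblock_L // eblockE !blk_emb eqxx !off_emb.
Qed.

Lemma dblock_T i j x : x \in T i -> j != i -> dblock j x = 1%g.
Proof.
case/cSP=> Lx hx nji; apply: (gl_eqP (X := Y j)) => a b.
rewrite dblockE // hx; last by rewrite /Dblk blk_emb.
by rewrite gl1E (can_eq (@off_emb j)).
Qed.

Lemma eblock_dblock i x : x \in T i -> eblock (dblock i x) = x.
Proof.
case/cSP=> Lx hx; apply: (gl_eqP (X := X)) => k l; rewrite eblockE.
case: (blk k =P i) => [bk | nbk] /=; last first.
  by rewrite hx //; apply/eqP.
case: (blk l =P i) => [bl | nbl]; first by rewrite dblockE // !emb_off.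
have [-> | nz] := eqVneq (X x k l) 0.
  by case: (k =P l) => // kl; case: nbl; rewrite -kl.
by case: nbl; rewrite -bk (L_blk Lx nz).
Qed.

Lemma L_eqP x y : x \in L -> y \in L -> (forall i, dblock i x = dblock i y) -> x = y.
Proof.
move=> Lx Ly eqd; apply: (gl_eqP (X := X)) => k l.
case: (blk l =P blk k) => [blk_lk | nlk].
  have := congr1 (fun z => Y (blk k) z (off (blk k) k) (off (blk k) l)) (eqd (blk k)).
  by rewrite /= !dblockE // !emb_off.
have zero z : z \in L -> X z k l = 0.
  by move=> Lz; apply/eqP; apply: contra_notT nlk => /(L_blk Lz).
by rewrite !zero.
Qed.

Definition tensor : {ffun gT -> K} :=
  [ffun x => (\prod_i psi i (dblock i x)) *+ (x \in L)].

Lemma tensorE x : x \in L -> tensor x = \prod_i psi i (dblock i x).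
Proof. by move=> Lx; rewrite ffunE Lx. Qed.

Lemma is_char_tensor : is_char L tensor.
Proof.
pose f i : {ffun gT -> K} := [ffun x => psi i (dblock i x) *+ (x \in L)].
have chf i : is_char L (f i).
  apply: (is_char_pull _ (@dblockM i) (irr_is_char (psi_irr i))) => x _.
  by rewrite inE.
suffices chprod (s : seq 'I_r) :
    is_char L [ffun x => (\prod_(i <- s) psi i (dblock i x)) *+ (x \in L)].
  exact: chprod.
elim: s => [|i s IHs].
  rewrite (_ : [ffun x => _] = [ffun x => (x \in L)%:R]); first exact: is_char_one.
  by apply/ffunP=> x; rewrite !ffunE big_nil.
rewrite (_ : [ffun x => _] = [ffun x => f i x *
    [ffun x => (\prod_(i <- s) psi i (dblock i x)) *+ (x \in L)] x]).
  exact: is_charM.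
apply/ffunP=> x; rewrite !ffunE big_cons; case: (x \in L) => //.
by rewrite !mulr0n mul0r.
Qed.

Lemma big_T (V : nmodType) i (f : hT i -> V) :
  \sum_(x in T i) f (dblock i x) = \sum_y f y.
Proof.
rewrite (reindex (@eblock i)) /=; last first.
  exists (dblock i) => [y _ | x Tx]; [exact: dblock_eblock | exact: eblock_dblock].
by apply: eq_big => [y | y _]; rewrite ?eblock_T ?dblock_eblock.
Qed.

Definition assemble (f : {ffun 'I_r -> gT}) : gT := (\prod_i f i)%g.

Lemma assembleP (f : {ffun 'I_r -> gT}) : (forall i, f i \in T i) ->
  assemble f \in L /\ forall i, dblock i (assemble f) = dblock i (f i).
Proof.
move=> Tf; have Lf i : f i \in L := subsetP (T_sub_L i) _ (Tf i).
rewrite /assemble; split=> [|i]; first by apply: group_prod.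
have: uniq (index_enum 'I_r) := index_enum_uniq _.
suffices E (s : seq 'I_r) : uniq s ->
    dblock i (\prod_(j <- s) f j)%g = if i \in s then dblock i (f i) else 1%g.
  by move/E => ->; rewrite mem_index_enum.
elim: s => [_ | j s IHs] /=; first by rewrite big_nil dblock1.
case/andP=> js us; rewrite big_cons dblockM ?group_prod // (IHs us) in_cons.
case: (eqVneq i j) => [ij | ij] /=.
  by rewrite ij (negPf js) mulg1.
by rewrite (dblock_T (Tf j) ij) mul1g.
Qed.

(** L is the direct product of the [T i]: choosing one element of each factor and multiplying is a
    bijection. *)
Lemma sum_tensor (g : forall i, hT i -> K) :
  \sum_(x in L) \prod_i g i (dblock i x) = \prod_i \sum_y g i y.
Proof.
transitivity (\prod_i \sum_(x in T i) g i (dblock i x)); last first.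
  by apply: eq_bigr => i _; apply: big_T.
rewrite (bigA_distr_big_dep (fun i => [in T i])) /=.
rewrite (reindex_onto assemble (fun x => [ffun i => eblock (dblock i x)])) /=.
  apply: eq_big => [f | f /andP[_ /eqP <-]].
    apply/andP/familyP => [[Lf /eqP <-] i | Tf].
      by rewrite ffunE; apply: eblock_T.
    have [Lf Df] := assembleP Tf; split=> //; apply/eqP/ffunP=> i.
    by rewrite ffunE Df eblock_dblock //; apply: Tf.
  have Tg i : [ffun i0 => eblock (dblock i0 (assemble f))] i \in T i.
    by rewrite ffunE eblock_T.
  have [_ Dg] := assembleP Tg.
  by apply: eq_bigr => i _; rewrite Dg.
move=> x Lx; set f := [ffun i => _].
have Tf i : f i \in T i by rewrite ffunE; apply: eblock_T.
have [Lf Df] := assembleP Tf; apply: L_eqP => // i.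
by rewrite Df ffunE dblock_eblock.
Qed.

Lemma dblockV i x : x \in L -> dblock i x^-1%g = (dblock i x)^-1%g.
Proof.
move=> Lx; apply: (mulgI (dblock i x)).
by rewrite -dblockM ?groupV // !mulgV dblock1.
Qed.

Lemma tensor_irr : is_irr_char L tensor.
Proof.
apply: (cdot1_irr charK0 is_char_tensor).
have cardL : #|L|%:R = \prod_i #|hT i|%:R :> K.
  have := sum_tensor (fun i (_ : hT i) => 1); rewrite big1_eq sumr_const => ->.
  by apply: eq_bigr => i _; rewrite sumr_const.
rewrite /cdot cardL (eq_bigr (fun x =>
    \prod_i (psi i (dblock i x) * psi i (dblock i x)^-1%g))); last first.
  move=> x Lx; rewrite !tensorE ?groupV // -big_split; apply: eq_bigr => i _.
  by rewrite dblockV.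
rewrite (sum_tensor (fun i y => psi i y * psi i y^-1%g)) -prodfV -big_split big1 //= => i _.
have := irr_cdot1 charK0 (psi_irr i); rewrite /cdot cardsT => E; rewrite -[RHS]E.
by congr (_ * _); apply: eq_bigl => x; rewrite inE.
Qed.

Lemma mem_cU_dblock (c : 'I_N -> nat) x : x \in L ->
  (x \in cU X c) = [forall i, dblock i x \in cU (Y i) (c \o @emb i)].
Proof.
move=> Lx; apply/idP/forallP=> [/setIdP[/cPP Px /forallP Ux] i | Ux].
  apply/setIdP; split.
    by apply/cPP=> a b; rewrite dblockE //; apply: Px.
  apply/forallP=> a; apply/forallP=> b; apply/implyP=> eab.
  have /forallP/(_ (emb b))/implyP/(_ eab) := Ux (emb a).
  by rewrite dblockE // (can_eq (@off_emb i)).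
have nzP k l : X x k l != 0 -> blk l = blk k by move/(L_blk Lx).
have DX k l : blk l = blk k ->
    X x k l = Y (blk k) (dblock (blk k) x) (off (blk k) k) (off (blk k) l).
  by move=> e; rewrite dblockE // !emb_off.
apply/setIdP; split.
  apply/cPP=> k l nz; have e := nzP _ _ nz; move: nz; rewrite DX //.
  have /setIdP[/cPP Px _] := Ux (blk k).
  by move/Px; rewrite /= !emb_off.
apply/forallP=> k; apply/forallP=> l; apply/implyP=> ekl.
case: (eqVneq (blk l) (blk k)) => [e | ne].
  have /setIdP[_ /forallP/(_ (off (blk k) k))/forallP/(_ (off (blk k) l))] := Ux (blk k).
  rewrite /= !emb_off // => /implyP/(_ ekl); rewrite -DX //.
  suffices -> : (off (blk k) k == off (blk k) l) = (k == l) by [].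
  apply/eqP/eqP=> [|-> //].
  by move/(congr1 (@emb (blk k))); rewrite !emb_off.
have -> : X x k l = 0 by apply/eqP; apply: contraNT ne => /nzP ->.
by case: (k =P l) ne => [-> | //]; rewrite eqxx.
Qed.

(** The intersection of U_c with L is the product of the corresponding groups in the factors, so the
    sum factorises; c is not constant on the block of k, whose factor vanishes. *)
Lemma tensor_cuspidal :
    (forall i (c : 'I_(m i) -> nat), (exists a b, c a <> c b) ->
       \sum_(u in cU (Y i) c) psi i u = 0) ->
  cuspidal_on X bcol tensor.
Proof.
move=> cusp c [k [l [/val_inj bkl ckl]]].
pose g i y := psi i y *+ (y \in cU (Y i) (c \o @emb i)).
transitivity (\sum_(x in L) \prod_i g i (dblock i x)).
  rewrite (eq_bigl (fun x => (x \in L) && (x \in cU X c))) => [|x]; last first.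
    by rewrite inE andbC.
  rewrite big_mkcondr /=; apply: eq_bigr => x Lx; rewrite mem_cU_dblock //.
  case: forallP => [Ux | nUx].
    by rewrite tensorE //; apply: eq_bigr => i _; rewrite /g Ux.
  have [i nUi] : exists i, dblock i x \notin cU (Y i) (c \o @emb i).
    by apply/existsP; apply: contra_notT nUx => /existsPn h i; rewrite -[_ \in _]negbK.
  by rewrite (bigD1 i) //= /g (negPf nUi) mulr0n mul0r.
rewrite sum_tensor (bigD1 (blk k)) //= -[X in X * _]/(\sum_y _ *+ _).
rewrite (eq_bigr (fun y => if y \in cU (Y (blk k)) (c \o @emb (blk k)) then psi (blk k) y else 0)).
  rewrite -big_mkcond cusp ?mul0r //.
  by exists (off (blk k) k), (off (blk k) l); rewrite /= !emb_off.
by move=> y _; rewrite mulrb.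
Qed.

Lemma tensor_T i x : x \in T i ->
  tensor x = psi i (dblock i x) * \prod_(j | j != i) psi j 1%g.
Proof.
move=> Tx; rewrite tensorE ?(subsetP (T_sub_L i)) // (bigD1 i) //=.
by congr (_ * _); apply: eq_bigr => j nji; rewrite (dblock_T Tx nji).
Qed.

Lemma prod_psi1_neq0 i : \prod_(j | j != i) psi j 1%g != 0.
Proof. by apply/prodf_neq0 => j _; apply: (irr_char1_neq0 charK0 (psi_irr j)). Qed.

(** Conjugation by s carries the factor of i to that of j. On each of them the tensor product is a
    single psi times the degrees of the others, which are the constants D and D'. *)
Lemma stab_psi_factors (s : 'S_N) k : s \in stab_psi X bcol tensor ->
  let i := blk k in let j := blk (s k) in
  exists pi : 'I_(m i) -> 'I_(m j), [/\ bijective pi &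
    exists D D' : K, [/\ D != 0, D' != 0 &
      forall y y', (forall a b, Y j y' (pi a) (pi b) = Y i y a b) ->
        psi i y * D = psi j y' * D']].
Proof.
case/stab_psiP=> sb /ffunP Js i j; pose pi a := off j (s (@emb i a)).
have same x y : (blk x == blk y) = (blk (s x) == blk (s y)) := sb x y.
have sij x : blk x = i -> blk (s x) = j by move=> bx; apply/eqP; rewrite -same bx.
have sji x : blk x = j -> blk ((s^-1)%g x) = i.
  by move=> bx; apply/eqP; rewrite same permKV bx.
exists pi; split.
  exists (fun a => off i ((s^-1)%g (@emb j a))) => a; rewrite /pi emb_off ?permK ?permKV ?off_emb //.
    by apply: sij; rewrite blk_emb.
  by apply: sji; rewrite blk_emb.
exists (\prod_(l | l != i) psi l 1%g), (\prod_(l | l != j) psi l 1%g).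
split; rewrite ?prod_psi1_neq0 // => y y' eqy.
have := Js (eblock y); rewrite [LHS]ffunE.
have -> : (eblock y ^ gl_perm X s)%g = eblock y'.
  apply: (gl_eqP (X := X)) => x z; rewrite -[x](permKV s) -[z](permKV s).
  move: (s^-1%g x) (s^-1%g z) => u v.
  rewrite gl_conj_perm !eblockE (inj_eq perm_inj).
  have E w : (blk (s w) == j) = (blk w == i) by rewrite /j -same.
  rewrite (E u) (E v); case: (blk u =P i) => //= bu; case: (blk v =P i) => //= bv.
  by rewrite -{2}(emb_off bu) -{2}(emb_off bv) -eqy.
by rewrite !(tensor_T (eblock_T _)) !dblock_eblock.
Qed.

(** Conjugation by t merely rearranges the factors of the product according to sg. *)
Lemma stab_psi_swap (t : 'S_N) (sg : {perm 'I_r}) :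
    (forall k, blk (t k) = sg (blk k)) ->
    (forall i y y', (forall k l, blk k = i -> blk l = i ->
         Y (sg i) y' (off (sg i) (t k)) (off (sg i) (t l)) = Y i y (off i k) (off i l)) ->
       psi (sg i) y' = psi i y) ->
  t \in stab_psi X bcol tensor.
Proof.
move=> bt eqpsi.
have sb : same_blocks bcol (bcol \o t).
  by move=> k l; rewrite /bcol /= !(inj_eq val_inj) !bt (inj_eq perm_inj).
apply/stab_psiP; split=> //; apply/ffunP=> x; rewrite [LHS]ffunE.
have Lxt : (x ^ gl_perm X t \in L)%g = (x \in L).
  by rewrite mem_cL_perm; rewrite -[cL X (bcol \o t)]/(cL_group X (bcol \o t) : {set gT}) -(same_cL X sb).
rewrite /tensor [LHS]ffunE [RHS]ffunE Lxt; case: (boolP (x \in L)) => // Lx.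
rewrite !mulr1n (reindex_inj (@perm_inj _ sg)) /=; apply: eq_bigr => i _.
apply: eqpsi => k l bk bl; rewrite !dblockE ?Lxt // !emb_off ?bt ?bk ?bl //.
exact: gl_conj_perm.
Qed.

End TensorLevi.

(** * Comparison with Harish-Chandra induction through complements *)

Section AbstractHC.

Variables (K : closedFieldType) (F : fieldType) (N : nat) (gT : finGroupType).
Variable X : gl_model F N gT.
Implicit Types (c d : 'I_N -> nat) (theta : {ffun gT -> K}).

Lemma cL_proper c : (cL X c \proper [set: gT]) -> exists a b, c a <> c b.
Proof.
move=> prop; have [/existsP[a /existsP[b /eqP]] | /existsPn cst] :=
  boolP [exists a, exists b, c a != c b]; first by exists a, b.
case/properP: prop => _ [x _ /cLP[]] a b _; apply/eqP; rewrite -[_ == _]negbK.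
by apply: contra (cst a) => nab; apply/existsP; exists b.
Qed.

Lemma proper_cL c a b : c a <> c b -> cL X c \proper [set: gT].
Proof.
move=> cab; apply/properP; split; first exact: subsetT.
exists (gl_perm X (tperm a b)) => //; apply/cLP=> /(_ a b) h.
by apply/cab/h; rewrite gl_permE tpermL eqxx oner_neq0.
Qed.

Lemma same_infl c theta theta' : {in cL X c, theta =1 theta'} ->
  infl X c theta = infl X c theta'.
Proof.
move=> eqth; apply/ffunP=> x; rewrite !ffunE; case: (boolP (x \in _)) => // Px.
by rewrite eqth ?lpart_L.
Qed.

Lemma eq_HCind c d theta : c =1 d -> HCind X c theta = HCind X d theta.
Proof.
move=> cd; have Pcd : cP X c = cP X d by apply: eq_cP => a b; rewrite !cd.
have Lcd x : lpart X c x = lpart X d x by apply: same_lpart => a b; rewrite !cd.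
apply/ffunP=> x; rewrite !ffunE /= Pcd; congr (_ * _); apply: eq_bigr => y _.
by rewrite !ffunE Pcd Lcd.
Qed.

(** As U_c and L_c meet trivially, [remgr] finds the same Levi component as [lpart]; the conjugation
    by g passes from the subgroups to theta. *)
Lemma HC_ind_conj c g theta :
  HC_ind [set: gT]%G (cP_group X c :^ g)%G (cU_group X c :^ g)%G (cL_group X c :^ g)%G theta
    = HCind X c (conjfun g theta).
Proof.
have inflJ x : char_infl (cP_group X c :^ g)%G (cU_group X c :^ g)%G (cL_group X c :^ g)%G
    theta (x ^ g)%g = infl X c (conjfun g theta) x.
  rewrite [LHS]ffunE [RHS]ffunE /= memJ_conjg; case: (boolP (x \in cP X c)) => // Px.
  congr (_ *+ _); rewrite ffunE; congr (theta _).
  have -> : (x ^ g)%g = ((x * (lpart X c x)^-1) ^ g * lpart X c x ^ g)%g.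
    by rewrite -conjMg mulgKV.
  rewrite remgrMid //.
  - apply/trivgP/subsetP=> y; rewrite inE !mem_conjg => /andP[/cUP[_ ly] Ly].
    by rewrite -[y](conjgKV g) -(lpart_id Ly) ly conj1g set11.
  - by rewrite memJ_conjg cU_div.
  by rewrite memJ_conjg lpart_L.
apply/ffunP=> x; rewrite !ffunE /= cardJg; congr (_ * _).
rewrite (reindex_inj (mulIg g)) /=.
by apply: eq_big => [y | y _]; rewrite ?inE // conjgM inflJ.
Qed.

Lemma HC_indE c theta :
  HC_ind [set: gT]%G (cP_group X c) (cU_group X c) (cL_group X c) theta = HCind X c theta.
Proof.
have e (H : {group gT}) : H = (H :^ 1)%G by apply: val_inj; rewrite /= conjsg1.
rewrite [cP_group _ _]e [cU_group _ _]e [cL_group _ _]e HC_ind_conj; congr (HCind X c _).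
by apply/ffunP=> x; rewrite ffunE conjg1.
Qed.

End AbstractHC.

(** * Specialisation to GL_n(F) *)

Section GeneralLinear.

Variables (K : closedFieldType) (charK0 : [pchar K] =i pred0) (F : finFieldType).

Fact GL_ofK n (M : 'M[F]_n.-1.+1) :
  M \in unitmx -> GLval (insubd (1%g : {'GL_n[F]}) M) = M.
Proof. by move=> uM; rewrite [LHS]val_insubd [_ \is a _]uM. Qed.

Definition GLX n : gl_model F n.-1.+1 {'GL_n[F]} :=
  @GLModel F n.-1.+1 {'GL_n[F]} (@GLval n F) (insubd (1%g : {'GL_n[F]})) (@GL_1E n F)
    (@GL_MxE n F) val_inj (@GL_ofK n).

Lemma std_parabolicE n mu : std_parabolic_group F n mu = cP_group (GLX n) (@block_of n mu).
Proof. exact: val_inj. Qed.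

Lemma std_leviE n mu : std_levi_group F n mu = cL_group (GLX n) (@block_of n mu).
Proof. exact: val_inj. Qed.

Lemma std_unipotentE n mu : std_unipotent_group F n mu = cU_group (GLX n) (@block_of n mu).
Proof. exact: val_inj. Qed.

Lemma HC_ind_levi n (P U L : {group {'GL_n[F]}}) : levi_decomposition P U L ->
  exists mu g, [/\ is_composition mu n, L = (cL_group (GLX n) (@block_of n mu) :^ g)%G
    & forall theta : GLfun K F n,
      HC_ind 'GL_n[F] P U L theta = HCind (GLX n) (@block_of n mu) (conjfun g theta)].
Proof.
move=> [mu [g [comp -> -> ->]]]; exists mu, g.
rewrite std_parabolicE std_unipotentE std_leviE; split=> // theta.
exact: HC_ind_conj.
Qed.

Lemma levi_coloring n c : (0 < n)%N ->
  levi_decomposition (cP_group (GLX n) c) (cU_group (GLX n) c) (cL_group (GLX n) c).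
Proof.
move=> n0; have [mu [s [comp eqmu]]] := coloring_composition c.
rewrite prednK // in comp; exists mu, (gl_perm (GLX n) s).
have eqc a b : (@block_of n mu ((s^-1)%g a) <= @block_of n mu ((s^-1)%g b))%N = (c a <= c b)%N.
  by rewrite -eqmu !permKV.
have eqLc a b : (@block_of n mu ((s^-1)%g a) == @block_of n mu ((s^-1)%g b)) = (c a == c b).
  by rewrite !eqn_leq !eqc.
rewrite std_parabolicE std_unipotentE std_leviE; split=> //; apply: val_inj.
- by rewrite /= cPJ; apply: eq_cP => a b; rewrite -eqc.
- rewrite /= cUJ; apply/setP=> x; rewrite !inE; congr (_ && _).
    by apply: eq_forallb => a; apply: eq_forallb => b; rewrite -eqc.
  by apply: eq_forallb => a; apply: eq_forallb => b; rewrite -eqLc.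
by rewrite /= cLJ; apply: eq_cL => a b; rewrite -eqLc.
Qed.

(** A nonzero sum would give the restriction of chi to P_c an irreducible constituent on which U_c
    is trivial. It is inflated from L_c, and Frobenius reciprocity makes chi a constituent of its
    induction. *)
Lemma cuspidal_sum0 n (chi : GLfun K F n) c : (0 < n)%N ->
    is_irr_char 'GL_n[F] chi -> cuspidal chi -> (exists a b, c a <> c b) ->
  \sum_(u in cU (GLX n) c) chi u = 0.
Proof.
move=> n0 irr_chi cusp [a [b cab]]; have ch_chi := irr_is_char irr_chi.
apply/eqP; apply: contraT => nz.
pose X := GLX n; pose P := cP_group X c; pose U := cU_group X c; pose L := cL_group X c.
have sUP : U \subset P := cU_sub_cP X c.
have sLP : L \subset P := cL_sub_cP X c.
pose f := char_res P chi; have chf : is_char P f by apply: is_char_res (subsetT _) ch_chi.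
have [| om [const nz_om]] := @char_subconstituent K charK0 _ P U f [ffun=> 1] chf.
  rewrite /cdot mulf_neq0 ?invr_eq0 ?card_neq0 //.
  rewrite (eq_bigr chi) // => u Uu.
  by rewrite [X in _ * X]ffunE mulr1 char_resE // (subsetP sUP).
have irr_om := const.1; have ch_om := irr_is_char irr_om.
have nz_sum : \sum_(u in U) om u != 0 by apply: sum_fixed_neq0 nz_om => u _; rewrite !ffunE.
have tr_om := irr_norm_trivial irr_om sUP (cU_norm X c) nz_sum.
pose th := char_res L om; have ch_th : is_char L th := is_char_res sLP ch_om.
have infl_th : infl X c th = om.
  apply/ffunP=> x; case: (boolP (x \in cP X c)) => Px.
    by rewrite inflE // char_resE ?lpart_L //; apply: lpart_trivial.
  by rewrite infl_out // (char_out ch_om).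
case: (cusp _ _ _ th (levi_coloring c n0) (proper_cL X cab) ch_th).
change (irr_constituent [set: {'GL_n[F]}]%G (HC_ind [set: {'GL_n[F]}]%G P U L th) chi).
rewrite HC_indE; apply: (cdot_constituent charK0) => //; first exact: HCind_char.
rewrite /HCind infl_th (Frobenius charK0) ?subsetT //; last first.
  by move=> x Px; rewrite (char_out ch_om).
have := irr_constituent_cdot charK0 const; rewrite cdotC.
by rewrite (@eq_cdotG _ _ P om om f chi) // => x Px; rewrite char_resE.
Qed.

(** y and y' have different types until the tagged equality identifies m and m', hence the
    comparison of entries through [inord]. *)
Lemma Tagged_GLfun_entries m m' (f : GLfun K F m) (f' : GLfun K F m')
    (y : {'GL_m[F]}) (y' : {'GL_m'[F]}) :
    Tagged (GLfun K F) f = Tagged (GLfun K F) f' ->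
    (forall a b : nat, (a < m.-1.+1)%N -> (b < m.-1.+1)%N ->
      GLval y (inord a) (inord b) = GLval y' (inord a) (inord b)) ->
  f y = f' y'.
Proof.
move=> eqff; have mm' : m = m' := congr1 tag eqff.
move: f' y' eqff; rewrite -mm' => f' y' eqff eqy.
have <- : f = f' by apply: eq_from_Tagged eqff.
congr (f _); apply: val_inj; apply/matrixP=> a b.
by have := eqy a b (ltn_ord a) (ltn_ord b); rewrite !inord_val.
Qed.

(** The bijection gives m = m' and then a permutation matrix, under which f' is invariant. So f is a
    nonzero multiple of f', and proportional irreducible characters are equal. *)
Lemma irr_GLfun_conj m m' (f : GLfun K F m) (f' : GLfun K F m')
    (p : 'I_m.-1.+1 -> 'I_m'.-1.+1) (D D' : K) :
    (0 < m)%N -> (0 < m')%N -> is_irr_char 'GL_m[F] f -> is_irr_char 'GL_m'[F] f' ->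
    bijective p -> D != 0 -> D' != 0 ->
    (forall y y', (forall a b, GLval y' (p a) (p b) = GLval y a b) -> f y * D = f' y' * D') ->
  Tagged (GLfun K F) f = Tagged (GLfun K F) f'.
Proof.
move=> m0 m0' irrf irrf' bij_p D0 D0' eqff.
have mm' : m = m'.
  by have := bij_eq_card bij_p; rewrite !card_ord !prednK.
move: f' p irrf' bij_p eqff; rewrite -mm' => f' p irrf' bij_p eqff.
pose s := perm (bij_inj bij_p).
suffices fE y : f y = (D' / D) * f' y.
  congr Tagged; apply: (irr_cdot_eq charK0 irrf irrf').
  have -> : cdot (GLgroup m F) f f' = (D' / D) * cdot (GLgroup m F) f' f'.
    rewrite /cdot mulrCA; congr (_ * _); rewrite mulr_sumr.
    by apply: eq_bigr => x _; rewrite fE mulrA.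
  by rewrite (irr_cdot1 charK0 irrf') mulr1 mulf_neq0 ?invr_eq0.
apply: (mulIf D0); rewrite (eqff y (y ^ gl_perm (GLX m) s)%g) => [|a b].
  by rewrite (charJ _ (irr_is_char irrf')) ?inE //; field.
by rewrite -(gl_conj_perm (GLX m) s y a b) !permE.
Qed.

Section TensorCharacter.

Variables (n : nat) (lam : seq nat).
Hypotheses (n0 : (0 < n)%N) (lam_comp : is_composition lam n).
Variable psi : forall i : 'I_(size lam), GLfun K F (nth 0%N lam i).
Hypothesis psi_irr : forall i : 'I_(size lam), is_irr_char 'GL_(nth 0%N lam i)[F] (psi i).

Let part (i : 'I_(size lam)) : nat := (nth 0%N lam i).-1.+1.
Let Y (i : 'I_(size lam)) : gl_model F (part i) {'GL_(nth 0%N lam i)[F]} := GLX _.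

Let nth_lam_gt0 i : (i < size lam)%N -> (0 < nth 0%N lam i)%N.
Proof.
move=> lti; rewrite lt0n; case/andP: lam_comp => lam0 _.
by apply: contraNneq lam0 => <-; apply: mem_nth.
Qed.

Let partE (i : 'I_(size lam)) : part i = nth 0%N lam i.
Proof. by rewrite /part prednK // nth_lam_gt0. Qed.

Let sumn_lam : sumn lam = n.-1.+1.
Proof. by case/andP: lam_comp => _ /eqP ->; rewrite prednK. Qed.

Let blk_lt (k : 'I_n.-1.+1) : (reshape_index lam k < size lam)%N.
Proof. by apply: reshape_indexP; rewrite sumn_lam. Qed.

Let blk (k : 'I_n.-1.+1) : 'I_(size lam) := Ordinal (blk_lt k).
Let emb (i : 'I_(size lam)) (a : 'I_(part i)) : 'I_n.-1.+1 := inord (flatten_index lam i a).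
Let off (i : 'I_(size lam)) (k : 'I_n.-1.+1) : 'I_(part i) := inord (reshape_offset lam k).

Let val_emb i a : val (@emb i a) = flatten_index lam i a.
Proof. by rewrite /= inordK // -sumn_lam; apply: flatten_indexP; rewrite -partE. Qed.

Let blk_emb i a : blk (@emb i a) = i.
Proof. by apply: val_inj; rewrite /= -/(val (emb a)) val_emb flatten_indexKl // -partE. Qed.

Let offset_emb i a : reshape_offset lam (@emb i a) = a.
Proof. by rewrite -/(val (emb a)) val_emb flatten_indexKr // -partE. Qed.

Let off_emb i a : off i (@emb i a) = a.
Proof. by rewrite /off offset_emb inord_val. Qed.

Let offset_lt (k : 'I_n.-1.+1) : (reshape_offset lam k < part (blk k))%N.
Proof. by rewrite partE; apply: reshape_offsetP; rewrite sumn_lam. Qed.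

Let val_off i k : blk k = i -> val (off i k) = reshape_offset lam k.
Proof. by move=> <-; rewrite /= inordK ?offset_lt. Qed.

Let emb_off i k : blk k = i -> emb (off i k) = k.
Proof.
move=> bk; apply: val_inj; rewrite val_emb val_off // -bk.
exact: reshape_indexK.
Qed.

Let b0 := @block_of n lam.
Let psi0 := levi_tensor n psi.

Lemma block_of_lt k : (b0 k < size lam)%N.
Proof. exact: blk_lt. Qed.

Lemma block_of_onto (i : 'I_(size lam)) : exists k, b0 k = i.
Proof. by exists (@emb i ord0); have := congr1 val (blk_emb (i := i) ord0). Qed.

Lemma levi_tensor_irr : is_irr_char (cL_group (GLX n) b0) psi0.
Proof. exact: (tensor_irr charK0 (GLX n) Y blk_emb emb_off off_emb psi_irr). Qed.

Lemma levi_tensor_cuspidal : (forall i, cuspidal (psi i)) -> cuspidal_on (GLX n) b0 psi0.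
Proof.
move=> cusp; apply: (tensor_cuspidal (GLX n) (Y := Y) blk_emb emb_off off_emb) => i c nc.
by apply: cuspidal_sum0 nc; rewrite ?nth_lam_gt0.
Qed.

Lemma stab_levi_tensor (s : 'S_n.-1.+1) k (i j : 'I_(size lam)) :
    s \in stab_psi (GLX n) b0 psi0 -> i = b0 k :> nat -> j = b0 (s k) :> nat ->
  Tagged (GLfun K F) (psi i) = Tagged (GLfun K F) (psi j).
Proof.
move=> + ik jk; have -> : i = blk k by apply: val_inj.
have -> : j = blk (s k) by apply: val_inj.
move=> /(stab_psi_factors (Y := Y) charK0 blk_emb emb_off off_emb psi_irr k).
case=> p [bij_p [D [D' [D0 D0' eqD]]]].
by apply: (irr_GLfun_conj (p := p) _ _ _ _ bij_p D0 D0' eqD); rewrite ?nth_lam_gt0.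
Qed.

Lemma levi_tensor_swap i j : all_factors_equal psi -> b0 i <> b0 j ->
  exists t, block_swap (GLX n) b0 psi0 i j t.
Proof.
move=> all_eq bij; pose sg := tperm (blk i) (blk j).
have part_eq h l : part h = part l by rewrite /part (congr1 tag (all_eq h l) : nth _ _ _ = _).
(* t0 changes the block by sg and keeps the offset inside it, which is possible because all parts
   are equal. *)
pose t0 k := emb (off (sg (blk k)) k).
have bt0 k : blk (t0 k) = sg (blk k) by rewrite /t0 blk_emb.
have offt0 k : reshape_offset lam (t0 k) = reshape_offset lam k.
  rewrite /t0 offset_emb /= inordK //.
  by rewrite -/(part _) (part_eq _ (blk k)) offset_lt.
have t0K : involutive t0.
  move=> k; rewrite {1}/t0 /off offt0 bt0 -[RHS](@emb_off (blk k)) //.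
  by rewrite /off /sg tpermK.
pose t := perm (inv_inj t0K); have tE k : t k = t0 k by rewrite permE.
have bi k l : b0 k = b0 l <-> blk k = blk l.
  by split=> [e | /(congr1 val)]; first exact: val_inj.
exists t; split=> [|k /bi e|k /bi e|k ni nj|k]; last by rewrite !tE t0K.
- apply: (stab_psi_swap (GLX n) (Y := Y) (sg := sg) blk_emb emb_off off_emb).
    by move=> k; rewrite tE bt0.
  move=> l y y' eqy; apply: Tagged_GLfun_entries (all_eq _ _) _ => a b lta ltb.
  have lta' : (a < part l)%N by rewrite (part_eq _ (sg l)).
  have ltb' : (b < part l)%N by rewrite (part_eq _ (sg l)).
  have := eqy _ _ (blk_emb (Ordinal lta')) (blk_emb (Ordinal ltb')).
  by rewrite !tE /off !offt0 !offset_emb.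
- by apply/bi; rewrite tE bt0 e /sg tpermL.
- by apply/bi; rewrite tE bt0 e /sg tpermR.
rewrite tE /t0 emb_off // /sg tpermD //; apply/eqP.
  by move/bi/esym.
by move/bi/esym.
Qed.

End TensorCharacter.

End GeneralLinear.

Theorem proposition9p1 (K : closedFieldType) (charK0 : [pchar K] =i pred0)
    (F : finFieldType) (n : nat) (n_ge2 : (2 <= n)%N)
    (lam : seq nat) (lam_comp : is_composition lam n)
    (r_ge2 : (2 <= size lam)%N)
    (psi : forall i : 'I_(size lam), GLfun K F (nth 0%N lam i))
    (psi_irr : forall i : 'I_(size lam), is_irr_char 'GL_(nth 0%N lam i)[F] (psi i))
    (psi_cusp : forall i : 'I_(size lam), cuspidal (psi i))
    (P U : {group {'GL_n[F]}})
    (P_levi : levi_decomposition P U (std_levi_group F n lam)) :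
  let R := HC_ind 'GL_n[F] P U (std_levi_group F n lam) (levi_tensor n psi) in
  (all_factors_equal psi ->
     forall chi : GLfun K F n, irr_constituent 'GL_n[F] R chi -> HC_primitive chi)
  /\
  (~ all_factors_equal psi ->
     forall chi : GLfun K F n, irr_constituent 'GL_n[F] R chi -> HC_imprimitive chi).
Proof.
have n0 : (0 < n)%N by apply: leq_trans n_ge2.
have irr_psi0 := levi_tensor_irr charK0 n0 lam_comp psi_irr.
have cusp_psi0 := levi_tensor_cuspidal charK0 n0 lam_comp psi_irr psi_cusp.
have swaps := levi_tensor_swap n0 lam_comp (psi := psi).
have stab := stab_levi_tensor charK0 n0 lam_comp psi_irr.
pose X := GLX F n; pose b := @block_of n lam; pose psi0 := levi_tensor n psi.
(* On the Levi subgroup, g acts as a permutation matrix times an element of L_0, under which psi0 is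
   invariant. The permutation is absorbed by the coloring, and independence of the parabolic
   subgroup gives the coloring b. *)
have -> : HC_ind 'GL_n[F] P U (std_levi_group F n lam) psi0 = HCind X b psi0.
  have [mu [g [_ DL ->]]] := HC_ind_levi K P_levi; pose m := @block_of n mu.
  have LJ : (cL X m :^ g)%g = cL X b by have /(congr1 val) := DL.
  have [s [l [mb Ll conj_g]]] := levi_conj LJ.
  transitivity (HCind X m (conjfun (gl_perm X s) psi0)).
    rewrite /HCind (@same_infl _ _ _ _ X m _ (conjfun (gl_perm X s) psi0)) // => x Lx.
    by rewrite [LHS]ffunE [RHS]ffunE conj_g // conjgM (charJ _ (irr_is_char irr_psi0)).
  rewrite (@eq_HCind _ _ _ _ X m ((m \o (s^-1)%g) \o s)) => [|a]; last first.
    by rewrite /= permK.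
  rewrite HCind_perm; apply: (HCind_same_blocks charK0 irr_psi0 cusp_psi0) => // a a' /=.
  by rewrite mb !permKV.
move=> R; split=> [all_eq chi const | not_all chi const].
  move=> [P' [U' [L' [theta [dec prop ch_theta Dchi]]]]].
  have [mu [g [_ DL' Dind]]] := HC_ind_levi K dec; pose m := @block_of n mu.
  rewrite {}Dind in Dchi; rewrite {}DL' in prop ch_theta.
  have nc : exists i j, m i <> m j.
    apply: (@cL_proper _ _ _ X); rewrite -(properJ _ _ g).
    by rewrite (conjGid (G := [set: _]%G)) ?inE.
  have ch : is_char (cL_group X m) (conjfun g theta).
    have := is_char_conj g ch_theta.
    by congr is_char; apply: val_inj; rewrite /= conjsgK.
  exact: (HC_series_primitive charK0 irr_psi0 cusp_psi0
            (fun i j => swaps i j all_eq) nc ch const).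
pose factor i : {m : nat & {ffun {'GL_m[F]} -> K}} := Tagged (GLfun K F) (psi i).
have [i0 [j0 ne_ij]] : exists i j, factor i != factor j.
  have [/existsP[i /existsP[j ne]] | /existsPn h] :=
    boolP [exists i, exists j, factor i != factor j]; first by exists i, j.
  case: not_all => i j; apply/eqP; apply/negPn; apply: contra (h i) => ne.
  by apply/existsP; exists j.
(* The existential avoids turning [b k] into an ordinal; [cE] evaluates it. *)
pose c k : nat := [exists i : 'I_(size lam), (i == b k :> nat) && (factor i == factor i0)].
have cE (i : 'I_(size lam)) k : b k = i -> c k = (factor i == factor i0).
  move=> bk; rewrite /c bk; congr nat_of_bool; apply/existsP/idP => [[j] | e].
    by case/andP=> /eqP/val_inj ->.
  by exists i; rewrite eqxx.
have [k bk] := block_of_onto n0 lam_comp i0; have [l bl] := block_of_onto n0 lam_comp j0.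
have ckl : c k <> c l by rewrite (cE _ _ bk) (cE _ _ bl) eqxx eq_sym (negPf ne_ij).
have [|s Ws i|theta ch_th ->] := HC_series_induced charK0 irr_psi0 cusp_psi0 (c := c) _ _ const.
- by move=> i j; rewrite /c /b => ->.
- pose h := Ordinal (block_of_lt n0 lam_comp i).
  pose h' := Ordinal (block_of_lt n0 lam_comp (s i)).
  rewrite (cE h' _ erefl) (cE h _ erefl); congr (nat_of_bool (_ == _)).
  exact/esym/(stab s i h h' Ws).
exists (cP_group X c), (cU_group X c), (cL_group X c), theta; split=> //.
- exact: levi_coloring.
- exact: proper_cL ckl.
exact/esym/HC_indE.
Qed.
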